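(* Let $X$ be a topological space, $\mathcal{O}_B$ a sheaf of $\mathbf{Q}$-algebras on $X$ and $\mathcal{O}_X$ a sheaf of $\mathcal{O}_B$-algebras. Let $\mathcal{F}$ be a sheaf of $\mathcal{O}_X$-modules and $D\colon\mathcal{O}_X\to\mathcal{F}$ an $\mathcal{O}_B$-derivation. Assume that $D$ is locally integrable, and that the sheaf of $\mathcal{O}_X$-linear maps from $\mathcal{F}$ to $\mathcal{S}(\mathcal{F})$ sending $D(\mathcal{O}_X)$ to zero has only trivial local sections. Let $\mathcal{U}$ be the collection of open subspaces $U\subseteq X$ such that $D|_U$ is integrable, and for $U\in\mathcal{U}$ let $\mathcal{C}_U$ be the collection of iterated Hasse derivations of $\mathcal{F}|_U$ extending $D|_U$. Then each $\mathcal{C}_U$ is nonempty, for any $h,h'\in\mathcal{C}_U$ there is a unique $\mathcal{O}_U$-algebra automorphism $\phi_{h,h'}$ of $\mathcal{S}(\mathcal{F})|_U$ realizing an equivalence with $h'=\phi_{h,h'}h$, and there exist an $\mathcal{O}_X$-algebra $\mathcal{J}$ and a map of $\mathcal{O}_B$-algebras $\tau\colon\mathcal{O}_X\to\mathcal{J}$, together with $\mathcal{O}_U$-algebra isomorphisms $\psi_h\colon\mathcal{J}|_U\to\mathcal{S}(\mathcal{F})|_U$ for all $U\in\mathcal{U}$ and $h\in\mathcal{C}_U$, compatible with restriction to smaller open sets, such that $\psi_h\circ\tau|_U=h$ and $\psi_{h'}=\phi_{h,h'}\psi_h$ for all $h,h'\in\mathcal{C}_U$. Moreover, for each integer $n\ge0$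 there is an $\mathcal{O}_X$-algebra quotient $\mathcal{J}^n$ of $\mathcal{J}$ such that each $\psi_h$ induces an isomorphism of $\mathcal{J}^n|_U$ with the truncation $\prod_{i=0}^n\mathcal{S}^i(\mathcal{F}|_U)$ of $\mathcal{S}(\mathcal{F}|_U)$; $\mathcal{J}^0\cong\mathcal{O}_X$; and for each $n>0$, $\mathcal{J}^{n-1}$ is a quotient $\mathcal{O}_X$-algebra of $\mathcal{J}^n$ and there is a natural exact sequence of $\mathcal{O}_X$-modules $$0\to\mathcal{S}^n(\mathcal{F})\to\mathcal{J}^n\to\mathcal{J}^{n-1}\to0,$$ where the first map is, under the $\psi_h$, the inclusion of the degree-$n$ part.
   Context: All rings are commutative $\mathbf{Q}$-algebras, apart from the tensor algebra $\mathcal{T}(\mathcal{F})$ and its quotients $\mathcal{R}(\mathcal{F})$, $\mathcal{A}(\mathcal{F})$ below. Tensor products are over $\mathcal{O}_X$. The definitions below are applied also to open subspaces $U\subseteq X$ with $\mathcal{O}_X|_U=\mathcal{O}_U$, $\mathcal{O}_B|_U$, $\mathcal{F}|_U$, $D|_U$. Tensor operations. For $n\ge 0$ let $\mathcal{T}^n(\mathcal{F})$, $\mathcal{S}^n(\mathcal{F})$, $\mathcal{A}^n(\mathcal{F})$ be the $n$-th tensor, symmetric and exterior powers of $\mathcal{F}$ over $\mathcal{O}_X$, with $\mathcal{T}(\mathcal{F})=\prod_{n\ge0}\mathcal{T}^n(\mathcal{F})$ and $\mathcal{S}(\mathcal{F})=\prod_{n\ge0}\mathcal{S}^n(\mathcal{F})$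 (direct products). The truncation $\prod_{i=0}^n\mathcal{S}^i(\mathcal{F})$ is the quotient algebra of $\mathcal{S}(\mathcal{F})$ by the ideal $\prod_{i>n}\mathcal{S}^i(\mathcal{F})$. Set $\mathcal{R}^0(\mathcal{F}):=\mathcal{O}_X$, $\mathcal{R}^n(\mathcal{F}):=\mathcal{S}^{n-1}(\mathcal{F})\otimes\mathcal{F}$ for $n\ge1$, and $\mathcal{R}(\mathcal{F}):=\prod_{n\ge0}\mathcal{R}^n(\mathcal{F})$, naturally a graded $\mathcal{O}_X$-algebra quotient of $\mathcal{T}(\mathcal{F})$; $\mathcal{S}(\mathcal{F})$ is naturally a quotient of $\mathcal{R}(\mathcal{F})$. $D$-connections. A $D$-connection is a map of $\mathcal{O}_B$-modules $\gamma\colon\mathcal{F}\to\mathcal{T}^2(\mathcal{F})$ with $\gamma(am)=D(a)\otimes m+a\gamma(m)$ for all local sections $a$ of $\mathcal{O}_X$ and $m$ of $\mathcal{F}$. It is flat if $\gamma D(\mathcal{O}_X)$ lies in the kernel of $\mathcal{T}^2(\mathcal{F})\to\mathcal{A}^2(\mathcal{F})$. The derivation $D$ is integrable if there exists a flat $D$-connection (on the whole space), and locally integrable if every point of $X$ has an open neighborhood $U$ such that $D|_U$ is integrable. Extended $D$-connections. An extended $D$-connection is a map of $\mathcal{O}_B$-modules $T=(T_0,T_1,\dots)\colon\mathcal{F}\to\prod_{i=0}^\infty\mathcal{R}^{i+1}(\mathcal{F})$ such that $T_0=\mathrm{id}_{\mathcal{F}}$ and, for each $i\ge1$ and all local sections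 $a$ of $\mathcal{O}_X$ and $m$ of $\mathcal{F}$, $$T_i(am)=aT_i(m)+\sum_{j=1}^i\frac1j\,T_{j-1}D(a)\,T_{i-j}(m),$$ with products in $\mathcal{R}(\mathcal{F})$. Hasse derivations. A Hasse derivation of $\mathcal{F}$ is a map of $\mathcal{O}_B$-algebras $h=(h_0,h_1,\dots)\colon\mathcal{O}_X\to\mathcal{S}(\mathcal{F})$ with $h_0=\mathrm{id}_{\mathcal{O}_X}$. It extends $D$ if $h_1=D$. A Hasse derivation $h$ extending $D$ is iterated if there is an extended $D$-connection $T$ such that, for each $i\ge1$, $h_i(a)$ is the class of $(1/i)T_{i-1}D(a)$ in $\mathcal{S}^i(\mathcal{F})$ for all local sections $a$ of $\mathcal{O}_X$. Equivalences. An equivalence from a Hasse derivation $h$ to a Hasse derivation $h'$ is an $\mathcal{O}_X$-algebra automorphism $\phi$ of $\mathcal{S}(\mathcal{F})$ with $h'=\phi h$ and $\phi_0|_{\mathcal{F}}=\mathrm{id}_{\mathcal{F}}$, where $\phi=\sum_{q\ge0}\phi_q$ is given by homogeneous parts and does not decrease degrees: there are $\mathcal{O}_X$-linear maps $\phi_q\colon\mathcal{S}^p(\mathcal{F})\to\mathcal{S}^{p+q}(\mathcal{F})$ ($p,q\ge0$) such that the degree-$n$ component of $\phi((\omega_p)_{p\ge0})$ is $\sum_{p=0}^n\phi_{n-p}(\omega_p)$. Terminology: $\mathcal{J}$ is called the sheaf of jets of $D$, $\tau$ its Hasse derivation, and $\mathcal{J}^n$ the sheaf of $n$-jets of $D$.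 *)

(* Defs.v *)
From HB Require Import structures.
From mathcomp Require Import all_boot all_order all_algebra.
From mathcomp Require Import boolp classical_sets topology_structure.

Set Implicit Arguments.
Unset Strict Implicit.
Unset Printing Implicit Defensive.

Import GRing.Theory.
Local Open Scope classical_set_scope.
Local Open Scope ring_scope.

Record eqv (T : Type) := Eqv {
  eqv_rel :> T -> T -> Prop;
  eqv_refl : forall s, eqv_rel s s;
  eqv_sym : forall s t, eqv_rel s t -> eqv_rel t s;
  eqv_trans : forall s t u, eqv_rel s t -> eqv_rel t u -> eqv_rel s u }.

Section Quotient.
Variables (T : Type) (e : eqv T).

Definition eqvb : rel {classic T} := fun s t => `[< e s t >].

Lemma eqvb_refl : reflexive eqvb.
Proof. by move=> s; apply/asboolP/eqv_refl. Qed.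

Lemma eqvb_sym : symmetric eqvb.
Proof. by move=> s t; apply/asboolP/asboolP; apply: eqv_sym. Qed.

Lemma eqvb_trans : transitive eqvb.
Proof.
move=> t s u /asboolP st /asboolP tu; apply/asboolP; exact: eqv_trans st tu.
Qed.

Definition eqvb_equiv := EquivRel eqvb eqvb_refl eqvb_sym eqvb_trans.

Definition cquot : Type := {eq_quot eqvb_equiv}%qT.
HB.instance Definition _ := Choice.copy cquot {eq_quot eqvb_equiv}%qT.

Definition cls (t : T) : cquot := (\pi_({eq_quot eqvb_equiv}) (t : {classic T}))%qT.
Definition rep (c : cquot) : T := repr (c : {eq_quot eqvb_equiv}%qT).

Lemma repK c : cls (rep c) = c.
Proof. exact: (@reprK _ {eq_quot eqvb_equiv}%qT). Qed.

Lemma clsP s t : cls s = cls t <-> e s t.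
Proof.
split; first by move=> /eqmodP /asboolP.
by move=> st; apply/eqmodP/asboolP.
Qed.

Lemma rep_cls t : e (rep (cls t)) t.
Proof. by apply/clsP; rewrite repK. Qed.

End Quotient.

Section PresentedModule.
Variables (A : comPzRingType) (G : Type).

Inductive mterm : Type :=
| MZero
| MGen of G
| MAdd of mterm & mterm
| MScale of A & mterm.

Variable rels : mterm -> mterm -> Prop.

Inductive meq : mterm -> mterm -> Prop :=
| meq_refl s : meq s s
| meq_sym s t : meq s t -> meq t s
| meq_trans s t u : meq s t -> meq t u -> meq s u
| meq_add s s' t t' : meq s s' -> meq t t' -> meq (MAdd s t) (MAdd s' t')
| meq_scale a s s' : meq s s' -> meq (MScale a s) (MScale a s')
| meq_addA s t u : meq (MAdd s (MAdd t u)) (MAdd (MAdd s t) u)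
| meq_addC s t : meq (MAdd s t) (MAdd t s)
| meq_add0 s : meq (MAdd MZero s) s
| meq_scale0 s : meq (MScale 0 s) MZero
| meq_scale1 s : meq (MScale 1 s) s
| meq_scaleA a b s : meq (MScale a (MScale b s)) (MScale (a * b) s)
| meq_scaleDr a s t : meq (MScale a (MAdd s t)) (MAdd (MScale a s) (MScale a t))
| meq_scaleDl a b s : meq (MScale (a + b) s) (MAdd (MScale a s) (MScale b s))
| meq_rel s t : rels s t -> meq s t.

Definition meq_eqv := Eqv meq_refl meq_sym meq_trans.

Definition presmod : Type := cquot meq_eqv.
HB.instance Definition _ := Choice.copy presmod (cquot meq_eqv).

Definition pm0 : presmod := cls meq_eqv MZero.
Definition pmgen (g : G) : presmod := cls meq_eqv (MGen g).
Definition pmadd (u v : presmod) : presmod := cls meq_eqv (MAdd (rep u) (rep v)).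
Definition pmscale (a : A) (u : presmod) : presmod :=
  cls meq_eqv (MScale a (rep u)).

Lemma cls_madd s t :
  pmadd (cls meq_eqv s) (cls meq_eqv t) = cls meq_eqv (MAdd s t).
Proof. by apply/clsP/meq_add; apply: (@rep_cls _ meq_eqv). Qed.

Lemma cls_mscale a s : pmscale a (cls meq_eqv s) = cls meq_eqv (MScale a s).
Proof. by apply/clsP/meq_scale; apply: (@rep_cls _ meq_eqv). Qed.

Lemma presmodP (P : presmod -> Prop) :
  (forall s, P (cls meq_eqv s)) -> forall u, P u.
Proof. by move=> H u; rewrite -(repK u). Qed.

Lemma pmaddA : associative pmadd.
Proof.
elim/presmodP=> s; elim/presmodP=> t; elim/presmodP=> u.
by rewrite !cls_madd; apply/clsP/meq_addA.
Qed.

Lemma pmaddC : commutative pmadd.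
Proof.
elim/presmodP=> s; elim/presmodP=> t.
by rewrite !cls_madd; apply/clsP/meq_addC.
Qed.

Lemma pmadd0 : left_id pm0 pmadd.
Proof. by elim/presmodP=> s; rewrite cls_madd; apply/clsP/meq_add0. Qed.

Lemma pmaddN : left_inverse pm0 (pmscale (-1)) pmadd.
Proof.
elim/presmodP=> s; rewrite cls_mscale cls_madd; apply/clsP.
apply: (@meq_trans _ (MAdd (MScale (-1) s) (MScale 1 s))).
  by apply: meq_add; [apply: meq_refl | apply/meq_sym/meq_scale1].
apply: (@meq_trans _ (MScale (-1 + 1) s)); first exact/meq_sym/meq_scaleDl.
by rewrite addNr; apply: meq_scale0.
Qed.

HB.instance Definition _ := GRing.isZmodule.Build presmod
  pmaddA pmaddC pmadd0 pmaddN.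

Lemma pmscaleA a b (v : presmod) : pmscale a (pmscale b v) = pmscale (a * b) v.
Proof.
by elim/presmodP: v => s; rewrite !cls_mscale; apply/clsP/meq_scaleA.
Qed.

Lemma pmscale1 : left_id 1 pmscale.
Proof. by elim/presmodP=> s; rewrite cls_mscale; apply/clsP/meq_scale1. Qed.

Lemma pmscaleDr : right_distributive pmscale +%R.
Proof.
move=> a; elim/presmodP=> s; elim/presmodP=> t.
have -> : (cls meq_eqv s : presmod) + (cls meq_eqv t : presmod) =
  cls meq_eqv (MAdd s t) by exact: cls_madd.
by rewrite !cls_mscale [RHS]cls_madd; apply/clsP/meq_scaleDr.
Qed.

Lemma pmscaleDl (v : presmod) : {morph pmscale^~ v : a b / a + b}.
Proof.
move=> a b; elim/presmodP: v => s.
by rewrite !cls_mscale [RHS]cls_madd; apply/clsP/meq_scaleDl.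
Qed.

HB.instance Definition _ := GRing.Zmodule_isLmodule.Build A presmod
  pmscaleA pmscale1 pmscaleDr pmscaleDl.

Section Lift.
Variables (P : lmodType A) (f : G -> P).

Fixpoint meval (s : mterm) : P :=
  match s with
  | MZero => 0
  | MGen g => f g
  | MAdd s t => meval s + meval t
  | MScale a s => a *: meval s
  end.

(* the linear map induced by [f]; meaningful when [f] respects [rels] *)
Definition pmlift (u : presmod) : P := meval (rep u).

Hypothesis frels : forall s t, rels s t -> meval s = meval t.

Lemma meval_meq s t : meq s t -> meval s = meval t.
Proof.
elim=> //=.
- by move=> ? ? ? _ -> _ ->.
- by move=> ? ? ? ? _ -> _ ->.
- by move=> ? ? ? _ ->.
- by move=> *; rewrite addrA.
- by move=> *; rewrite addrC.
- by move=> *; rewrite add0r.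
- by move=> *; rewrite scale0r.
- by move=> *; rewrite scale1r.
- by move=> *; rewrite scalerA.
- by move=> *; rewrite scalerDr.
- by move=> *; rewrite scalerDl.
Qed.

Lemma pmlift_cls s : pmlift (cls meq_eqv s) = meval s.
Proof. by apply: meval_meq; apply: (@rep_cls _ meq_eqv). Qed.

Lemma pmlift_gen g : pmlift (pmgen g) = f g.
Proof. exact: pmlift_cls. Qed.

Lemma pmliftD u v : pmlift (u + v) = pmlift u + pmlift v.
Proof.
elim/presmodP: u => s; elim/presmodP: v => t.
by rewrite [_ + _]cls_madd !pmlift_cls.
Qed.

Lemma pmliftZ a u : pmlift (a *: u) = a *: pmlift u.
Proof.
by elim/presmodP: u => s; rewrite [_ *: _]cls_mscale !pmlift_cls.
Qed.

Lemma pmlift0 : pmlift 0 = 0.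
Proof. exact: pmlift_cls. Qed.

End Lift.

End PresentedModule.

Section Tensor.
Variables (A : comPzRingType) (M N : lmodType A).

Inductive bilin_rel : mterm A (M * N) -> mterm A (M * N) -> Prop :=
| bilinDl m m' n :
    bilin_rel (MGen A (m + m', n)) (MAdd (MGen A (m, n)) (MGen A (m', n)))
| bilinDr m n n' :
    bilin_rel (MGen A (m, n + n')) (MAdd (MGen A (m, n)) (MGen A (m, n')))
| bilinZl a m n : bilin_rel (MGen A (a *: m, n)) (MScale a (MGen A (m, n)))
| bilinZr a m n : bilin_rel (MGen A (m, a *: n)) (MScale a (MGen A (m, n))).

Definition tensor : lmodType A := presmod bilin_rel.

Definition tens (m : M) (n : N) : tensor := pmgen bilin_rel (m, n).

Lemma tensDl m m' n : tens (m + m') n = tens m n + tens m' n.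
Proof.
by rewrite /tens [RHS]cls_madd; apply/clsP/meq_rel; constructor.
Qed.

Lemma tensDr m n n' : tens m (n + n') = tens m n + tens m n'.
Proof.
by rewrite /tens [RHS]cls_madd; apply/clsP/meq_rel; constructor.
Qed.

Lemma tensZl a m n : tens (a *: m) n = a *: tens m n.
Proof.
by rewrite /tens [RHS]cls_mscale; apply/clsP/meq_rel; constructor.
Qed.

Lemma tensZr a m n : tens m (a *: n) = a *: tens m n.
Proof.
by rewrite /tens [RHS]cls_mscale; apply/clsP/meq_rel; constructor.
Qed.

End Tensor.

Section Exterior.
Variables (A : comPzRingType) (M : lmodType A).

Inductive alt_rel : mterm A (M * M) -> mterm A (M * M) -> Prop :=
| alt_bilin s t : bilin_rel s t -> alt_rel s t
| alt_diag m : alt_rel (MGen A (m, m)) (MZero A _).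

Definition exterior2 : lmodType A := presmod alt_rel.

Definition wedge (m n : M) : exterior2 := pmgen alt_rel (m, n).

Definition tens_wedge (u : tensor M M) : exterior2 :=
  pmlift (fun p => wedge p.1 p.2) u.

Lemma wedge_bilin s t : bilin_rel s t ->
  meval (fun p => wedge p.1 p.2) s = meval (fun p => wedge p.1 p.2) t.
Proof.
case=> * /=; rewrite ?[RHS]cls_madd ?[RHS]cls_mscale;
  by apply/clsP/meq_rel/alt_bilin; constructor.
Qed.

Lemma wedgeZl a m n : wedge (a *: m) n = a *: wedge m n.
Proof. exact: (wedge_bilin (bilinZl a m n)). Qed.

Lemma tens_wedgeD u v : tens_wedge (u + v) = tens_wedge u + tens_wedge v.
Proof. exact/pmliftD/wedge_bilin. Qed.

Lemma tens_wedge0 : tens_wedge 0 = 0.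
Proof. exact/pmlift0/wedge_bilin. Qed.

Lemma tens_wedge_tens m n : tens_wedge (tens m n) = wedge m n.
Proof. exact: (pmlift_gen wedge_bilin). Qed.

End Exterior.

Section SymmetricAlgebra.
Variables (A : comPzRingType) (M : lmodType A).

Inductive sterm : Type :=
| SCst of A
| SGen of M
| SAdd of sterm & sterm
| SMul of sterm & sterm.

Inductive symeq : sterm -> sterm -> Prop :=
| symeq_refl s : symeq s s
| symeq_sym s t : symeq s t -> symeq t s
| symeq_trans s t u : symeq s t -> symeq t u -> symeq s u
| symeq_add s s' t t' : symeq s s' -> symeq t t' -> symeq (SAdd s t) (SAdd s' t')
| symeq_mul s s' t t' : symeq s s' -> symeq t t' -> symeq (SMul s t) (SMul s' t')
| symeq_addA s t u : symeq (SAdd s (SAdd t u)) (SAdd (SAdd s t) u)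
| symeq_addC s t : symeq (SAdd s t) (SAdd t s)
| symeq_add0 s : symeq (SAdd (SCst 0) s) s
| symeq_mulA s t u : symeq (SMul s (SMul t u)) (SMul (SMul s t) u)
| symeq_mulC s t : symeq (SMul s t) (SMul t s)
| symeq_mul1 s : symeq (SMul (SCst 1) s) s
| symeq_mul0 s : symeq (SMul (SCst 0) s) (SCst 0)
| symeq_mulDl s t u : symeq (SMul (SAdd s t) u) (SAdd (SMul s u) (SMul t u))
| symeq_cstD a b : symeq (SCst (a + b)) (SAdd (SCst a) (SCst b))
| symeq_cstM a b : symeq (SCst (a * b)) (SMul (SCst a) (SCst b))
| symeq_genD m n : symeq (SGen (m + n)) (SAdd (SGen m) (SGen n))
| symeq_genZ a m : symeq (SGen (a *: m)) (SMul (SCst a) (SGen m)).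

Definition symeq_eqv := Eqv symeq_refl symeq_sym symeq_trans.

(* the commutative A-algebra generated by the A-module M *)
Definition symalg : Type := cquot symeq_eqv.
HB.instance Definition _ := Choice.copy symalg (cquot symeq_eqv).

Definition symC (a : A) : symalg := cls symeq_eqv (SCst a).
Definition symV (m : M) : symalg := cls symeq_eqv (SGen m).
Definition symadd (u v : symalg) : symalg :=
  cls symeq_eqv (SAdd (rep u) (rep v)).
Definition symmul (u v : symalg) : symalg :=
  cls symeq_eqv (SMul (rep u) (rep v)).

Lemma cls_sadd s t :
  symadd (cls symeq_eqv s) (cls symeq_eqv t) = cls symeq_eqv (SAdd s t).
Proof. by apply/clsP/symeq_add; apply: (@rep_cls _ symeq_eqv). Qed.

Lemma cls_smul s t :
  symmul (cls symeq_eqv s) (cls symeq_eqv t) = cls symeq_eqv (SMul s t).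
Proof. by apply/clsP/symeq_mul; apply: (@rep_cls _ symeq_eqv). Qed.

Lemma symalgP (P : symalg -> Prop) :
  (forall s, P (cls symeq_eqv s)) -> forall u, P u.
Proof. by move=> H u; rewrite -(repK u). Qed.

Lemma symaddA : associative symadd.
Proof.
elim/symalgP=> s; elim/symalgP=> t; elim/symalgP=> u.
by rewrite !cls_sadd; apply/clsP/symeq_addA.
Qed.

Lemma symaddC : commutative symadd.
Proof.
elim/symalgP=> s; elim/symalgP=> t.
by rewrite !cls_sadd; apply/clsP/symeq_addC.
Qed.

Lemma symadd0 : left_id (symC 0) symadd.
Proof. by elim/symalgP=> s; rewrite cls_sadd; apply/clsP/symeq_add0. Qed.

Lemma symmulA : associative symmul.
Proof.
elim/symalgP=> s; elim/symalgP=> t; elim/symalgP=> u.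
by rewrite !cls_smul; apply/clsP/symeq_mulA.
Qed.

Lemma symmulC : commutative symmul.
Proof.
elim/symalgP=> s; elim/symalgP=> t.
by rewrite !cls_smul; apply/clsP/symeq_mulC.
Qed.

Lemma symmul1 : left_id (symC 1) symmul.
Proof. by elim/symalgP=> s; rewrite cls_smul; apply/clsP/symeq_mul1. Qed.

Lemma symmulDl : left_distributive symmul symadd.
Proof.
elim/symalgP=> s; elim/symalgP=> t; elim/symalgP=> u.
by rewrite !(cls_smul, cls_sadd); apply/clsP/symeq_mulDl.
Qed.

Lemma symmul0 u : symmul (symC 0) u = symC 0.
Proof. by elim/symalgP: u => s; rewrite cls_smul; apply/clsP/symeq_mul0. Qed.

Lemma symC_D a b : symC (a + b) = symadd (symC a) (symC b).
Proof. by rewrite cls_sadd; apply/clsP/symeq_cstD. Qed.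

Lemma symC_M a b : symC (a * b) = symmul (symC a) (symC b).
Proof. by rewrite cls_smul; apply/clsP/symeq_cstM. Qed.

Lemma symaddN : left_inverse (symC 0) (symmul (symC (-1))) symadd.
Proof.
move=> u; rewrite -{2}(symmul1 u) -symmulDl -symC_D addNr; exact: symmul0.
Qed.

HB.instance Definition _ := GRing.isZmodule.Build symalg
  symaddA symaddC symadd0 symaddN.

HB.instance Definition _ := GRing.Zmodule_isComPzRing.Build symalg
  symmulA symmulC symmul1 symmulDl.

Lemma symCD a b : symC (a + b) = symC a + symC b.
Proof. exact: symC_D. Qed.

Lemma symCM a b : symC (a * b) = symC a * symC b.
Proof. exact: symC_M. Qed.

Lemma symC1 : symC 1 = 1. Proof. by []. Qed.

Lemma symC0 : symC 0 = 0. Proof. by []. Qed.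

Lemma symVD m n : symV (m + n) = symV m + symV n.
Proof. by rewrite [RHS]cls_sadd; apply/clsP/symeq_genD. Qed.

Lemma symVZ a m : symV (a *: m) = symC a * symV m.
Proof. by rewrite [RHS]cls_smul; apply/clsP/symeq_genZ. Qed.

Definition symscale (a : A) (u : symalg) : symalg := symC a * u.

Lemma symscaleA a b u : symscale a (symscale b u) = symscale (a * b) u.
Proof. by rewrite /symscale mulrA symCM. Qed.

Lemma symscale1 : left_id 1 symscale.
Proof. by move=> u; rewrite /symscale symC1 mul1r. Qed.

Lemma symscaleDr : right_distributive symscale +%R.
Proof. by move=> a u v; rewrite /symscale mulrDr. Qed.

Lemma symscaleDl u : {morph symscale^~ u : a b / a + b}.
Proof. by move=> a b; rewrite /symscale symCD mulrDl. Qed.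

HB.instance Definition _ := GRing.Zmodule_isLmodule.Build A symalg
  symscaleA symscale1 symscaleDr symscaleDl.

Lemma symZE a (u : symalg) : a *: u = symC a * u. Proof. by []. Qed.

End SymmetricAlgebra.

(* The positive part of R(M) is the direct sum over n > 0 of S^{n-1}(M) (x) M,
   that is, Sym(M) (x) M.  As a quotient of the tensor algebra by the map
     x_1 (x) ... (x) x_n |-> x_1...x_{n-1} (x) x_n,
   it has the product
     (x_1...x_p (x) x) (y_1...y_q (x) y) = (x_1...x_p x y_1...y_q) (x) y,
   and its map to Sym(M) sends s (x) m to s m.  No product with an element of
   degree 0 is needed beyond the A-module structure. *)
Section RAlgebra.
Variables (A : comPzRingType) (M : lmodType A).

Local Notation S := (symalg M : lmodType A).

Definition Rpos : lmodType A := tensor S M.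

Definition Rpos_sym (u : Rpos) : symalg M :=
  pmlift (fun p : S * M => (p.1 : symalg M) * symV p.2 : S) u.

Definition Rpos_act (s : symalg M) (u : Rpos) : Rpos :=
  pmlift (fun p : S * M => tens (s * p.1 : S) p.2) u.

Definition Rpos_mul (u v : Rpos) : Rpos := Rpos_act (Rpos_sym u) v.

Lemma Rpos_sym_tens s x : Rpos_sym (tens s x) = (s : symalg M) * symV x.
Proof.
apply: pmlift_gen => _ _ [] /= *.
- by rewrite mulrDl.
- by rewrite symVD mulrDr.
- by rewrite !symZE mulrA.
- by rewrite symVZ symZE mulrCA.
Qed.

Lemma Rpos_act_tens s t y :
  Rpos_act s (tens t y) = tens (s * (t : symalg M) : S) y.
Proof.
apply: pmlift_gen => _ _ [] /= *.
- by rewrite mulrDr tensDl.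
- by rewrite tensDr.
- by rewrite -tensZl !symZE mulrCA.
- by rewrite tensZr.
Qed.

Lemma Rpos_mul_tens s x t y :
  Rpos_mul (tens s x) (tens t y) =
  tens ((s : symalg M) * symV x * (t : symalg M) : S) y.
Proof. by rewrite /Rpos_mul Rpos_sym_tens Rpos_act_tens. Qed.

End RAlgebra.

Record opens (X : topologicalType) := Opens {
  oset :> set X;
  oset_open : open oset }.

Definition omem (X : topologicalType) (U : opens X) (x : X) : Prop := oset U x.
Coercion omem : opens >-> Funclass.

Section Opens.
Variable X : topologicalType.

Definition fullO : opens X := Opens openT.

Definition interO (U V : opens X) : opens X :=
  Opens (openI (oset_open U) (oset_open V)).

Lemma interOl (U V : opens X) : interO U V `<=` U.
Proof. exact: subIsetl. Qed.

Lemma interOr (U V : opens X) : interO U V `<=` V.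
Proof. exact: subIsetr. Qed.

End Opens.
Arguments fullO {X}.

Record presheaf (X : topologicalType) := Presheaf {
  psec :> opens X -> Type;
  pres : forall U V : opens X, V `<=` U -> psec U -> psec V;
  pres_id : forall (U : opens X) (UU : U `<=` U) (s : psec U), pres UU s = s;
  pres_comp : forall (U V W : opens X) (VU : V `<=` U) (WV : W `<=` V)
    (WU : W `<=` U) (s : psec U), pres WV (pres VU s) = pres WU s }.

Definition is_sheaf (X : topologicalType) (P : presheaf X) : Prop :=
  forall (U : opens X) (I : Type) (V : I -> opens X)
    (VU : forall i, V i `<=` U),
    (forall x, U x -> exists i, V i x) ->
  forall s : forall i, P (V i),
    (forall i j,
       pres (@interOl X (V i) (V j)) (s i) =
       pres (@interOr X (V i) (V j)) (s j)) ->
  exists! t : P U, forall i, pres (VU i) t = s i.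

(* Sections form possibly trivial rings: those over the empty set are 0. *)
Record ringSheaf (X : topologicalType) := RingSheaf {
  rsec : opens X -> comPzRingType;
  rres : forall U V : opens X, V `<=` U -> {rmorphism rsec U -> rsec V};
  rres_id : forall (U : opens X) (UU : U `<=` U) s, rres UU s = s;
  rres_comp : forall (U V W : opens X) (VU : V `<=` U) (WV : W `<=` V)
    (WU : W `<=` U) s, rres WV (rres VU s) = rres WU s;
  rpresheaf := @Presheaf X rsec (fun U V VU => rres VU) rres_id rres_comp;
  rsheaf : is_sheaf rpresheaf }.
Coercion rpresheaf : ringSheaf >-> presheaf.
Canonical rpresheaf.

Record modSheaf (X : topologicalType) (O : ringSheaf X) := ModSheaf {
  msec : forall U : opens X, lmodType (rsec O U);
  mres : forall U V : opens X, V `<=` U -> {additive msec U -> msec V};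
  mresZ : forall (U V : opens X) (VU : V `<=` U) (a : rsec O U) (m : msec U),
    mres VU (a *: m) = rres O VU a *: mres VU m;
  mres_id : forall (U : opens X) (UU : U `<=` U) s, mres UU s = s;
  mres_comp : forall (U V W : opens X) (VU : V `<=` U) (WV : W `<=` V)
    (WU : W `<=` U) s, mres WV (mres VU s) = mres WU s;
  mpresheaf := @Presheaf X msec (fun U V VU => mres VU) mres_id mres_comp;
  msheaf : is_sheaf mpresheaf }.
Coercion mpresheaf : modSheaf >-> presheaf.

Record algSheaf (X : topologicalType) (O : ringSheaf X) := AlgSheaf {
  aring :> ringSheaf X;
  astr : forall U : opens X, {rmorphism rsec O U -> rsec aring U};
  astr_res : forall (U V : opens X) (VU : V `<=` U) a,
    astr V (rres O VU a) = rres aring VU (astr U a) }.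

Record QSheaf (X : topologicalType) := MkQSheaf {
  qring :> ringSheaf X;
  qstr : forall U : opens X, {rmorphism rat -> rsec qring U} }.

Section AlgebraAsModule.
Variables (X : topologicalType) (O : ringSheaf X) (R : algSheaf O).

Section Sections.
Variable U : opens X.

Definition amsec : Type := rsec R U.
HB.instance Definition _ := GRing.Zmodule.on amsec.

Definition amscale (a : rsec O U) (s : amsec) : amsec :=
  astr R U a * (s : rsec R U).

Lemma amscaleA a b s : amscale a (amscale b s) = amscale (a * b) s.
Proof. by rewrite /amscale rmorphM mulrA. Qed.

Lemma amscale1 : left_id 1 amscale.
Proof. by move=> s; rewrite /amscale rmorph1 mul1r. Qed.

Lemma amscaleDr : right_distributive amscale +%R.
Proof. by move=> a s t; rewrite /amscale mulrDr. Qed.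

Lemma amscaleDl s : {morph amscale^~ s : a b / a + b}.
Proof. by move=> a b; rewrite /amscale rmorphD mulrDl. Qed.

HB.instance Definition _ := GRing.Zmodule_isLmodule.Build (rsec O U) amsec
  amscaleA amscale1 amscaleDr amscaleDl.

End Sections.

Definition amres (U V : opens X) (VU : V `<=` U) :
  {additive amsec U -> amsec V} := rres R VU.

Lemma amresZ (U V : opens X) (VU : V `<=` U) a (m : amsec U) :
  amres VU (a *: m) = rres O VU a *: amres VU m.
Proof. by rewrite /amres /= [LHS]rmorphM -astr_res. Qed.

Definition amod : modSheaf O :=
  @ModSheaf X O amsec amres amresZ
    (@rres_id X R) (@rres_comp X R) (@rsheaf X R).

End AlgebraAsModule.

(* maps from P|_U to Q|_U; the sections of P|_U are those over the open V
   contained in U *)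
Record smap (X : topologicalType) (U : opens X) (P Q : presheaf X) := Smap {
  sapp :> forall V : opens X, V `<=` U -> P V -> Q V;
  sapp_res : forall (V W : opens X) (VU : V `<=` U) (WV : W `<=` V)
    (WU : W `<=` U) (s : P V), sapp WU (pres WV s) = pres WV (sapp VU s) }.

Section Maps.
Variable X : topologicalType.
Implicit Types (U V : opens X) (P Q R : presheaf X).

Definition srestr U V P Q (VU : V `<=` U) (f : smap U P Q) : smap V P Q :=
  @Smap X V P Q (fun W WV => f W (subset_trans WV VU))
    (fun W W' WV W'W W'V s => sapp_res f _ _ _ s).

Definition scomp U P Q R (g : smap U Q R) (f : smap U P Q) : smap U P R.
Proof.
exists (fun V VU s => g V VU (f V VU s)) => V W VU WV WU s.
by rewrite !(sapp_res _ VU).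
Defined.

Definition bij_map U P Q (f : smap U P Q) : Prop :=
  forall V (VU : V `<=` U), bijective (f V VU).

Definition inj_map U P Q (f : smap U P Q) : Prop :=
  forall V (VU : V `<=` U), injective (f V VU).

Definition locally_surj U P Q (f : smap U P Q) : Prop :=
  forall V (VU : V `<=` U) (t : Q V) x, V x ->
  exists (W : opens X) (WV : W `<=` V) (s : P W),
    W x /\ f W (subset_trans WV VU) s = pres WV t.

Definition additive_map (O O' : ringSheaf X) U
    (F : modSheaf O) (G : modSheaf O') (f : smap U F G) : Prop :=
  forall V (VU : V `<=` U) (m n : msec F V),
    f V VU (m + n) = f V VU m + (f V VU n : msec G V).

Definition linear_map (O : ringSheaf X) U (F G : modSheaf O)
    (f : smap U F G) : Prop :=
  additive_map f /\
  forall V (VU : V `<=` U) (a : rsec O V) (m : msec F V),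
    f V VU (a *: m) = a *: (f V VU m : msec G V).

(* O_B-linear maps between O_X-modules *)
Definition base_linear_map (OB : ringSheaf X) (OX : algSheaf OB) U
    (F G : modSheaf OX) (f : smap U F G) : Prop :=
  additive_map f /\
  forall V (VU : V `<=` U) (b : rsec OB V) (m : msec F V),
    f V VU (astr OX V b *: m) = astr OX V b *: (f V VU m : msec G V).

Definition ring_map U (R S : ringSheaf X) (f : smap U R S) : Prop :=
  forall V (VU : V `<=` U),
    [/\ f V VU (1 : rsec R V) = (1 : rsec S V),
        forall s t : rsec R V, f V VU (s + t) = f V VU s + (f V VU t : rsec S V)
      & forall s t : rsec R V, f V VU (s * t) = f V VU s * (f V VU t : rsec S V)].

Definition alg_map (O : ringSheaf X) U (R S : algSheaf O)
    (f : smap U R S) : Prop :=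
  ring_map f /\
  forall V (VU : V `<=` U) (a : rsec O V), f V VU (astr R V a) = astr S V a.

(* maps of O_B-algebras from O_X to an O_X-algebra *)
Definition base_alg_map (OB : ringSheaf X) (OX : algSheaf OB) U
    (S : algSheaf OX) (f : smap U OX S) : Prop :=
  ring_map f /\
  forall V (VU : V `<=` U) (b : rsec OB V),
    f V VU (astr OX V b) = astr S V (astr OX V b).

End Maps.

Record gpair (X : topologicalType) (P : presheaf X) (x : X) := Gpair {
  gdom : opens X;
  gin : gdom x;
  gval : P gdom }.

Section Stalk.
Variables (X : topologicalType) (P : presheaf X) (x : X).

Definition geq (p q : gpair P x) : Prop :=
  exists (W : opens X) (Wp : W `<=` gdom p) (Wq : W `<=` gdom q),
    W x /\ pres Wp (gval p) = pres Wq (gval q).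

Lemma geq_refl p : geq p p.
Proof. by exists (gdom p), (@subset_refl _ _), (@subset_refl _ _); split=> //; case: p. Qed.

Lemma geq_sym p q : geq p q -> geq q p.
Proof. by case=> W [Wp] [Wq] [Wx e]; exists W, Wq, Wp. Qed.

Lemma geq_trans p q r : geq p q -> geq q r -> geq p r.
Proof.
case=> W [Wp] [Wq] [Wx e] [W'] [W'q] [W'r] [W'x e'].
pose Z := interO W W'.
have ZW : Z `<=` W := @interOl _ _ _.
have ZW' : Z `<=` W' := @interOr _ _ _.
exists Z, (subset_trans ZW Wp), (subset_trans ZW' W'r); split=> //.
rewrite -(pres_comp Wp ZW) e (pres_comp Wq ZW (subset_trans ZW Wq)).
by rewrite -(pres_comp W'r ZW') -e' (pres_comp W'q ZW' (subset_trans ZW Wq)).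
Qed.

Definition geq_eqv := Eqv geq_refl geq_sym geq_trans.

Definition stalk : Type := cquot geq_eqv.

Definition germ (V : opens X) (Vx : V x) (s : P V) : stalk :=
  cls geq_eqv (Gpair Vx s).

Lemma germ_res (V W : opens X) (WV : W `<=` V) (Wx : W x) (Vx : V x) s :
  germ Wx (pres WV s) = germ Vx s.
Proof.
apply/clsP; exists W, (@subset_refl _ _), WV; split=> //=.
by rewrite pres_id.
Qed.

Lemma germP (u : stalk) : exists (V : opens X) (Vx : V x) s, u = germ Vx s.
Proof. by rewrite -(repK u); case: (rep u) => V Vx s; exists V, Vx, s. Qed.

End Stalk.

Section StalkMap.
Variables (X : topologicalType) (P Q R : presheaf X) (x : X).

Lemma germP2 (u : stalk P x) (v : stalk Q x) :
  exists (V : opens X) (Vx : V x) s t, u = germ Vx s /\ v = germ Vx t.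
Proof.
have [V [Vx [s ->]]] := germP u; have [W [Wx [t ->]]] := germP v.
have IV : interO V W `<=` V := @interOl _ _ _.
have IW : interO V W `<=` W := @interOr _ _ _.
have Ix : interO V W x by [].
exists (interO V W), Ix, (pres IV s), (pres IW t).
by rewrite !germ_res.
Qed.

Lemma germP3 (u : stalk P x) (v : stalk Q x) (w : stalk R x) :
  exists (V : opens X) (Vx : V x) r s t,
    [/\ u = germ Vx r, v = germ Vx s & w = germ Vx t].
Proof.
have [V [Vx [r [s [-> ->]]]]] := germP2 u v; have [W [Wx [t ->]]] := germP w.
have IV : interO V W `<=` V := @interOl _ _ _.
have IW : interO V W `<=` W := @interOr _ _ _.
have Ix : interO V W x by [].
exists (interO V W), Ix, (pres IV r), (pres IV s), (pres IW t).
by rewrite !germ_res.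
Qed.

Variable f : forall V : opens X, P V -> Q V -> R V.

Definition stalk_map2 (u : stalk P x) (v : stalk Q x) : stalk R x :=
  let p := rep u in let q := rep v in
  @germ X R x (interO (gdom p) (gdom q)) (conj (gin p) (gin q))
    (f (pres (@interOl _ _ _) (gval p)) (pres (@interOr _ _ _) (gval q))).

Hypothesis f_res : forall (V W : opens X) (WV : W `<=` V) s t,
  pres WV (f s t) = f (pres WV s) (pres WV t).

Lemma stalk_map2E (V : opens X) (Vx : V x) s t :
  stalk_map2 (germ Vx s) (germ Vx t) = germ Vx (f s t).
Proof.
rewrite /stalk_map2 /=.
have := @rep_cls _ (geq_eqv P x) (Gpair Vx s).
have := @rep_cls _ (geq_eqv Q x) (Gpair Vx t).
rewrite /germ; case: (rep _) => V2 V2x t'; case: (rep _) => V1 V1x s' /=.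
case=> W2 /= [a2] [b2] [W2x e2] [W1] /= [a1] [b1] [W1x e1].
apply/clsP; pose W := interO W1 W2.
have WV : W `<=` V by move=> y [/b1].
have WI : W `<=` interO V1 V2 by move=> y [/a1 ? /a2 ?].
have WW1 : W `<=` W1 := @interOl _ _ _.
have WW2 : W `<=` W2 := @interOr _ _ _.
exists W, WI, WV; split=> //=; rewrite !f_res; congr f.
  rewrite (pres_comp _ WI (subset_trans WW1 a1)) -(pres_comp a1 WW1) e1.
  exact: pres_comp.
rewrite (pres_comp _ WI (subset_trans WW2 a2)) -(pres_comp a2 WW2) e2.
exact: pres_comp.
Qed.

End StalkMap.

Section StalkRing.
Variables (X : topologicalType) (O : ringSheaf X) (x : X).

Definition rstalk : Type := stalk O x.
HB.instance Definition _ := Choice.copy rstalk (cquot (geq_eqv O x)).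

Definition rgerm (V : opens X) (Vx : V x) (a : rsec O V) : rstalk :=
  germ (P := O) Vx a.

Definition rst_add : rstalk -> rstalk -> rstalk :=
  stalk_map2 (P := O) (Q := O) (R := O) (fun V (a b : rsec O V) => a + b).
Definition rst_mul : rstalk -> rstalk -> rstalk :=
  stalk_map2 (P := O) (Q := O) (R := O) (fun V (a b : rsec O V) => a * b).
Definition rst_0 : rstalk := @rgerm fullO I 0.
Definition rst_1 : rstalk := @rgerm fullO I 1.

Lemma rst_addE (V : opens X) (Vx : V x) (a b : rsec O V) :
  rst_add (rgerm Vx a) (rgerm Vx b) = rgerm Vx (a + b).
Proof.
by apply: stalk_map2E => ? ? ? ? ?; rewrite /= rmorphD.
Qed.

Lemma rst_mulE (V : opens X) (Vx : V x) (a b : rsec O V) :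
  rst_mul (rgerm Vx a) (rgerm Vx b) = rgerm Vx (a * b).
Proof.
by apply: stalk_map2E => ? ? ? ? ?; rewrite /= rmorphM.
Qed.

Lemma rgerm_res (V W : opens X) (WV : W `<=` V) (Wx : W x) (Vx : V x) a :
  rgerm Wx (rres O WV a) = rgerm Vx a.
Proof. exact: (@germ_res _ O). Qed.

Lemma rst_0E (V : opens X) (Vx : V x) : rst_0 = rgerm Vx 0.
Proof.
by rewrite /rst_0 -(@rgerm_res fullO V (@subsetT _ _) Vx I) rmorph0.
Qed.

Lemma rst_1E (V : opens X) (Vx : V x) : rst_1 = rgerm Vx 1.
Proof.
by rewrite /rst_1 -(@rgerm_res fullO V (@subsetT _ _) Vx I) rmorph1.
Qed.

Lemma rgermP1 (u : rstalk) : exists (V : opens X) (Vx : V x) a, u = rgerm Vx a.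
Proof. exact: (@germP _ O). Qed.

Lemma rgermP2 (u v : rstalk) :
  exists (V : opens X) (Vx : V x) a b, u = rgerm Vx a /\ v = rgerm Vx b.
Proof. exact: (@germP2 _ O O). Qed.

Lemma rgermP3 (u v w : rstalk) : exists (V : opens X) (Vx : V x) a b c,
  [/\ u = rgerm Vx a, v = rgerm Vx b & w = rgerm Vx c].
Proof. exact: (@germP3 _ O O O). Qed.

Definition rst_opp (u : rstalk) : rstalk := rst_mul (@rgerm fullO I (-1)) u.

Lemma rst_oppE (V : opens X) (Vx : V x) (a : rsec O V) :
  rst_opp (rgerm Vx a) = rgerm Vx (- a).
Proof.
rewrite /rst_opp -(@rgerm_res fullO V (@subsetT _ _) Vx I) rst_mulE.
by rewrite rmorphN1 mulN1r.
Qed.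

Lemma rst_addA : associative rst_add.
Proof.
move=> u v w; have [V [Vx [a [b [c [-> -> ->]]]]]] := rgermP3 u v w.
by rewrite !rst_addE addrA.
Qed.

Lemma rst_addC : commutative rst_add.
Proof.
move=> u v; have [V [Vx [a [b [-> ->]]]]] := rgermP2 u v.
by rewrite !rst_addE addrC.
Qed.

Lemma rst_add0 : left_id rst_0 rst_add.
Proof.
move=> u; have [V [Vx [a ->]]] := rgermP1 u.
by rewrite (rst_0E Vx) rst_addE add0r.
Qed.

Lemma rst_addN : left_inverse rst_0 rst_opp rst_add.
Proof.
move=> u; have [V [Vx [a ->]]] := rgermP1 u.
by rewrite (rst_0E Vx) rst_oppE rst_addE addNr.
Qed.

Lemma rst_mulA : associative rst_mul.
Proof.
move=> u v w; have [V [Vx [a [b [c [-> -> ->]]]]]] := rgermP3 u v w.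
by rewrite !rst_mulE mulrA.
Qed.

Lemma rst_mulC : commutative rst_mul.
Proof.
move=> u v; have [V [Vx [a [b [-> ->]]]]] := rgermP2 u v.
by rewrite !rst_mulE mulrC.
Qed.

Lemma rst_mul1 : left_id rst_1 rst_mul.
Proof.
move=> u; have [V [Vx [a ->]]] := rgermP1 u.
by rewrite (rst_1E Vx) rst_mulE mul1r.
Qed.

Lemma rst_mulDl : left_distributive rst_mul rst_add.
Proof.
move=> u v w; have [V [Vx [a [b [c [-> -> ->]]]]]] := rgermP3 u v w.
by rewrite !(rst_addE, rst_mulE) mulrDl.
Qed.

HB.instance Definition _ := GRing.isZmodule.Build rstalk
  rst_addA rst_addC rst_add0 rst_addN.
HB.instance Definition _ := GRing.Zmodule_isComPzRing.Build rstalk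
  rst_mulA rst_mulC rst_mul1 rst_mulDl.

Lemma rgermD (V : opens X) (Vx : V x) (a b : rsec O V) :
  rgerm Vx (a + b) = rgerm Vx a + rgerm Vx b.
Proof. by rewrite [RHS]rst_addE. Qed.

Lemma rgermM (V : opens X) (Vx : V x) (a b : rsec O V) :
  rgerm Vx (a * b) = rgerm Vx a * rgerm Vx b.
Proof. by rewrite [RHS]rst_mulE. Qed.

Lemma rgerm0 (V : opens X) (Vx : V x) : rgerm Vx 0 = 0.
Proof. by rewrite -(rst_0E Vx). Qed.

Lemma rgerm1 (V : opens X) (Vx : V x) : rgerm Vx 1 = 1.
Proof. by rewrite -(rst_1E Vx). Qed.

End StalkRing.

Section StalkModule.
Variables (X : topologicalType) (O : ringSheaf X) (F : modSheaf O) (x : X).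

Definition mstalk : Type := stalk F x.
HB.instance Definition _ := Choice.copy mstalk (cquot (geq_eqv F x)).

Definition mgerm (V : opens X) (Vx : V x) (m : msec F V) : mstalk :=
  germ (P := F) Vx m.

Definition mst_add : mstalk -> mstalk -> mstalk :=
  stalk_map2 (P := F) (Q := F) (R := F) (fun V (m n : msec F V) => m + n).
Definition mst_scale : rstalk O x -> mstalk -> mstalk :=
  stalk_map2 (P := O) (Q := F) (R := F)
    (fun V (a : rsec O V) (m : msec F V) => a *: m).
Definition mst_0 : mstalk := @mgerm fullO I 0.

Lemma mst_addE (V : opens X) (Vx : V x) (m n : msec F V) :
  mst_add (mgerm Vx m) (mgerm Vx n) = mgerm Vx (m + n).
Proof.
by apply: stalk_map2E => ? ? ? ? ?; rewrite /= raddfD.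
Qed.

Lemma mst_scaleE (V : opens X) (Vx : V x) (a : rsec O V) (m : msec F V) :
  mst_scale (rgerm Vx a) (mgerm Vx m) = mgerm Vx (a *: m).
Proof.
by apply: stalk_map2E => ? ? ? ? ?; rewrite /= mresZ.
Qed.

Lemma mgerm_res (V W : opens X) (WV : W `<=` V) (Wx : W x) (Vx : V x) m :
  mgerm Wx (mres F WV m) = mgerm Vx m.
Proof. exact: (@germ_res _ F). Qed.

Lemma mst_0E (V : opens X) (Vx : V x) : mst_0 = mgerm Vx 0.
Proof.
by rewrite /mst_0 -(@mgerm_res fullO V (@subsetT _ _) Vx I) raddf0.
Qed.

Lemma mgermP1 (u : mstalk) : exists (V : opens X) (Vx : V x) m, u = mgerm Vx m.
Proof. exact: (@germP _ F). Qed.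

Lemma mst_addA : associative mst_add.
Proof.
move=> u v w.
have [V [Vx [a [b [c [-> -> ->]]]]]] := @germP3 _ F F F x u v w.
by rewrite !mst_addE addrA.
Qed.

Lemma mst_addC : commutative mst_add.
Proof.
move=> u v; have [V [Vx [a [b [-> ->]]]]] := @germP2 _ F F x u v.
by rewrite !mst_addE addrC.
Qed.

Lemma mst_add0 : left_id mst_0 mst_add.
Proof.
move=> u; have [V [Vx [a ->]]] := mgermP1 u.
by rewrite (mst_0E Vx) mst_addE add0r.
Qed.

Lemma mst_addN : left_inverse mst_0 (mst_scale (-1)) mst_add.
Proof.
move=> u; have [V [Vx [a ->]]] := mgermP1 u.
have -> : -1 = @rgerm _ O x V Vx (-1).
  by rewrite -(rst_oppE Vx) -(rst_1E O Vx).
by rewrite (mst_0E Vx) mst_scaleE mst_addE scaleN1r addNr.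
Qed.

HB.instance Definition _ := GRing.isZmodule.Build mstalk
  mst_addA mst_addC mst_add0 mst_addN.

Lemma mst_scaleA a b v : mst_scale a (mst_scale b v) = mst_scale (a * b) v.
Proof.
have [V [Vx [c [d [m [-> -> ->]]]]]] := @germP3 _ O O F x a b v.
by rewrite !mst_scaleE [X in mst_scale X]rst_mulE mst_scaleE scalerA.
Qed.

Lemma mst_scale1 : left_id 1 mst_scale.
Proof.
move=> u; have [V [Vx [a ->]]] := mgermP1 u.
by rewrite [1](rst_1E _ Vx) mst_scaleE scale1r.
Qed.

Lemma mst_scaleDr : right_distributive mst_scale +%R.
Proof.
move=> a u v.
have [V [Vx [c [m [n [-> -> ->]]]]]] := @germP3 _ O F F x a u v.
by rewrite [X in mst_scale _ X]mst_addE !mst_scaleE [RHS]mst_addE scalerDr.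
Qed.

Lemma mst_scaleDl v : {morph mst_scale^~ v : a b / a + b}.
Proof.
move=> a b; have [V [Vx [c [d [m [-> -> ->]]]]]] := @germP3 _ O O F x a b v.
by rewrite [X in mst_scale X]rst_addE !mst_scaleE [RHS]mst_addE scalerDl.
Qed.

HB.instance Definition _ := GRing.Zmodule_isLmodule.Build (rstalk O x) mstalk
  mst_scaleA mst_scale1 mst_scaleDr mst_scaleDl.

Lemma mgermD (V : opens X) (Vx : V x) (m n : msec F V) :
  mgerm Vx (m + n) = mgerm Vx m + mgerm Vx n.
Proof. by rewrite [RHS]mst_addE. Qed.

Lemma mgermZ (V : opens X) (Vx : V x) (a : rsec O V) (m : msec F V) :
  mgerm Vx (a *: m) = rgerm Vx a *: mgerm Vx m.
Proof. by rewrite [RHS]mst_scaleE. Qed.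

End StalkModule.

(* The tensor, exterior and symmetric powers of F are the sheaves associated
   with the presheaves taking these powers on sections.  As the powers commute
   with the passage to stalks, the sections over U of the associated sheaf are
   the families (s_x), x in U, of elements of the corresponding powers [fE x] of
   the stalks F_x that are locally sums of pure elements, [fG V] parametrizing
   the pure elements over V. *)
Record famData (X : topologicalType) (O : ringSheaf X) := FamData {
  fE : forall x : X, lmodType (rstalk O x);
  fG : opens X -> Type;
  fpure : forall (V : opens X), fG V -> forall x, V x -> fE x;
  fscale : forall V : opens X, rsec O V -> fG V -> fG V;
  fscaleE : forall (V : opens X) a (g : fG V) x (Vx : V x),
    fpure (fscale a g) Vx = rgerm Vx a *: fpure g Vx;
  fgres : forall U V : opens X, V `<=` U -> fG U -> fG V;
  fgresE : forall (U V : opens X) (VU : V `<=` U) (g : fG U) x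
    (Vx : V x) (Ux : U x), fpure (fgres VU g) Vx = fpure g Ux }.

Section Families.
Variables (X : topologicalType) (O : ringSheaf X) (E : famData O).

Definition is_local (U : opens X) (s : forall x, U x -> fE E x) : Prop :=
  forall x, U x -> exists (V : opens X) (VU : V `<=` U) (l : seq (fG E V)),
    V x /\ forall y (Vy : V y) (Uy : U y), s y Uy = \sum_(g <- l) fpure g Vy.

Record fam (U : opens X) := Fam {
  fval : forall x, U x -> fE E x;
  fvalP : is_local fval }.

Lemma famP U (s t : fam U) :
  (forall x (Ux : U x), fval s Ux = fval t Ux) -> s = t.
Proof.
case: s t => [s sP] [t tP] /= st.
have e : s = t.
  by apply: functional_extensionality_dep => x; apply: functional_extensionality_dep.
by case: _ / e tP {st} => tP; congr Fam; apply: Prop_irrelevance.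
Qed.

Lemma fval_irr U (s : fam U) x (Ux Ux' : U x) : fval s Ux = fval s Ux'.
Proof. by rewrite (Prop_irrelevance Ux Ux'). Qed.

HB.instance Definition _ U := gen_eqMixin (fam U).
HB.instance Definition _ U := gen_choiceMixin (fam U).

Lemma fres_local (U V : opens X) (VU : V `<=` U) (s : fam U) :
  is_local (fun x (Vx : V x) => fval s (VU x Vx)).
Proof.
move=> x Vx; have [W [WU [l [Wx sl]]]] := fvalP s (VU x Vx).
exists (interO V W), (@interOl _ V W).
exists [seq fgres (@interOr _ V W) g | g <- l]; split=> // y Iy Vy.
rewrite big_map (sl y (interOr Iy)); apply: eq_bigr => g _.
by rewrite (fgresE _ _ _ (interOr Iy)).
Qed.

Definition fres (U V : opens X) (VU : V `<=` U) (s : fam U) : fam V :=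
  Fam (fres_local VU s).

Section Sections.
Variable U : opens X.

Lemma fam0_local : is_local (fun x (_ : U x) => 0 : fE E x).
Proof.
by move=> x Ux; exists U, (@subset_refl _ _), [::]; split=> // *; rewrite big_nil.
Qed.

Lemma famD_local (s t : fam U) :
  is_local (fun x (Ux : U x) => fval s Ux + fval t Ux).
Proof.
move=> x Ux; have [V [VU [l [Vx sl]]]] := fvalP s Ux.
have [W [WU [k [Wx tk]]]] := fvalP t Ux.
exists (interO V W), (subset_trans (@interOl _ V W) VU).
exists ([seq fgres (@interOl _ V W) g | g <- l] ++
        [seq fgres (@interOr _ V W) g | g <- k]); split=> // y Iy Uy.
rewrite big_cat !big_map /= (sl y (interOl Iy)) (tk y (interOr Iy)).
congr (_ + _); apply: eq_bigr => g _.
  by rewrite (fgresE _ _ _ (interOl Iy)).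
by rewrite (fgresE _ _ _ (interOr Iy)).
Qed.

Lemma famZ_local (a : rsec O U) (s : fam U) :
  is_local (fun x (Ux : U x) => rgerm Ux a *: fval s Ux).
Proof.
move=> x Ux; have [V [VU [l [Vx sl]]]] := fvalP s Ux.
exists V, VU, [seq fscale (rres O VU a) g | g <- l]; split=> // y Vy Uy.
rewrite big_map (sl y Vy) scaler_sumr; apply: eq_bigr => g _.
by rewrite fscaleE (rgerm_res VU Vy Uy).
Qed.

Definition fam0 : fam U := Fam fam0_local.
Definition famadd (s t : fam U) : fam U := Fam (famD_local s t).
Definition famscale (a : rsec O U) (s : fam U) : fam U := Fam (famZ_local a s).

Lemma famaddA : associative famadd.
Proof. by move=> s t u; apply: famP => x Ux /=; rewrite addrA. Qed.

Lemma famaddC : commutative famadd.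
Proof. by move=> s t; apply: famP => x Ux /=; rewrite addrC. Qed.

Lemma famadd0 : left_id fam0 famadd.
Proof. by move=> s; apply: famP => x Ux /=; rewrite add0r. Qed.

Lemma rgermN1 x (Ux : U x) : rgerm Ux (-1 : rsec O U) = -1.
Proof. by rewrite -[RHS]/(rst_opp _) -(rst_oppE Ux) -(rst_1E O Ux). Qed.

Lemma famaddN : left_inverse fam0 (famscale (-1)) famadd.
Proof.
by move=> s; apply: famP => x Ux /=; rewrite rgermN1 scaleN1r addNr.
Qed.

HB.instance Definition _ := GRing.isZmodule.Build (fam U)
  famaddA famaddC famadd0 famaddN.

Lemma famscaleA a b s : famscale a (famscale b s) = famscale (a * b) s.
Proof. by apply: famP => x Ux /=; rewrite rgermM scalerA. Qed.

Lemma famscale1 : left_id 1 famscale.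
Proof. by move=> s; apply: famP => x Ux /=; rewrite rgerm1 scale1r. Qed.

Lemma famscaleDr : right_distributive famscale +%R.
Proof. by move=> a s t; apply: famP => x Ux /=; rewrite scalerDr. Qed.

Lemma famscaleDl s : {morph famscale^~ s : a b / a + b}.
Proof. by move=> a b; apply: famP => x Ux /=; rewrite rgermD scalerDl. Qed.

HB.instance Definition _ := GRing.Zmodule_isLmodule.Build (rsec O U) (fam U)
  famscaleA famscale1 famscaleDr famscaleDl.

Lemma fval0 x (Ux : U x) : fval (0 : fam U) Ux = 0. Proof. by []. Qed.

Lemma fvalD (s t : fam U) x (Ux : U x) :
  fval (s + t) Ux = fval s Ux + fval t Ux.
Proof. by []. Qed.

Lemma fvalZ a (s : fam U) x (Ux : U x) :
  fval (a *: s) Ux = rgerm Ux a *: fval s Ux.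
Proof. by []. Qed.

Lemma pure_local (g : fG E U) : is_local (fun x (Ux : U x) => fpure g Ux).
Proof.
move=> x Ux; exists U, (@subset_refl _ _), [:: g]; split=> // y Uy Uy'.
by rewrite big_seq1 (Prop_irrelevance Uy' Uy).
Qed.

Definition fam_pure (g : fG E U) : fam U := Fam (pure_local g).

End Sections.

Lemma fresB (U V : opens X) (VU : V `<=` U) : zmod_morphism (fres VU).
Proof.
move=> s t; apply: famP => x Vx; rewrite -scaleN1r -[in RHS]scaleN1r /=.
by rewrite !rgermN1.
Qed.

HB.instance Definition _ (U V : opens X) (VU : V `<=` U) :=
  GRing.isZmodMorphism.Build (fam U) (fam V) (fres VU) (fresB VU).

Lemma fresZ (U V : opens X) (VU : V `<=` U) (a : rsec O U) (m : fam U) :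
  fres VU (a *: m) = rres O VU a *: fres VU m.
Proof. by apply: famP => x Vx /=; rewrite (rgerm_res VU Vx (VU x Vx)). Qed.

Lemma fres_id (U : opens X) (UU : U `<=` U) s : fres UU s = s.
Proof. by apply: famP => x Ux /=; apply: fval_irr. Qed.

Lemma fres_comp (U V W : opens X) (VU : V `<=` U) (WV : W `<=` V)
  (WU : W `<=` U) s : fres WV (fres VU s) = fres WU s.
Proof. by apply: famP => x Wx /=; apply: fval_irr. Qed.

Lemma fam_sheaf : is_sheaf (Presheaf fres_id fres_comp).
Proof.
move=> U I V VU cov s compat.
pose idx x (Ux : U x) := projT1 (cid (cov x Ux)).
have idxP x (Ux : U x) : V (idx x Ux) x by exact: projT2 (cid (cov x Ux)).
pose t x (Ux : U x) := fval (s (idx x Ux)) (idxP x Ux).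
have tE i x (Vx : V i x) (Ux : U x) : t x Ux = fval (s i) Vx.
  have Ix : interO (V (idx x Ux)) (V i) x by split=> //; apply: idxP.
  have /(congr1 (fun u => fval u Ix)) /= := compat (idx x Ux) i.
  rewrite /t (Prop_irrelevance (idxP x Ux) (interOl Ix)) => ->.
  exact: fval_irr.
have tP : is_local t.
  move=> x Ux; have [W [WV [l [Wx sl]]]] := fvalP (s _) (idxP x Ux).
  exists W, (subset_trans WV (VU _)), l; split=> // y Wy Uy.
  by rewrite (tE _ _ (WV y Wy)) (sl y Wy).
exists (Fam tP); split=> [i|u uE].
  by apply: famP => x Vx /=; rewrite (tE i x Vx).
apply: famP => x Ux /=; rewrite (tE _ _ (idxP x Ux)) -uE /=.
exact: fval_irr.
Qed.

Definition famSheaf : modSheaf O :=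
  @ModSheaf X O fam (fun U V VU => fres VU) fresZ fres_id fres_comp fam_sheaf.

End Families.

Section TensorOps.
Variables (X : topologicalType) (O : ringSheaf X) (F : modSheaf O).

Section T2.

Definition T2E (x : X) : lmodType (rstalk O x) :=
  tensor (mstalk F x) (mstalk F x).
Definition T2G (V : opens X) : Type := (msec F V * msec F V)%type.
Definition T2pure (V : opens X) (g : T2G V) x (Vx : V x) : T2E x :=
  tens (mgerm Vx g.1) (mgerm Vx g.2).
Definition T2scale (V : opens X) (a : rsec O V) (g : T2G V) : T2G V :=
  (a *: g.1, g.2).
Definition T2gres (U V : opens X) (VU : V `<=` U) (g : T2G U) : T2G V :=
  (mres F VU g.1, mres F VU g.2).

Lemma T2scaleE (V : opens X) a (g : T2G V) x (Vx : V x) :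
  T2pure (T2scale a g) Vx = rgerm Vx a *: T2pure g Vx.
Proof. by rewrite /T2pure mgermZ tensZl. Qed.

Lemma T2gresE (U V : opens X) (VU : V `<=` U) (g : T2G U) x
  (Vx : V x) (Ux : U x) : T2pure (T2gres VU g) Vx = T2pure g Ux.
Proof. by rewrite /T2pure !(mgerm_res _ _ Ux). Qed.

Definition T2 : modSheaf O := famSheaf (FamData T2scaleE T2gresE).

Definition T2tens (V : opens X) (m n : msec F V) : msec T2 V :=
  fam_pure (E := FamData T2scaleE T2gresE) (m, n).

End T2.

Section A2.

Definition A2E (x : X) : lmodType (rstalk O x) := exterior2 (mstalk F x).
Definition A2pure (V : opens X) (g : T2G V) x (Vx : V x) : A2E x :=
  wedge (mgerm Vx g.1) (mgerm Vx g.2).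

Lemma A2scaleE (V : opens X) a (g : T2G V) x (Vx : V x) :
  A2pure (T2scale a g) Vx = rgerm Vx a *: A2pure g Vx.
Proof. by rewrite /A2pure mgermZ wedgeZl. Qed.

Lemma A2gresE (U V : opens X) (VU : V `<=` U) (g : T2G U) x
  (Vx : V x) (Ux : U x) : A2pure (T2gres VU g) Vx = A2pure g Ux.
Proof. by rewrite /A2pure !(mgerm_res _ _ Ux). Qed.

Definition A2 : modSheaf O := famSheaf (FamData A2scaleE A2gresE).

Lemma T2_A2_local (V : opens X) (s : msec T2 V) :
  is_local (E := FamData A2scaleE A2gresE)
    (fun x (Vx : V x) => tens_wedge (fval s Vx)).
Proof.
move=> x Vx; have [W [WV [l [Wx sl]]]] := fvalP s Vx.
exists W, WV, l; split=> // y Wy Vy; rewrite (sl y Wy Vy).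
elim: l {sl} => [|g l IHl]; first by rewrite !big_nil tens_wedge0.
by rewrite !big_cons tens_wedgeD IHl /= /T2pure tens_wedge_tens.
Qed.

Definition T2_A2 (V : opens X) (s : msec T2 V) : msec A2 V :=
  Fam (T2_A2_local s).

End A2.

Section Sym.
Variable n : nat.

Definition SE (x : X) : lmodType (rstalk O x) := symalg (mstalk F x).
Definition SG (V : opens X) : Type := (rsec O V * n.-tuple (msec F V))%type.
Definition Spure (V : opens X) (g : SG V) x (Vx : V x) : SE x :=
  symC _ (rgerm Vx g.1) * \prod_(m <- g.2) symV (mgerm Vx m).
Definition Sscale (V : opens X) (a : rsec O V) (g : SG V) : SG V :=
  (a * g.1, g.2).
Definition Sgres (U V : opens X) (VU : V `<=` U) (g : SG U) : SG V :=
  (rres O VU g.1, [tuple of map (mres F VU) g.2]).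

Lemma SscaleE (V : opens X) a (g : SG V) x (Vx : V x) :
  Spure (Sscale a g) Vx = rgerm Vx a *: Spure g Vx.
Proof. by rewrite /Spure rgermM symCM -mulrA. Qed.

Lemma SgresE (U V : opens X) (VU : V `<=` U) (g : SG U) x
  (Vx : V x) (Ux : U x) : Spure (Sgres VU g) Vx = Spure g Ux.
Proof.
rewrite /Spure /= (rgerm_res VU Vx Ux) big_map; congr (_ * _).
by apply: eq_bigr => m _; rewrite (mgerm_res _ _ Ux).
Qed.

Definition Sdata : famData O := FamData SscaleE SgresE.

(* S^n(F), with S^n(F_x) seen as the degree n part of Sym(F_x) *)
Definition Ssh : modSheaf O := famSheaf Sdata.

Definition symval (V : opens X) (s : msec Ssh V) x (Vx : V x) :
  symalg (mstalk F x) := fval s Vx.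

End Sym.

(* O -> S^0(F) and F -> S^1(F) *)
Definition Scst (V : opens X) (a : rsec O V) : msec (Ssh 0) V :=
  fam_pure (E := Sdata 0) (a, [tuple]).
Definition Sgen (V : opens X) (m : msec F V) : msec (Ssh 1) V :=
  fam_pure (E := Sdata 1) (1, [tuple m]).

Section R.
Variable n : nat.

Definition RE (x : X) : lmodType (rstalk O x) := Rpos (mstalk F x).
Definition RG (V : opens X) : Type := (msec (Ssh n) V * msec F V)%type.
Definition Rpure (V : opens X) (g : RG V) x (Vx : V x) : RE x :=
  tens (fval g.1 Vx) (mgerm Vx g.2).
Definition Rscale (V : opens X) (a : rsec O V) (g : RG V) : RG V :=
  (a *: g.1, g.2).
Definition Rgres (U V : opens X) (VU : V `<=` U) (g : RG U) : RG V :=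
  (mres (Ssh n) VU g.1, mres F VU g.2).

Lemma RscaleE (V : opens X) a (g : RG V) x (Vx : V x) :
  Rpure (Rscale a g) Vx = rgerm Vx a *: Rpure g Vx.
Proof. by rewrite /Rpure -tensZl. Qed.

Lemma RgresE (U V : opens X) (VU : V `<=` U) (g : RG U) x
  (Vx : V x) (Ux : U x) : Rpure (Rgres VU g) Vx = Rpure g Ux.
Proof.
rewrite /Rpure (mgerm_res _ _ Ux); congr tens.
exact: (@fval_irr _ _ (Sdata n) U g.1 x (VU x Vx) Ux).
Qed.

Definition Rdata : famData O := FamData RscaleE RgresE.

(* R^{n+1}(F) = S^n(F) (x) F, with S^n(F_x) (x) F_x seen as a direct summand of
   Sym(F_x) (x) F_x *)
Definition Rsh : modSheaf O := famSheaf Rdata.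

Definition Rval (V : opens X) (s : msec Rsh V) x (Vx : V x) :
  Rpos (mstalk F x) := fval s Vx.

End R.

(* F = R^1(F) *)
Definition Rgen (V : opens X) (m : msec F V) : msec (Rsh 0) V :=
  fam_pure (E := Rdata 0) (Scst 1, m).

End TensorOps.

Section Convolution.
Variable K : comPzRingType.
Implicit Types f g h : nat -> K.

Definition conv f g (n : nat) : K := \sum_(i < n.+1) f i * g (n - i)%N.

Lemma conv_rev f g n : conv f g n = \sum_(i < n.+1) f (n - i)%N * g i.
Proof.
rewrite /conv (reindex_inj rev_ord_inj) /=; apply: eq_bigr => i _.
by rewrite subSS subKn // -ltnS.
Qed.

Lemma convC f g n : conv f g n = conv g f n.
Proof. by rewrite conv_rev; apply: eq_bigr => i _; rewrite mulrC. Qed.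

Lemma convA f g h n : conv f (conv g h) n = conv (conv f g) h n.
Proof.
rewrite [RHS]conv_rev.
pose coef3 j k := f j * (g (n - j - k)%N * h k).
transitivity (\sum_(j < n.+1) \sum_(k < n.+1 | (k <= n - j)%N) coef3 j k).
  apply: eq_bigr => /= j _; rewrite conv_rev big_distrr /=.
  by rewrite (big_ord_narrow_leq (leq_subr _ _)).
rewrite (exchange_big_dep predT) //=; apply: eq_bigr => k _.
transitivity (\sum_(j < n.+1 | (j <= n - k)%N) coef3 j k).
  apply: eq_bigl => j; rewrite -ltnS -(ltnS j) -!subSn ?leq_ord //.
  by rewrite -subn_gt0 -(subn_gt0 j) -!subnDA addnC.
rewrite (big_ord_narrow_leq (leq_subr _ _)) big_distrl /=.
by apply: eq_bigr => j _; rewrite /coef3 -!subnDA addnC mulrA.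
Qed.

Lemma convDl f g h n : conv (fun i => f i + g i) h n = conv f h n + conv g h n.
Proof. by rewrite -big_split; apply: eq_bigr => i _; rewrite mulrDl. Qed.

Definition conv_const (a : K) (n : nat) : K := if n is 0%N then a else 0.

Lemma conv_constl a f n : conv (conv_const a) f n = a * f n.
Proof.
rewrite /conv big_ord_recl subn0 big1 ?addr0 // => i _.
by rewrite /= mul0r.
Qed.

Lemma eq_conv f f' g g' n : (forall i, (i <= n)%N -> f i = f' i) ->
  (forall i, (i <= n)%N -> g i = g' i) -> conv f g n = conv f' g' n.
Proof.
move=> ff' gg'; apply: eq_bigr => i _.
by rewrite ff' ?gg' ?leq_subr // -ltnS.
Qed.

End Convolution.

Section SymmetricSheaf.
Variables (X : topologicalType) (O : ringSheaf X) (F : modSheaf O).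

Section Sections.
Variable U : opens X.

Lemma Smul_local i j n (s : msec (Ssh F i) U) (t : msec (Ssh F j) U) :
  (i + j)%N = n ->
  is_local (E := Sdata F n) (fun x (Ux : U x) => symval s Ux * symval t Ux).
Proof.
move=> <- x Ux; have [V [VU [l [Vx sl]]]] := fvalP s Ux.
have [W [WU [k [Wx tk]]]] := fvalP t Ux.
exists (interO V W), (subset_trans (@interOl _ V W) VU).
exists [seq ((Sgres (@interOl _ V W) g).1 * (Sgres (@interOr _ V W) h).1,
             [tuple of (Sgres (@interOl _ V W) g).2 ++
                       (Sgres (@interOr _ V W) h).2]) | g <- l, h <- k].
split=> // y Iy Uy.
rewrite /symval (sl y (interOl Iy)) (tk y (interOr Iy)).
rewrite big_allpairs_dep /= big_distrl /=; apply: eq_bigr => g _.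
rewrite big_distrr /=; apply: eq_bigr => h _.
rewrite -(SgresE (@interOl _ V W) g Iy) -(SgresE (@interOr _ V W) h Iy).
by rewrite /Spure /= rgermM symCM big_cat /= mulrACA.
Qed.

Lemma sum_local n (I : Type) (r : seq I) (s : I -> forall x, U x -> SE F x) :
  (forall i, is_local (E := Sdata F n) (s i)) ->
  is_local (E := Sdata F n) (fun x (Ux : U x) => \sum_(i <- r) s i x Ux).
Proof.
move=> sP; have [t tE] : exists t : fam (Sdata F n) U,
  forall x (Ux : U x), fval t Ux = \sum_(i <- r) s i x Ux.
  elim: r => [|i r [t tE]]; first by exists 0 => x Ux; rewrite big_nil.
  by exists (Fam (sP i) + t) => x Ux; rewrite big_cons -tE.
by have := fvalP t; congr is_local; apply: functional_extensionality_dep => x;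
  apply: functional_extensionality_dep => Ux; rewrite tE.
Qed.

(* sections of S(F), the direct product of the S^n(F) *)
Definition Ssec : Type := forall n, msec (Ssh F n) U.

HB.instance Definition _ := gen_eqMixin Ssec.
HB.instance Definition _ := gen_choiceMixin Ssec.

Definition Sv (s : Ssec) x (Ux : U x) (n : nat) : symalg (mstalk F x) :=
  symval (s n) Ux.

Lemma SsecP (s t : Ssec) :
  (forall x (Ux : U x) n, Sv s Ux n = Sv t Ux n) -> s = t.
Proof.
move=> st; apply: functional_extensionality_dep => n.
by apply: famP => x Ux; apply: st.
Qed.

Definition Sadd (s t : Ssec) : Ssec := fun n => s n + t n.
Definition Sopp (s : Ssec) : Ssec := fun n => - s n.
Definition Szero : Ssec := fun n => 0.

Lemma SaddA : associative Sadd.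
Proof. by move=> s t u; apply: functional_extensionality_dep => n; apply: addrA. Qed.

Lemma SaddC : commutative Sadd.
Proof. by move=> s t; apply: functional_extensionality_dep => n; apply: addrC. Qed.

Lemma Sadd0 : left_id Szero Sadd.
Proof. by move=> s; apply: functional_extensionality_dep => n; apply: add0r. Qed.

Lemma SaddN : left_inverse Szero Sopp Sadd.
Proof. by move=> s; apply: functional_extensionality_dep => n; apply: addNr. Qed.

HB.instance Definition _ := GRing.isZmodule.Build Ssec SaddA SaddC Sadd0 SaddN.

Lemma Sconv_local (s t : Ssec) n :
  is_local (E := Sdata F n)
    (fun x (Ux : U x) => \sum_(i < n.+1) Sv s Ux i * Sv t Ux (n - i)).
Proof.
apply: (@sum_local n _ _
  (fun (i : 'I_n.+1) x (Ux : U x) => Sv s Ux i * Sv t Ux (n - i)%N : SE F x)).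
by move=> i; apply: Smul_local; rewrite subnKC // -ltnS.
Qed.

Definition Smul (s t : Ssec) : Ssec := fun n => Fam (Sconv_local s t n).

Lemma SmulE s t x (Ux : U x) : Sv (Smul s t) Ux = conv (Sv s Ux) (Sv t Ux).
Proof. by []. Qed.

Definition Sconst (a : rsec O U) : Ssec :=
  fun n => if n is 0%N then Scst F a else 0.

Lemma SconstE a x (Ux : U x) :
  Sv (Sconst a) Ux = conv_const (symC _ (rgerm Ux a)).
Proof.
apply: functional_extensionality_dep => -[|n] //=.
by rewrite /Sv /symval /= /Spure big_nil mulr1.
Qed.

Definition Sone : Ssec := Sconst 1.

Lemma SmulA : associative Smul.
Proof.
move=> s t u; apply: SsecP => x Ux n.
by rewrite [LHS]convA.
Qed.

Lemma SmulC : commutative Smul.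
Proof. by move=> s t; apply: SsecP => x Ux n; apply: convC. Qed.

Lemma Smul1 : left_id Sone Smul.
Proof.
by move=> s; apply: SsecP => x Ux n; rewrite SmulE SconstE rgerm1 conv_constl mul1r.
Qed.

Lemma SmulDl : left_distributive Smul +%R.
Proof. by move=> s t u; apply: SsecP => x Ux n; apply: convDl. Qed.

HB.instance Definition _ := GRing.Zmodule_isComPzRing.Build Ssec
  SmulA SmulC Smul1 SmulDl.

Lemma SconstD a b : Sconst (a + b) = Sconst a + Sconst b.
Proof.
apply: SsecP => x Ux n; rewrite -[RHS]/(Sv (Sconst a) Ux n + Sv (Sconst b) Ux n).
rewrite !SconstE; case: n => [|n] /=; last by rewrite addr0.
by rewrite rgermD symCD.
Qed.

Lemma SconstB : zmod_morphism Sconst.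
Proof. by move=> a b; apply: (addIr (Sconst b)); rewrite -SconstD !subrK. Qed.

Lemma SconstM : monoid_morphism Sconst.
Proof.
split=> // a b; apply: SsecP => x Ux n.
rewrite -[RHS]/(Sv (Smul _ _) Ux n) SmulE !SconstE conv_constl rgermM symCM.
by case: n => //= n; rewrite mulr0.
Qed.

HB.instance Definition _ := GRing.isZmodMorphism.Build _ _ Sconst SconstB.
HB.instance Definition _ := GRing.isMonoidMorphism.Build _ _ Sconst SconstM.

End Sections.

Section Restriction.
Variables (U V : opens X) (VU : V `<=` U).

Definition Sres (s : Ssec U) : Ssec V := fun n => mres (Ssh F n) VU (s n).

Lemma SresB : zmod_morphism Sres.
Proof.
by move=> s t; apply: functional_extensionality_dep => n; apply: raddfB.
Qed.

Lemma SresE s x (Vx : V x) n : Sv (Sres s) Vx n = Sv s (@VU x Vx) n.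
Proof. by []. Qed.

Lemma Sres_const a : Sconst (rres O VU a) = Sres (Sconst a).
Proof.
apply: SsecP => x Vx n.
by rewrite SresE !SconstE (rgerm_res VU Vx (@VU x Vx)).
Qed.

Lemma SresM : monoid_morphism Sres.
Proof.
split; first by rewrite -[1]/(Sconst 1) -Sres_const rmorph1.
by move=> s t; apply: SsecP => x Vx n.
Qed.

HB.instance Definition _ := GRing.isZmodMorphism.Build _ _ Sres SresB.
HB.instance Definition _ := GRing.isMonoidMorphism.Build _ _ Sres SresM.

End Restriction.

Lemma Sres_id (U : opens X) (UU : U `<=` U) (s : Ssec U) : Sres UU s = s.
Proof. by apply: functional_extensionality_dep => n; apply: fres_id. Qed.

Lemma Sres_comp (U V W : opens X) (VU : V `<=` U) (WV : W `<=` V)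
  (WU : W `<=` U) (s : Ssec U) : Sres WV (Sres VU s) = Sres WU s.
Proof. by apply: functional_extensionality_dep => n; apply: fres_comp. Qed.

Lemma S_sheaf : is_sheaf (Presheaf Sres_id Sres_comp).
Proof.
move=> U I V VU cov s compat.
have H n : exists! t : msec (Ssh F n) U,
    forall i, pres (p := Ssh F n) (VU i) t = s i n.
  by apply: (@msheaf X O (Ssh F n)) => // i j; have /(congr1 (@^~ n)) := compat i j.
exists (fun n => projT1 (cid (H n))); split=> [i|t tE].
  apply: functional_extensionality_dep => n.
  by have [+ _] := projT2 (cid (H n)); apply.
apply: functional_extensionality_dep => n.
have [_] := projT2 (cid (H n)); apply=> i.
by have /(congr1 (@^~ n)) := tE i.
Qed.

Definition Sring : ringSheaf X :=
  @RingSheaf X Ssec (fun U V VU => Sres VU) Sres_id Sres_comp S_sheaf.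

Definition Salg : algSheaf O :=
  @AlgSheaf X O Sring (fun U => @Sconst U) (fun U V VU a => Sres_const VU a).

Section Truncation.
Variable N : nat.

Section Sections.
Variable U : opens X.

(* sections of the product of the S^i(F), i <= N *)
Definition Tsec : Type := forall i : 'I_N.+1, msec (Ssh F i) U.

HB.instance Definition _ := gen_eqMixin Tsec.
HB.instance Definition _ := gen_choiceMixin Tsec.

Definition trunc (s : Ssec U) : Tsec := fun i => s i.

(* extension by zero in degrees > N, a section of [trunc] *)
Definition pad (t : Tsec) : Ssec U := fun n =>
  match @idP (n < N.+1)%N with
  | ReflectT h => t (Ordinal h)
  | ReflectF _ => 0
  end.

Lemma padK : cancel pad trunc.
Proof.
move=> t; apply: functional_extensionality_dep => i; rewrite /trunc /pad.
case: i => i h /=; case: {-}_ / idP => [h'|/(_ h) //].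
by rewrite (bool_irrelevance h' h).
Qed.

Lemma trunc_eqP (s s' : Ssec U) :
  (forall x (Ux : U x) n, (n <= N)%N -> Sv s Ux n = Sv s' Ux n) <->
  trunc s = trunc s'.
Proof.
split=> [ss'|/[swap] x /[swap] Ux /[swap] n ss' nN].
  apply: functional_extensionality_dep => i; apply: famP => x Ux.
  by apply: ss'; rewrite -ltnS.
have /(congr1 (fun t : Tsec => t (Ordinal (nN : (n < N.+1)%N)))) := ss'.
by rewrite /trunc /= /Sv => ->.
Qed.

Definition Tadd (s t : Tsec) : Tsec := fun i => s i + t i.
Definition Topp (s : Tsec) : Tsec := fun i => - s i.
Definition Tzero : Tsec := fun i => 0.

Lemma TaddA : associative Tadd.
Proof. by move=> s t u; apply: functional_extensionality_dep => n; apply: addrA. Qed.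

Lemma TaddC : commutative Tadd.
Proof. by move=> s t; apply: functional_extensionality_dep => n; apply: addrC. Qed.

Lemma Tadd0 : left_id Tzero Tadd.
Proof. by move=> s; apply: functional_extensionality_dep => n; apply: add0r. Qed.

Lemma TaddN : left_inverse Tzero Topp Tadd.
Proof. by move=> s; apply: functional_extensionality_dep => n; apply: addNr. Qed.

HB.instance Definition _ := GRing.isZmodule.Build Tsec TaddA TaddC Tadd0 TaddN.

Definition Tmul (s t : Tsec) : Tsec := trunc (pad s * pad t).
Definition Tone : Tsec := trunc 1.

Lemma trunc_mul (s t : Ssec U) : trunc (s * t) = Tmul (trunc s) (trunc t).
Proof.
apply/trunc_eqP => x Ux n nN; apply: eq_conv => i ni.
  by have /trunc_eqP/(_ x Ux i (leq_trans ni nN)) := padK (trunc s).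
by have /trunc_eqP/(_ x Ux i (leq_trans ni nN)) := padK (trunc t).
Qed.

Lemma trunc_sub (s t : Ssec U) : trunc (s - t) = trunc s - trunc t.
Proof. by []. Qed.

Lemma trunc_add (s t : Ssec U) : trunc (s + t) = trunc s + trunc t.
Proof. by []. Qed.

Lemma TmulA : associative Tmul.
Proof.
by move=> s t u; rewrite -(padK s) -(padK t) -(padK u) -!trunc_mul mulrA.
Qed.

Lemma TmulC : commutative Tmul.
Proof. by move=> s t; rewrite /Tmul mulrC. Qed.

Lemma Tmul1 : left_id Tone Tmul.
Proof. by move=> s; rewrite -(padK s) -trunc_mul mul1r. Qed.

Lemma TmulDl : left_distributive Tmul +%R.
Proof.
move=> s t u; rewrite -(padK s) -(padK t) -(padK u).
by rewrite -trunc_add -!trunc_mul mulrDl trunc_add.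
Qed.

HB.instance Definition _ := GRing.Zmodule_isComPzRing.Build Tsec
  TmulA TmulC Tmul1 TmulDl.

Lemma trunc_monoid : monoid_morphism trunc.
Proof. by split=> // s t; apply: trunc_mul. Qed.

HB.instance Definition _ := GRing.isZmodMorphism.Build _ _ trunc trunc_sub.
HB.instance Definition _ := GRing.isMonoidMorphism.Build _ _ trunc trunc_monoid.

Definition Tconst (a : rsec O U) : Tsec := trunc (Sconst a).
HB.instance Definition _ := GRing.RMorphism.copy Tconst (trunc \o @Sconst U).

(* the inclusion of the part of degree N *)
Definition Ttop (s : msec (Ssh F N) U) : Tsec := fun i =>
  match @eqP _ N i with
  | ReflectT e => ecast n (msec (Ssh F n) U) e s
  | ReflectF _ => 0
  end.

End Sections.

Section Restriction.
Variables (U V : opens X) (VU : V `<=` U).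

Definition Tres (t : Tsec U) : Tsec V := fun i => mres (Ssh F i) VU (t i).

Lemma Tres_trunc s : Tres (trunc s) = trunc (Sres VU s).
Proof. by []. Qed.

Lemma TresB : zmod_morphism Tres.
Proof.
by move=> s t; apply: functional_extensionality_dep => n; apply: raddfB.
Qed.

Lemma TresM : monoid_morphism Tres.
Proof.
split=> [|s t]; first by rewrite Tres_trunc rmorph1.
rewrite -(padK s) -(padK t) -[LHS]/(Tres (Tmul _ _)) -trunc_mul !Tres_trunc.
by rewrite !rmorphM.
Qed.

HB.instance Definition _ := GRing.isZmodMorphism.Build _ _ Tres TresB.
HB.instance Definition _ := GRing.isMonoidMorphism.Build _ _ Tres TresM.

Lemma Tres_const a : Tconst (rres O VU a) = Tres (Tconst a).
Proof. by rewrite /Tconst Sres_const. Qed.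

End Restriction.

Lemma Tres_id (U : opens X) (UU : U `<=` U) (s : Tsec U) : Tres UU s = s.
Proof. by apply: functional_extensionality_dep => n; apply: fres_id. Qed.

Lemma Tres_comp (U V W : opens X) (VU : V `<=` U) (WV : W `<=` V)
  (WU : W `<=` U) (s : Tsec U) : Tres WV (Tres VU s) = Tres WU s.
Proof. by apply: functional_extensionality_dep => n; apply: fres_comp. Qed.

Lemma T_sheaf : is_sheaf (Presheaf Tres_id Tres_comp).
Proof.
move=> U I V VU cov s compat.
have H n : exists! t : msec (Ssh F (nat_of_ord n)) U,
    forall i, pres (p := Ssh F n) (VU i) t = s i n.
  by apply: (@msheaf X O (Ssh F n)) => // i j; have /(congr1 (@^~ n)) := compat i j.
exists (fun n => projT1 (cid (H n))); split=> [i|t tE].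
  apply: functional_extensionality_dep => n.
  by have [+ _] := projT2 (cid (H n)); apply.
apply: functional_extensionality_dep => n.
have [_] := projT2 (cid (H n)); apply=> i.
by have /(congr1 (@^~ n)) := tE i.
Qed.

Definition Tring : ringSheaf X :=
  @RingSheaf X Tsec (fun U V VU => Tres VU) Tres_id Tres_comp T_sheaf.

Definition Talg : algSheaf O :=
  @AlgSheaf X O Tring (fun U => @Tconst U) (fun U V VU a => Tres_const VU a).

End Truncation.

End SymmetricSheaf.
Arguments trunc {X O F} N {U} s.

Section SelfAlgebra.
Variables (X : topologicalType) (O : ringSheaf X).

Definition self_str (U : opens X) : {rmorphism rsec O U -> rsec O U} := idfun.

Definition self_alg : algSheaf O :=
  @AlgSheaf X O O self_str (fun U V VU a => erefl).

End SelfAlgebra.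

Lemma fullO_sub (X : topologicalType) (U : opens X) : U `<=` fullO.
Proof. exact: subsetT. Qed.

Definition on_open (X : topologicalType) (P Q : presheaf X)
    (f : smap fullO P Q) (U : opens X) : smap U P Q :=
  srestr (@fullO_sub X U) f.

Definition short_exact (X : topologicalType) (O : ringSheaf X) (U : opens X)
    (F G H : modSheaf O) (f : smap U F G) (g : smap U G H) : Prop :=
  [/\ linear_map f, linear_map g, inj_map f, locally_surj g
    & forall (V : opens X) (VU : V `<=` U) (s : msec G V),
        g V VU s = (0 : msec H V) <->
        forall x, V x -> exists (W : opens X) (WV : W `<=` V) (m : msec F W),
          W x /\ f W (subset_trans WV VU) m = mres G WV s].

Definition alg_quotient (X : topologicalType) (O : ringSheaf X) (U : opens X)
    (R S : algSheaf O) (q : smap U R S) : Prop :=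
  alg_map q /\ locally_surj q.

Definition alg_iso (X : topologicalType) (O : ringSheaf X) (U : opens X)
    (R S : algSheaf O) (f : smap U R S) : Prop :=
  alg_map f /\ bij_map f.

Section Hasse.
Variables (X : topologicalType) (OB : QSheaf X) (OX : algSheaf OB).
Variable F : modSheaf OX.

Definition ratO (V : opens X) (q : rat) : rsec OX V := astr OX V (qstr OB V q).
Definition rat_germ (V : opens X) x (Vx : V x) (q : rat) : rstalk OX x :=
  rgerm Vx (ratO V q).

Section OnOpen.
Variable U : opens X.

Definition is_derivation (D : smap U OX F) : Prop :=
  forall (V : opens X) (VU : V `<=` U),
  [/\ forall a b : rsec OX V, D V VU (a + b) = D V VU a + (D V VU b : msec F V),
      forall a b : rsec OX V,
        D V VU (a * b) = a *: (D V VU b : msec F V) + b *: (D V VU a : msec F V)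
    & forall (b : rsec OB V) (a : rsec OX V),
        D V VU (astr OX V b * a) = astr OX V b *: (D V VU a : msec F V)].

Variable D : smap U OX F.

Definition is_connection (gamma : smap U F (T2 F)) : Prop :=
  base_linear_map gamma /\
  forall (V : opens X) (VU : V `<=` U) (a : rsec OX V) (m : msec F V),
    gamma V VU (a *: m) =
    T2tens (D V VU a) m + a *: (gamma V VU m : msec (T2 F) V).

Definition is_flat (gamma : smap U F (T2 F)) : Prop :=
  forall (V : opens X) (VU : V `<=` U) (a : rsec OX V),
    T2_A2 (gamma V VU (D V VU a)) = 0.

Definition integrable : Prop :=
  exists gamma : smap U F (T2 F), is_connection gamma /\ is_flat gamma.

(* [T i] takes values in R^{i+1}(F) *)
Definition is_extended_connection (T : forall i, smap U F (Rsh F i)) : Prop :=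
  [/\ forall i, base_linear_map (T i),
      forall (V : opens X) (VU : V `<=` U) (m : msec F V), T 0%N V VU m = Rgen m
    & forall i (V : opens X) (VU : V `<=` U) (a : rsec OX V) (m : msec F V) x (Vx : V x),
        (0 < i)%N ->
        Rval (T i V VU (a *: m)) Vx =
        rgerm Vx a *: Rval (T i V VU m) Vx +
        \sum_(1 <= j < i.+1) rat_germ Vx j%:R^-1 *:
          Rpos_mul (Rval (T j.-1 V VU (D V VU a)) Vx)
                   (Rval (T (i - j)%N V VU m) Vx)].

Definition is_hasse (h : smap U OX (Salg F)) : Prop :=
  base_alg_map h /\
  forall (V : opens X) (VU : V `<=` U) (a : rsec OX V),
    (h V VU a : Ssec F V) 0%N = Scst F a.

Definition hasse_extends (h : smap U OX (Salg F)) : Prop :=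
  forall (V : opens X) (VU : V `<=` U) (a : rsec OX V),
    (h V VU a : Ssec F V) 1%N = Sgen (D V VU a).

Definition hasse_iterated (h : smap U OX (Salg F)) : Prop :=
  exists T : forall i, smap U F (Rsh F i), is_extended_connection T /\
    forall i (V : opens X) (VU : V `<=` U) (a : rsec OX V) x (Vx : V x), (0 < i)%N ->
      symval ((h V VU a : Ssec F V) i) Vx =
      rat_germ Vx i%:R^-1 *: Rpos_sym (Rval (T i.-1 V VU (D V VU a)) Vx).

Definition iterated_hasse (h : smap U OX (Salg F)) : Prop :=
  [/\ is_hasse h, hasse_extends h & hasse_iterated h].

End OnOpen.

(* [phiq p q] is the part S^p(F) -> S^{p+q}(F) of phi of degree q *)
Definition homogeneous_parts (U : opens X) (phi : smap U (Salg F) (Salg F))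
    (phiq : forall p q, smap U (Ssh F p) (Ssh F (p + q)%N)) : Prop :=
  (forall p q, linear_map (phiq p q)) /\
  forall n (V : opens X) (VU : V `<=` U) (w : Ssec F V) x (Vx : V x),
    symval ((phi V VU w : Ssec F V) n) Vx =
    \sum_(p < n.+1) symval (phiq p (n - p)%N V VU (w p)) Vx.

Definition is_equivalence (U : opens X) (h h' : smap U OX (Salg F))
    (phi : smap U (Salg F) (Salg F)) : Prop :=
  [/\ alg_iso phi,
      forall (V : opens X) (VU : V `<=` U) (a : rsec OX V),
        h' V VU a = phi V VU (h V VU a)
    & exists phiq, homogeneous_parts phi phiq /\
        forall (V : opens X) (VU : V `<=` U) (m : msec F V),
          phiq 1%N 0%N V VU (Sgen m) = Sgen m].

Definition locally_integrable (D : smap fullO OX F) : Prop :=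
  forall x, exists U : opens X, U x /\ integrable (on_open D U).

End Hasse.

(* Main.v *)
Require Import Defs.
From HB Require Import structures.
From mathcomp Require Import all_boot all_order all_algebra.
From mathcomp Require Import boolp classical_sets topology_structure.

Set Implicit Arguments.
Unset Strict Implicit.
Unset Printing Implicit Defensive.

Import GRing.Theory.
Local Open Scope classical_set_scope.
Local Open Scope ring_scope.

(** Write S = S(F), R = S (x) F, and let delta : S -> R be the universal
    O_X-derivation.  A D-connection gamma extends to a derivation nabla of S over
    D and to a nabla-derivation gam of R; T = exp(gam) is an extended D-connection
    and h0 = exp(nabla) its Hasse derivation.  If gamma is flat, the commutator of
    nabla with the covariant derivative in the vertical direction kills O_X, so it
    is an S-linear function (the curvature) of delta.  The Jacobi equation then
    yields an h0-semilinear V : F -> R with delta h0 = V D: the vertical derivative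
    of the exponential map stays tangent to the leaves.  This is where flatness is
    used.

    Let h be an iterated Hasse derivation, with extended connection T'.  Solving
    degree by degree the equation phi_* V = mu T', where mu : R -> S is the product
    and phi_* is phi followed by the Euler operator, gives an O_X-linear F -> S whose
    extension phi to S satisfies phi h0 = h, because both sides have the same image
    under the Euler operator.
    Such a phi does not decrease degrees and is the identity on the associated
    graded algebra, hence invertible; composing, any two iterated Hasse derivations
    are equivalent.  The difference of two equivalences is, in the first degree
    where they differ, a linear map F -> S killing D(O_X), so the equivalence is
    unique.  Uniqueness makes the equivalences a cocycle, and J and its truncations
    are glued from the S(F)|_U along it.

    Since the tensor operations are defined by local families of elements of the
    tensor powers of the stalks, the algebra is done on the stalks, and each
    operator is then shown to preserve locality of families. *)

(** * Maps out of tensor products and symmetric algebras *)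

(** The equation phi h0 = h constrains phi only through D(O_X), which need not generate F; this is
    why it is replaced by phi_* V = mu T' on all of F. The left side is semilinear over phi h0 and
    the right side over h. Once they agree below degree q, evaluating at D(a) and inverting the
    Euler operator in positive degrees gives phi h0 = h through degree q. In degree q all mixed
    terms of the two semilinearity formulas then cancel, so the defect is O_X-linear, and its
    quotient by q + 1 is the next homogeneous part of phi. Linearity of phi is thus a by-product of
    the induction. For the same reason V has to be defined on all of F and not only on D(O_X). The
    Jacobi recursion started at D(a) merely records derivatives of exp(nabla)(a), but since flatness
    makes the commutator a function of delta, the recursion itself no longer mentions a and can be
    started at any section of F. *)

Section TensorLift.
Variables (A : comPzRingType) (N M : lmodType A) (P : zmodType).
Variable f : N -> M -> P.

(** The argument [c] collects the scalars met on the way down and releases them into the left factor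
    at a generator. So the target need only be an abelian group and [f] only balanced, which covers
    the semilinear and Leibniz-type maps that [pmlift] cannot produce. *)
Fixpoint tens_eval (s : mterm A (N * M)) (c : A) : P :=
  match s with
  | MZero => 0
  | MGen g => f (c *: g.1) g.2
  | MAdd s t => tens_eval s c + tens_eval t c
  | MScale a s => tens_eval s (c * a)
  end.

Definition tens_lift (u : tensor N M) : P := tens_eval (rep u) 1.

Hypothesis fDl : forall m, {morph f^~ m : s t / s + t}.
Hypothesis fDr : forall s, {morph f s : m n / m + n}.
Hypothesis f_bal : forall a s m, f s (a *: m) = f (a *: s) m.

Lemma tens_evalD s a b : tens_eval s (a + b) = tens_eval s a + tens_eval s b.
Proof.
elim: s a b => [|g|s IHs t IHt|c s IHs] a b /=.
- by rewrite addr0.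
- by rewrite scalerDl fDl.
- by rewrite IHs IHt addrACA.
- by rewrite mulrDl IHs.
Qed.

Lemma tens_eval0 s : tens_eval s 0 = 0.
Proof. by apply: (addIr (tens_eval s 0)); rewrite -tens_evalD !add0r. Qed.

Lemma tens_eval_meq s t : meq (@bilin_rel A N M) s t ->
  forall c, tens_eval s c = tens_eval t c.
Proof.
elim=> {s t} //=.
- by move=> s t u _ IH1 _ IH2 c; rewrite IH1 IH2.
- by move=> s s' t t' _ IH1 _ IH2 c; rewrite IH1 IH2.
- by move=> *; rewrite addrA.
- by move=> *; rewrite addrC.
- by move=> *; rewrite add0r.
- by move=> s c; rewrite mulr0 tens_eval0.
- by move=> s c; rewrite mulr1.
- by move=> a b s c; rewrite mulrA.
- by move=> a b s c; rewrite mulrDr tens_evalD.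
- by move=> s t [] *; rewrite /= ?scalerDr ?fDl ?fDr ?f_bal ?scalerA // mulrC.
Qed.

Lemma tens_lift_cls s : tens_lift (cls (meq_eqv (@bilin_rel A N M)) s) = tens_eval s 1.
Proof. by apply: tens_eval_meq; apply: (@rep_cls _ (meq_eqv (@bilin_rel A N M))). Qed.

Lemma tens_lift_tens s m : tens_lift (tens s m) = f s m.
Proof. by rewrite tens_lift_cls /= scale1r. Qed.

Lemma tens_liftD : {morph tens_lift : u v / u + v}.
Proof.
elim/presmodP=> s; elim/presmodP=> t.
by rewrite [_ + _]cls_madd !tens_lift_cls.
Qed.

End TensorLift.

Lemma tensor_ind (A : comPzRingType) (N M : lmodType A) (Q : tensor N M -> Prop) :
  Q 0 -> (forall s m, Q (tens s m)) -> (forall u v, Q u -> Q v -> Q (u + v)) ->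
  forall u, Q u.
Proof.
move=> Q0 Qt QD; elim/presmodP.
suff H s : forall c : A, Q (c *: (cls (meq_eqv (@bilin_rel A N M)) s : tensor N M)).
  by move=> s; rewrite -[X in Q X](scale1r (_ : tensor N M)); apply: H.
elim: s => [|[n m]|s IHs t IHt|a s IHs] c.
- by rewrite -[X in c *: X]/(0 : tensor N M) scaler0.
- by rewrite -[X in c *: X]/(tens n m) -tensZl.
- rewrite -[X in c *: X]cls_madd.
  by rewrite -[X in c *: X]/((_ : tensor N M) + (_ : tensor N M)) scalerDr; apply: QD.
- rewrite -[X in c *: X]cls_mscale.
  by rewrite -[X in c *: X]/(a *: (_ : tensor N M)) scalerA; apply: IHs.
Qed.

Section SymmetricLift.
Variables (A : comPzRingType) (M : lmodType A).
Notation S := (symalg M).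

Lemma symalg_ind (Q : S -> Prop) :
  (forall a, Q (symC M a)) -> (forall m, Q (symV m)) ->
  (forall u v, Q u -> Q v -> Q (u + v)) -> (forall u v, Q u -> Q v -> Q (u * v)) ->
  forall u, Q u.
Proof.
move=> QC QV QD QM; elim/symalgP; elim=> // s IHs t IHt.
- by have := QD _ _ IHs IHt; rewrite [_ + _]cls_sadd.
- by have := QM _ _ IHs IHt; rewrite [_ * _]cls_smul.
Qed.

Section Derivation.
Variables (P : lmodType S) (d : A -> P) (c : M -> P).

(** The coefficients in the Leibniz rule are the classes of the subterms. A nonzero [d] on constants
    is allowed because the derivations built later extend D. *)
Fixpoint symder_eval (s : sterm M) : P :=
  match s with
  | SCst a => d a
  | SGen m => c m
  | SAdd s t => symder_eval s + symder_eval t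
  | SMul s t => (cls (symeq_eqv M) s : S) *: symder_eval t +
                (cls (symeq_eqv M) t : S) *: symder_eval s
  end.

Definition symder (u : S) : P := symder_eval (rep u).

Hypothesis dD : {morph d : a b / a + b}.
Hypothesis dM : forall a b, d (a * b) = symC M a *: d b + symC M b *: d a.
Hypothesis cD : {morph c : m n / m + n}.
Hypothesis cZ : forall a m, c (a *: m) = symC M a *: c m + symV m *: d a.

Lemma symder_eval_eq s t : symeq s t -> symder_eval s = symder_eval t.
Proof.
have d0 : d 0 = 0 by apply: (addIr (d 0)); rewrite -dD !add0r.
have d1 : d 1 = 0.
  by apply: (addIr (d 1)); rewrite add0r -[RHS](congr1 d (mulr1 1)) dM symC1 !scale1r.
have clE s' t' : symeq s' t' -> cls (symeq_eqv M) s' = cls (symeq_eqv M) t'.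
  by move=> st; apply/clsP.
have clA s' t' : cls (symeq_eqv M) (SAdd s' t') =
    (cls (symeq_eqv M) s' : S) + (cls (symeq_eqv M) t' : S).
  by rewrite [RHS]cls_sadd.
have clM s' t' : cls (symeq_eqv M) (SMul s' t') =
    (cls (symeq_eqv M) s' : S) * (cls (symeq_eqv M) t' : S).
  by rewrite [RHS]cls_smul.
elim=> {s t} //=.
- by move=> s t u _ -> _ ->.
- by move=> s s' t t' _ -> _ ->.
- by move=> s s' t t' ss' -> tt' ->; rewrite (clE _ _ ss') (clE _ _ tt').
- by move=> *; rewrite addrA.
- by move=> *; rewrite addrC.
- by move=> s; rewrite d0 add0r.
- move=> s t u; rewrite !clM !scalerDr !scalerA -addrA.
  by congr (_ + (_ *: _ + _ *: _)); rewrite mulrC.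
- by move=> *; rewrite addrC.
- by move=> s; rewrite d1 scaler0 addr0; apply: scale1r.
- by move=> s; rewrite d0 scaler0 addr0; apply: scale0r.
- by move=> s t u; rewrite clA scalerDl scalerDr addrACA.
Qed.

Lemma symder_cls s : symder (cls (symeq_eqv M) s) = symder_eval s.
Proof. by apply: symder_eval_eq; apply: (@rep_cls _ (symeq_eqv M)). Qed.

Lemma symderC a : symder (symC M a) = d a.
Proof. exact: symder_cls. Qed.

Lemma symderV m : symder (symV m) = c m.
Proof. exact: symder_cls. Qed.

Lemma symderD : {morph symder : u v / u + v}.
Proof.
by elim/symalgP=> s; elim/symalgP=> t; rewrite [_ + _]cls_sadd !symder_cls.
Qed.

Lemma symderM u v : symder (u * v) = u *: symder v + v *: symder u.
Proof.
elim/symalgP: u => s; elim/symalgP: v => t.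
by rewrite [_ * _]cls_smul !symder_cls.
Qed.

End Derivation.

Section Morphism.
Variables (B : comPzRingType) (i : {rmorphism A -> B}) (g : M -> B).

Fixpoint sym_eval (s : sterm M) : B :=
  match s with
  | SCst a => i a
  | SGen m => g m
  | SAdd s t => sym_eval s + sym_eval t
  | SMul s t => sym_eval s * sym_eval t
  end.

Definition symlift (u : S) : B := sym_eval (rep u).

Hypothesis gD : {morph g : m n / m + n}.
Hypothesis gZ : forall a m, g (a *: m) = i a * g m.

Lemma sym_eval_eq s t : symeq s t -> sym_eval s = sym_eval t.
Proof.
elim=> {s t} //=.
- by move=> s t u _ -> _ ->.
- by move=> s s' t t' _ -> _ ->.
- by move=> s s' t t' _ -> _ ->.
- by move=> *; rewrite addrA.
- by move=> *; rewrite addrC.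
- by move=> s; rewrite rmorph0 add0r.
- by move=> *; rewrite mulrA.
- by move=> *; rewrite mulrC.
- by move=> s; rewrite rmorph1 mul1r.
- by move=> s; rewrite rmorph0 mul0r.
- by move=> *; rewrite mulrDl.
- by move=> *; rewrite rmorphD.
- by move=> *; rewrite rmorphM.
Qed.

Lemma symlift_cls s : symlift (cls (symeq_eqv M) s) = sym_eval s.
Proof. by apply: sym_eval_eq; apply: (@rep_cls _ (symeq_eqv M)). Qed.

Lemma symliftC a : symlift (symC M a) = i a.
Proof. exact: symlift_cls. Qed.

Lemma symliftV m : symlift (symV m) = g m.
Proof. exact: symlift_cls. Qed.

Lemma symliftD : {morph symlift : u v / u + v}.
Proof.
by elim/symalgP=> s; elim/symalgP=> t; rewrite [_ + _]cls_sadd !symlift_cls.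
Qed.

Lemma symliftM : {morph symlift : u v / u * v}.
Proof.
by elim/symalgP=> s; elim/symalgP=> t; rewrite [_ * _]cls_smul !symlift_cls.
Qed.

End Morphism.

End SymmetricLift.

Section SymConst.
Variables (A : comPzRingType) (M : lmodType A).

Lemma symCB : zmod_morphism (@symC A M).
Proof. by move=> a b; apply: (addIr (symC M b)); rewrite -symCD !subrK. Qed.

Lemma symC_monoid : monoid_morphism (@symC A M).
Proof. by split=> // a b; apply: symCM. Qed.

HB.instance Definition _ := GRing.isZmodMorphism.Build _ _ (@symC A M) symCB.
HB.instance Definition _ :=
  GRing.isMonoidMorphism.Build _ _ (@symC A M) symC_monoid.

End SymConst.

Section RModule.
Variables (A : comPzRingType) (M : lmodType A).
Notation S := (symalg M).

Lemma Rpos_symD : {morph @Rpos_sym A M : u v / u + v}.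
Proof.
apply: pmliftD => _ _ [] /= *.
- by rewrite mulrDl.
- by rewrite symVD mulrDr.
- by rewrite !symZE mulrA.
- by rewrite symVZ symZE mulrCA.
Qed.

Lemma Rpos_sym0 : Rpos_sym (0 : Rpos M) = 0.
Proof. by apply: (addIr (Rpos_sym 0)); rewrite -Rpos_symD !add0r. Qed.

Lemma Rpos_actDr (s : S) : {morph Rpos_act s : u v / u + v}.
Proof.
apply: pmliftD => _ _ [] /= *.
- by rewrite mulrDr tensDl.
- by rewrite tensDr.
- by rewrite -tensZl !symZE mulrCA.
- by rewrite tensZr.
Qed.

Lemma Rpos_act0 (s : S) : Rpos_act s 0 = 0.
Proof. by apply: (addIr (Rpos_act s 0)); rewrite -Rpos_actDr !add0r. Qed.

(* [Rpos M] is an A-module; this alias carries the S(M)-module structure. *)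
Definition Rmod : Type := Rpos M.
HB.instance Definition _ := GRing.Zmodule.on Rmod.

Definition Rscal (s : S) (u : Rmod) : Rmod := Rpos_act s u.

Lemma RscalA s t u : Rscal s (Rscal t u) = Rscal (s * t) u.
Proof.
rewrite /Rscal; elim/tensor_ind: u => [|v m|u v IHu IHv].
- by rewrite !Rpos_act0.
- by rewrite !Rpos_act_tens mulrA.
- by rewrite !Rpos_actDr IHu IHv.
Qed.

Lemma Rscal1 : left_id 1 Rscal.
Proof.
rewrite /Rscal; elim/tensor_ind => [|v m|u v IHu IHv].
- by rewrite !Rpos_act0.
- by rewrite !Rpos_act_tens mul1r.
- by rewrite !Rpos_actDr IHu IHv.
Qed.

Lemma RscalDr : right_distributive Rscal +%R.
Proof. by move=> s u v; apply: Rpos_actDr. Qed.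

Lemma RscalDl u : {morph Rscal^~ u : s t / s + t}.
Proof.
move=> s t; rewrite /Rscal; elim/tensor_ind: u => [|v m|u v IHu IHv].
- by rewrite !Rpos_act0 addr0.
- by rewrite !Rpos_act_tens mulrDl tensDl.
- by rewrite !Rpos_actDr IHu IHv addrACA.
Qed.

HB.instance Definition _ := GRing.Zmodule_isLmodule.Build S Rmod
  RscalA Rscal1 RscalDr RscalDl.

Definition Rone (m : M) : Rmod := tens (1 : S) m.

Lemma RactE (s : S) (u : Rmod) : Rpos_act s u = s *: u. Proof. by []. Qed.

Lemma RtensE (s : S) (m : M) : tens s m = s *: Rone m.
Proof. by rewrite -RactE Rpos_act_tens mulr1. Qed.

Lemma RposZ (a : A) (u : Rpos M) : a *: u = symC M a *: (u : Rmod).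
Proof.
rewrite -RactE; elim/tensor_ind: u => [|v m|u v IHu IHv].
- by rewrite Rpos_act0 scaler0.
- by rewrite Rpos_act_tens -tensZl.
- by rewrite Rpos_actDr scalerDr IHu IHv.
Qed.

Lemma RoneD : {morph Rone : m n / m + n}.
Proof. by move=> m n; apply: tensDr. Qed.

Lemma RoneZ a m : Rone (a *: m) = symC M a *: Rone m.
Proof. by rewrite -RposZ; apply: tensZr. Qed.

Lemma Rmod_ind (Q : Rmod -> Prop) :
  Q 0 -> (forall s m, Q (s *: Rone m)) -> (forall u v, Q u -> Q v -> Q (u + v)) ->
  forall u, Q u.
Proof. by move=> Q0 Qt QD; apply: tensor_ind => // s m; rewrite RtensE. Qed.

Lemma RsymZ (s : S) (u : Rmod) : Rpos_sym (s *: u) = s * Rpos_sym u.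
Proof.
elim/Rmod_ind: u => [|v m|u v IHu IHv].
- by rewrite scaler0 Rpos_sym0 mulr0.
- by rewrite scalerA -!RtensE !Rpos_sym_tens mulrA.
- by rewrite scalerDr !Rpos_symD mulrDr IHu IHv.
Qed.

Lemma Rsym_one m : Rpos_sym (Rone m) = symV m.
Proof. by rewrite Rpos_sym_tens mul1r. Qed.

Section Twisted.
Variables (P : zmodType) (f : S -> M -> P).
Hypothesis fDl : forall m, {morph f^~ m : s t / s + t}.
Hypothesis fDr : forall s, {morph f s : m n / m + n}.
Hypothesis f_bal : forall a s m, f s (a *: m) = f (symC M a * s) m.

Definition Rtwist (u : Rmod) : P := tens_lift f u.

Lemma RtwistD : {morph Rtwist : u v / u + v}.
Proof. exact: tens_liftD. Qed.

Lemma Rtwist_one s m : Rtwist (s *: Rone m) = f s m.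
Proof. by rewrite -RtensE; apply: tens_lift_tens. Qed.

Lemma Rtwist0 : Rtwist 0 = 0.
Proof. by apply: (addIr (Rtwist 0)); rewrite -RtwistD !add0r. Qed.

End Twisted.

Section Derivation.
Variables (nab : S -> S) (c : M -> Rmod).
Hypothesis nabD : {morph nab : s t / s + t}.
Hypothesis nabM : forall s t, nab (s * t) = s * nab t + t * nab s.
Hypothesis cD : {morph c : m n / m + n}.
Hypothesis cZ : forall a m, c (a *: m) = symC M a *: c m + nab (symC M a) *: Rone m.

(** The Leibniz extension of [c] along a derivation of S(M) that may be nonzero on A; [cZ] is what
    makes the formula balanced over A. *)
Definition Rder : Rmod -> Rmod :=
  Rtwist (fun s m => nab s *: Rone m + s *: c m).

Let fDl m : {morph (fun s => nab s *: Rone m + s *: c m) : s t / s + t}.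
Proof. by move=> s t; rewrite nabD !scalerDl addrACA. Qed.

Let fDr s : {morph (fun m => nab s *: Rone m + s *: c m) : m n / m + n}.
Proof. by move=> m n; rewrite RoneD cD !scalerDr addrACA. Qed.

Let f_bal a s m : nab s *: Rone (a *: m) + s *: c (a *: m) =
  nab (symC M a * s) *: Rone m + (symC M a * s) *: c m.
Proof.
rewrite nabM RoneZ cZ scalerDr !scalerDl !scalerA addrA (mulrC (nab s)) -!addrA.
by congr (_ + _); rewrite addrC (mulrC s (symC M a)).
Qed.

Lemma RderD : {morph Rder : u v / u + v}.
Proof. exact: RtwistD. Qed.

Lemma Rder_one m : Rder (Rone m) = c m.
Proof.
rewrite -[Rone m]scale1r [LHS]Rtwist_one //.
have -> : nab 1 = 0.
  by apply: (addIr (nab 1)); rewrite add0r -[RHS](congr1 nab (mulr1 1)) nabM !mul1r.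
by rewrite scale0r add0r scale1r.
Qed.

Lemma RderZ s u : Rder (s *: u) = nab s *: u + s *: Rder u.
Proof.
elim/Rmod_ind: u => [|t m|u v IHu IHv].
- by rewrite !scaler0 add0r [Rder 0]Rtwist0 // scaler0.
- rewrite scalerA /Rder !Rtwist_one // nabM scalerDr !scalerDl !scalerA.
  by rewrite [RHS]addrCA -addrA (mulrC t).
- by rewrite scalerDr !RderD IHu IHv !scalerDr addrACA.
Qed.

End Derivation.

Section Linear.
Variables (P : lmodType S) (f : M -> P).
Hypothesis fD : {morph f : m n / m + n}.
Hypothesis fZ : forall a m, f (a *: m) = symC M a *: f m.

Definition Rlift : Rmod -> P := Rtwist (fun s m => s *: f m).

Let gDl m : {morph (fun s => s *: f m) : s t / s + t}.
Proof. by move=> s t; rewrite scalerDl. Qed.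

Let gDr s : {morph (fun m => s *: f m) : m n / m + n}.
Proof. by move=> m n; rewrite fD scalerDr. Qed.

Let g_bal a s m : s *: f (a *: m) = (symC M a * s) *: f m.
Proof. by rewrite fZ scalerA mulrC. Qed.

Lemma RliftD : {morph Rlift : u v / u + v}.
Proof. exact: RtwistD. Qed.

Lemma Rlift_one m : Rlift (Rone m) = f m.
Proof. by rewrite -[Rone m]scale1r [LHS]Rtwist_one // scale1r. Qed.

Lemma RliftZ s u : Rlift (s *: u) = s *: Rlift u.
Proof.
elim/Rmod_ind: u => [|t m|u v IHu IHv].
- by rewrite !scaler0 [Rlift 0]Rtwist0 // scaler0.
- by rewrite scalerA /Rlift !Rtwist_one // scalerA.
- by rewrite scalerDr !RliftD IHu IHv scalerDr.
Qed.

End Linear.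

Definition symdelta : S -> Rmod := symder (fun _ => 0) Rone.

Let dM a b : (0 : Rmod) = symC M a *: 0 + symC M b *: 0.
Proof. by rewrite !scaler0 addr0. Qed.

Let cZ a m : Rone (a *: m) = symC M a *: Rone m + symV m *: 0.
Proof. by rewrite RoneZ scaler0 addr0. Qed.

Lemma symdeltaC a : symdelta (symC M a) = 0.
Proof. by apply: symderC => //; [move=> *; rewrite addr0|apply: RoneD]. Qed.

Lemma symdeltaV m : symdelta (symV m) = Rone m.
Proof. by apply: symderV => //; [move=> *; rewrite addr0|apply: RoneD]. Qed.

Lemma symdeltaD : {morph symdelta : u v / u + v}.
Proof. by apply: symderD => //; [move=> *; rewrite addr0|apply: RoneD]. Qed.

Lemma symdeltaM u v : symdelta (u * v) = u *: symdelta v + v *: symdelta u.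
Proof. by apply: symderM => //; [move=> *; rewrite addr0|apply: RoneD]. Qed.

End RModule.

(** * Formal power series, with the variable recording a rise in degree *)

Section Series.
Variable K : comPzRingType.

Definition series : Type := nat -> K.
HB.instance Definition _ := gen_eqMixin series.
HB.instance Definition _ := gen_choiceMixin series.

Implicit Types f g h : series.

Lemma seriesP f g : (forall n, f n = g n) -> f = g.
Proof. by move=> fg; apply: functional_extensionality_dep. Qed.

Definition series_add f g : series := fun n => f n + g n.
Definition series_opp f : series := fun n => - f n.
Definition series_zero : series := fun n => 0.
Definition series_mul f g : series := conv f g.
Definition series_const (a : K) : series := conv_const a.

Lemma series_addA : associative series_add.
Proof. by move=> f g h; apply: seriesP => n; apply: addrA. Qed.
Lemma series_addC : commutative series_add.
Proof. by move=> f g; apply: seriesP => n; apply: addrC. Qed.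
Lemma series_add0 : left_id series_zero series_add.
Proof. by move=> f; apply: seriesP => n; apply: add0r. Qed.
Lemma series_addN : left_inverse series_zero series_opp series_add.
Proof. by move=> f; apply: seriesP => n; apply: addNr. Qed.

HB.instance Definition _ := GRing.isZmodule.Build series
  series_addA series_addC series_add0 series_addN.

Lemma series_mulA : associative series_mul.
Proof. by move=> f g h; apply: seriesP => n; apply: convA. Qed.
Lemma series_mulC : commutative series_mul.
Proof. by move=> f g; apply: seriesP => n; apply: convC. Qed.
Lemma series_mul1 : left_id (series_const 1) series_mul.
Proof. by move=> f; apply: seriesP => n; rewrite [LHS]conv_constl mul1r. Qed.
Lemma series_mulDl : left_distributive series_mul +%R.
Proof. by move=> f g h; apply: seriesP => n; apply: convDl. Qed.

HB.instance Definition _ := GRing.Zmodule_isComPzRing.Build series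
  series_mulA series_mulC series_mul1 series_mulDl.

Lemma seriesD f g n : (f + g) n = f n + g n. Proof. by []. Qed.

Lemma seriesME f g n : (f * g) n = \sum_(i < n.+1) f i * g (n - i)%N.
Proof. by []. Qed.

Lemma seriesMn f j n : (f *+ j) n = f n *+ j.
Proof. by elim: j => [|j IHj]; rewrite ?mulr0n // !mulrS seriesD IHj. Qed.

Lemma series_constB : zmod_morphism series_const.
Proof.
move=> a b; apply: seriesP => -[|n] //; rewrite -[RHS]/(0 - 0 : K).
by rewrite subr0.
Qed.

Lemma series_const_monoid : monoid_morphism series_const.
Proof.
split=> // a b; apply: seriesP => n; rewrite [RHS]conv_constl.
by case: n => //= n; rewrite mulr0.
Qed.

HB.instance Definition _ :=
  GRing.isZmodMorphism.Build _ _ series_const series_constB.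
HB.instance Definition _ :=
  GRing.isMonoidMorphism.Build _ _ series_const series_const_monoid.

Lemma series_constM a f n : (series_const a * f) n = a * f n.
Proof. exact: conv_constl. Qed.

Definition shift f : series := fun n => if n is m.+1 then f m else 0.

Lemma shiftM f g : shift f * g = shift (f * g).
Proof.
apply: seriesP => -[|n]; first by rewrite seriesME big_ord_recl big_ord0 mul0r addr0.
by rewrite seriesME big_ord_recl mul0r add0r.
Qed.

Lemma shiftMr f g : f * shift g = shift (f * g).
Proof. by rewrite mulrC shiftM mulrC. Qed.

Lemma series_split f : f = series_const (f 0%N) + shift (fun n => f n.+1).
Proof.
by apply: seriesP => -[|n]; rewrite seriesD /= ?addr0 // add0r.
Qed.

(* t d/dt *)
Definition euler f : series := fun n => f n *+ n.

Lemma eulerD : {morph euler : f g / f + g}.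
Proof. by move=> f g; apply: seriesP => n; rewrite /euler !seriesD mulrnDl. Qed.

Lemma eulerM f g : euler (f * g) = f * euler g + g * euler f.
Proof.
apply: seriesP => n; rewrite seriesD (mulrC g) /euler !seriesME -big_split.
rewrite -sumrMnl; apply: eq_bigr => i _ /=.
by rewrite mulrnAr mulrnAl -mulrnDr subnK // -ltnS.
Qed.

Lemma euler_const a : euler (series_const a) = 0.
Proof. by apply: seriesP => -[|n]; rewrite /euler /= ?mulr0n // mul0rn. Qed.

End Series.

Section Diagonal.
Variable K : comPzRingType.
Implicit Types x y : series (series K).

(* setting both variables of a double series equal *)
Definition diag x : series K := fun n => \sum_(i < n.+1) x i (n - i)%N.

Lemma diagD : {morph diag : x y / x + y}.
Proof. by move=> x y; apply: seriesP => n; rewrite /diag seriesD -big_split. Qed.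

Lemma diag_split x : diag x = x 0%N + shift (diag (fun i => x i.+1)).
Proof.
apply: seriesP => -[|n]; rewrite seriesD /= /diag big_ord_recl.
  by rewrite big_ord0.
by rewrite subn0.
Qed.

Lemma diag_shift x : diag (shift x) = shift (diag x).
Proof. by rewrite diag_split add0r. Qed.

Lemma diag_constM (c : series K) y : diag (series_const c * y) = c * diag y.
Proof.
have cyE (z : series (series K)) i : (series_const c * z) i = c * z i by apply: conv_constl.
apply: seriesP => n; elim: n {-2}n (leqnn n) y => [|N IHN] n nN y;
  rewrite diag_split (diag_split y) mulrDr !seriesD cyE shiftMr; congr (_ + _).
  by move: nN; rewrite leqn0 => /eqP->.
case: n nN => //= n nN; rewrite -IHN //.
by congr (diag _ _); apply: seriesP => i; rewrite !cyE.
Qed.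

(** Split off the constant term of [x] in its outer variable. That term is handled by [diag_constM];
    the rest carries a factor of the variable, so it is needed only in smaller degree. This avoids
    reindexing the double sum. *)
Lemma diagM x y : diag (x * y) = diag x * diag y.
Proof.
apply: seriesP => n; elim: n {-2}n (leqnn n) x => [|N IHN] n nN x;
  rewrite {1}(series_split x) mulrDl diagD diag_constM shiftM diag_shift
    (diag_split x) mulrDl shiftM !seriesD; congr (_ + _).
  by move: nN; rewrite leqn0 => /eqP->.
by case: n nN => //= n nN; apply: IHN.
Qed.

End Diagonal.

Section SeriesMorphism.
Variables (A : comPzRingType) (M : lmodType A).
Notation S := (symalg M).
Implicit Types f g : nat -> M -> S.

Definition linear_coefs f : Prop :=
  (forall j, {morph f j : m n / m + n}) /\
  (forall j a m, f j (a *: m) = symC M a * f j m).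

Definition const_const : {rmorphism A -> series S} :=
  [the {rmorphism A -> series S} of @series_const S \o @symC A M].

Definition coefs f (m : M) : series S := fun j => f j m.

Definition phi f : S -> series S := symlift const_const (coefs f).

(* the phi-linear map sending 1 (x) m to the image of m under d/dt (t f), that
   is, under phi followed by the Euler operator when m is given weight 1 *)
Definition phiR f : Rmod M -> series S :=
  Rtwist (fun s m => phi f s * (coefs f m + euler (coefs f m))).

Section Linear.
Variable f : nat -> M -> S.
Hypothesis f_lin : linear_coefs f.

Let gD : {morph coefs f : m n / m + n}.
Proof. by case: f_lin => fD _ m n; apply: seriesP => j; apply: fD. Qed.

Let gZ a m : coefs f (a *: m) = const_const a * coefs f m.
Proof.
by case: f_lin => _ fZ; apply: seriesP => j; rewrite series_constM; apply: fZ.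
Qed.

Lemma phiC a : phi f (symC M a) = const_const a. Proof. exact: symliftC. Qed.
Lemma phiV m : phi f (symV m) = coefs f m. Proof. exact: symliftV. Qed.
Lemma phiD : {morph phi f : s t / s + t}. Proof. exact: symliftD. Qed.
Lemma phiM : {morph phi f : s t / s * t}. Proof. exact: symliftM. Qed.
Lemma phi1 : phi f 1 = 1. Proof. by rewrite -symC1 phiC rmorph1. Qed.

Lemma phiMn s n : phi f (s *+ n) = phi f s *+ n.
Proof.
elim: n => [|n IHn]; first by rewrite !mulr0n -symC0 phiC rmorph0.
by rewrite !mulrS phiD IHn.
Qed.

Let e (m : M) := coefs f m + euler (coefs f m).

Let eD : {morph e : m n / m + n}.
Proof. by move=> m n; rewrite /e gD eulerD addrACA. Qed.

Let eZ a m : e (a *: m) = const_const a * e m.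
Proof. by rewrite /e gZ eulerM euler_const mulr0 addr0 mulrDr. Qed.

Let fDl m : {morph (fun s => phi f s * e m) : s t / s + t}.
Proof. by move=> s t; rewrite phiD mulrDl. Qed.
Let fDr s : {morph (fun m => phi f s * e m) : m n / m + n}.
Proof. by move=> m n; rewrite eD mulrDr. Qed.
Let f_bal a s m : phi f s * e (a *: m) = phi f (symC M a * s) * e m.
Proof. by rewrite phiM phiC eZ mulrCA mulrA. Qed.

Lemma phiRD : {morph phiR f : u v / u + v}. Proof. exact: RtwistD. Qed.

Lemma phiR0 : phiR f 0 = 0. Proof. exact: Rtwist0. Qed.

Lemma phiR_sum (I : Type) (r : seq I) (F : I -> Rmod M) :
  phiR f (\sum_(i <- r) F i) = \sum_(i <- r) phiR f (F i).
Proof. exact: (big_morph (phiR f) phiRD phiR0). Qed.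

Lemma phiR_one m : phiR f (Rone m) = e m.
Proof. by rewrite -[Rone m]scale1r [LHS]Rtwist_one // phi1 mul1r. Qed.

Lemma phiRZ s u : phiR f (s *: u) = phi f s * phiR f u.
Proof.
elim/Rmod_ind: u => [|t m|u v IHu IHv].
- by rewrite scaler0 phiR0 mulr0.
- by rewrite scalerA /phiR !Rtwist_one // phiM mulrA.
- by rewrite scalerDr !phiRD IHu IHv mulrDr.
Qed.

(** Both sides are derivations along [phi f] that vanish on constants and have equal values on
    generators. For s homogeneous of weight n, the left side multiplies the coefficient of index j
    by n + j, its degree in S(M): it is the full Euler operator applied to the image. *)
Lemma euler_phi s :
  phi f (Rpos_sym (symdelta s)) + euler (phi f s) = phiR f (symdelta s).
Proof.
elim/symalg_ind: s => [a|m|s t IHs IHt|s t IHs IHt].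
- by rewrite symdeltaC Rpos_sym0 phiR0 phiC euler_const -symC0 phiC rmorph0 addr0.
- by rewrite symdeltaV Rsym_one phiR_one phiV.
- by rewrite symdeltaD Rpos_symD !phiD eulerD phiRD -IHs -IHt addrACA.
- rewrite symdeltaM Rpos_symD !RsymZ phiD !phiM eulerM phiRD !phiRZ -IHs -IHt.
  by rewrite !mulrDr addrACA.
Qed.

End Linear.

Section Congruence.
Variables (f g : nat -> M -> S) (q : nat).
Hypotheses (f_lin : linear_coefs f) (g_lin : linear_coefs g).
Hypothesis fg : forall j m, (j < q)%N -> f j m = g j m.

Lemma phi_congr s n : (n < q)%N -> phi f s n = phi g s n.
Proof.
elim/symalg_ind: s n => [a|m|s t IHs IHt|s t IHs IHt] n nq.
- by rewrite !phiC.
- by rewrite !phiV // /coefs fg.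
- by rewrite !phiD // !seriesD IHs // IHt.
- rewrite !phiM //; apply: eq_conv => i ni; [apply: IHs|apply: IHt];
    exact: leq_ltn_trans nq.
Qed.

Lemma phiR_congr u n : (n < q)%N -> phiR f u n = phiR g u n.
Proof.
elim/Rmod_ind: u n => [|s m|u v IHu IHv] n nq.
- by rewrite !phiR0.
- rewrite !phiRZ // !phiR_one //; apply: eq_conv => i ni.
    by apply: phi_congr; apply: leq_ltn_trans nq.
  by rewrite !seriesD /euler /coefs fg //; apply: leq_ltn_trans nq.
- by rewrite !phiRD // !seriesD IHu // IHv.
Qed.

End Congruence.

End SeriesMorphism.

(** * Solving for the equivalence degree by degree *)

Section Solve.
Variables (A : comPzRingType) (M : lmodType A) (rho : {rmorphism rat -> A}).
Notation S := (symalg M).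

Definition ratS (q : rat) : S := symC M (rho q).

Lemma ratSM p q : ratS (p * q) = ratS p * ratS q.
Proof. by rewrite /ratS !rmorphM. Qed.

Lemma ratS_nat n : ratS n%:R = n%:R.
Proof. by rewrite /ratS !rmorph_nat. Qed.

Lemma ratSV n : n.+1%:R * ratS (n.+1%:R^-1) = 1.
Proof.
by rewrite -ratS_nat -ratSM mulfV ?Num.Theory.pnatr_eq0 // /ratS !rmorph1.
Qed.

Lemma ratS_mulrnK n (s : S) : ratS (n.+1%:R^-1) * (s *+ n.+1) = s.
Proof. by rewrite mulrnAr -mulrnAl -[X in X * _]mulr_natl ratSV mul1r. Qed.

Lemma mulrSn_inj n (s t : S) : s *+ n.+1 = t *+ n.+1 -> s = t.
Proof. by move=> st; rewrite -(ratS_mulrnK n s) st ratS_mulrnK. Qed.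

Variable D : A -> M.
Variables (h h' : nat -> A -> S) (V : nat -> M -> Rmod M) (t' : nat -> M -> S).

(* The unknown f : M -> S(M) is determined degree by degree from the equation
   [phiV_diag f = t'], whose degree q part is [q.+1 * f q] plus terms in the
   [f j], j < q. *)
Definition phiV_diag f (m : M) : series S := diag (fun i => phiR f (V i m)).

Definition solve_step (q : nat) (f : nat -> M -> S) : nat -> M -> S :=
  fun j m => if j == q
    then ratS (q.+1%:R^-1) * (t' q m - phiV_diag f m q) else f j m.

Fixpoint solve_upto (q : nat) : nat -> M -> S :=
  if q is p.+1 then solve_step p (solve_upto p) else fun _ _ => 0.

Definition solution (q : nat) (m : M) : S := solve_upto q.+1 q m.

Hypothesis VD : forall n, {morph V n : m m' / m + m'}.
Hypothesis V0 : forall m, V 0%N m = Rone m.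
Hypothesis VZ : forall n a m,
  V n (a *: m) = \sum_(i < n.+1) h i a *: V (n - i)%N m.
Hypothesis delta_h : forall n a, symdelta (h n.+1 a) = V n (D a).
Hypothesis h0 : forall a, h 0%N a = symC M a.
Hypothesis h_weight : forall n a, Rpos_sym (symdelta (h n a)) = h n a *+ n.
Hypothesis t'D : forall n, {morph t' n : m m' / m + m'}.
Hypothesis t'Z : forall n a m,
  t' n (a *: m) = \sum_(i < n.+1) h' i a * t' (n - i)%N m.
Hypothesis h'0 : forall a, h' 0%N a = symC M a.
Hypothesis h'S : forall n a, h' n.+1 a *+ n.+1 = t' n (D a).

Definition phi_diag f (a : A) : series S := diag (fun p => phi f (h p a)).

Section Linear.
Variable f : nat -> M -> S.
Hypothesis f_lin : linear_coefs f.

Lemma phiV_diagD : {morph phiV_diag f : m n / m + n}.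
Proof.
move=> m n; rewrite /phiV_diag -diagD; congr diag; apply: seriesP => i.
by rewrite seriesD VD phiRD.
Qed.

Lemma phiV_diagZ a m : phiV_diag f (a *: m) = phi_diag f a * phiV_diag f m.
Proof.
rewrite -diagM; congr diag; apply: seriesP => i.
rewrite VZ phiR_sum // seriesME; apply: eq_bigr => l _.
by rewrite phiRZ.
Qed.

Lemma phi_diag0 a : phi_diag f a 0%N = symC M a.
Proof. by rewrite /phi_diag /diag big_ord1 h0 phiC. Qed.

(** As [h i a] has weight i, its contribution to degree n.+1 has total weight n.+1, and [euler_phi]
    trades the factor n.+1 for [symdelta]. The summand i = 0 drops out because [symdelta] kills
    constants, whence the shift from n.+1 to n. *)
Lemma phi_diagS a n : phi_diag f a n.+1 *+ n.+1 = phiV_diag f (D a) n.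
Proof.
rewrite /phi_diag /phiV_diag /diag -sumrMnl.
transitivity (\sum_(i < n.+2) phiR f (symdelta (h i a)) (n.+1 - i)%N).
  apply: eq_bigr => i _; rewrite -(euler_phi f_lin) h_weight seriesD /euler.
  by rewrite phiMn // seriesMn -mulrnDr subnKC // -ltnS.
rewrite big_ord_recl h0 symdeltaC phiR0 // add0r.
by apply: eq_bigr => i _; rewrite delta_h.
Qed.

(** The gain of one degree, from below q to q included, comes from [phi_diagS]: degree j.+1 of
    [phi_diag] is governed by degree j of [phiV_diag] at [D a]. *)
Lemma phi_diag_eq q :
  (forall j m, (j < q)%N -> phiV_diag f m j = t' j m) ->
  forall j a, (j <= q)%N -> phi_diag f a j = h' j a.
Proof.
move=> ft [|j] a jq; first by rewrite phi_diag0 h'0.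
by apply: (@mulrSn_inj j); rewrite phi_diagS h'S ft.
Qed.

(** [t'] is semilinear over [h'] and [phiV_diag f] over [phi_diag f]. In degree q the terms with i >
    0 multiply coefficients of degree at most q by values of degree below q, and all of these agree;
    only the term i = 0 is left, and its coefficient is the constant a. *)
Lemma phiV_defect_linear q a m :
  (forall j m, (j < q)%N -> phiV_diag f m j = t' j m) ->
  t' q (a *: m) - phiV_diag f (a *: m) q =
  symC M a * (t' q m - phiV_diag f m q).
Proof.
move=> ft; rewrite t'Z phiV_diagZ seriesME -sumrB big_ord_recl big1 => [|i _].
  by rewrite addr0 h'0 phi_diag0 subn0 mulrBr.
rewrite (phi_diag_eq ft) //; last by rewrite /= /bump leq0n; apply: ltn_ord.
rewrite ft ?subrr // /= /bump leq0n add1n.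
by case: q {ft} i => [[] //|q] i; rewrite subSS ltnS leq_subr.
Qed.

End Linear.

Lemma solve_upto_ge q j m : (q <= j)%N -> solve_upto q j m = 0.
Proof.
elim: q => //= q IHq qj; rewrite /solve_step gtn_eqF //; exact/IHq/ltnW.
Qed.

Lemma solve_upto_lt q j m : (j < q)%N -> solve_upto q j m = solution j m.
Proof.
elim: q => //= q IHq; rewrite ltnS leq_eqVlt => /orP[/eqP->|jq]; first by [].
by rewrite {1}/solve_step ltn_eqF // IHq.
Qed.

Lemma phiV_diag_congr f g q (f_lin : linear_coefs f) (g_lin : linear_coefs g) m n :
  (forall j m, (j < q)%N -> f j m = g j m) ->
  (n < q)%N -> phiV_diag f m n = phiV_diag g m n.
Proof.
move=> fg nq; apply: eq_bigr => i _; apply: (phiR_congr f_lin g_lin fg).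
by apply: leq_ltn_trans nq; apply: leq_subr.
Qed.

Lemma solve_upto_spec q : linear_coefs (solve_upto q) /\
  forall j m, (j < q)%N -> phiV_diag (solve_upto q) m j = t' j m.
Proof.
elim: q => [|q [IHl IHt]].
  by split=> //; split=> [j m n|j a m]; rewrite /= ?addr0 ?mulr0.
have lin1 : linear_coefs (solve_upto q.+1).
  split=> [j m n|j a m] /=; rewrite /solve_step; case: (j == q).
  - by rewrite t'D phiV_diagD // seriesD opprD addrACA mulrDr.
  - by case: IHl => + _; apply.
  - by rewrite phiV_defect_linear // mulrCA.
  - by case: IHl => _; apply.
split=> // j m; rewrite ltnS leq_eqVlt => /orP[/eqP->|jq]; last first.
  rewrite -IHt //; apply: (@phiV_diag_congr _ _ q) => // i n iq /=.
  by rewrite /solve_step ltn_eqF.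
(* Only the summand i = 0 involves the new coefficient: it contributes that coefficient plus q times
   it, hence the factor q.+1. The summands i > 0 use coefficients of index below q, where the two
   stages coincide, and the old stage has coefficient 0 at q. *)
rewrite /phiV_diag /diag big_ord_recl V0 phiR_one // subn0 seriesD /euler.
rewrite {1 2}/coefs -mulrS /= /solve_step eqxx -mulrnAl.
have -> : ratS q.+1%:R^-1 *+ q.+1 = 1 by rewrite -[LHS]mulr_natl ratSV.
rewrite mul1r; apply/eqP; rewrite addrAC subr_eq; apply/eqP; congr (_ + _).
rewrite /phiV_diag /diag big_ord_recl V0 phiR_one // seriesD subn0 /euler.
rewrite /coefs solve_upto_ge // mul0rn addr0 add0r.
apply: eq_bigr => i _; apply: (@phiR_congr _ _ _ _ q) => //.
  by move=> k n kq /=; rewrite /solve_step ltn_eqF.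
by rewrite /= /bump leq0n add1n; case: (q) i => [[] //|p] i; rewrite subSS ltnS leq_subr.
Qed.

Lemma solution_linear : linear_coefs solution.
Proof.
by split=> [j|j a m]; have [[fD fZ] _] := solve_upto_spec j.+1; [apply: fD|apply: fZ].
Qed.

(** Identifies the leading part of the solution, from which the resulting automorphism is seen to be
    unipotent. *)
Lemma solution0 m : solution 0%N m = t' 0%N m.
Proof.
have [fl ft] := solve_upto_spec 1; rewrite -(ft 0%N m) // /phiV_diag /diag big_ord1.
by rewrite V0 phiR_one // seriesD /euler mulr0n addr0.
Qed.

Lemma phi_solution n a : phi_diag solution a n = h' n a.
Proof.
have ft j m : phiV_diag solution m j = t' j m.
  have [fl <-//] := solve_upto_spec j.+1.
  apply: (@phiV_diag_congr _ _ j.+1) => //; first exact: solution_linear.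
  by move=> i k ij; rewrite solve_upto_lt.
exact: (phi_diag_eq solution_linear (q := n)).
Qed.

End Solve.

(** * Exponentials of connections *)

Section Exponential.
Variables (A : comPzRingType) (M : lmodType A) (rho : {rmorphism rat -> A}).
Notation S := (symalg M).
Variable nab : S -> S.

Section Module.
Variables (E : lmodType S) (Gam : E -> E).

(** Recursive form of Gam^n / n!. *)
Fixpoint dexp (n : nat) (u : E) : E :=
  if n is p.+1 then ratS M rho (p.+1%:R^-1) *: Gam (dexp p u) else u.

Lemma scalerSn_inj n (u v : E) : u *+ n.+1 = v *+ n.+1 -> u = v.
Proof.
suff K (w : E) : ratS M rho (n.+1%:R^-1) *: (w *+ n.+1) = w.
  by move=> uv; rewrite -(K u) uv K.
by rewrite -scaler_nat scalerA mulrC ratSV scale1r.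
Qed.

Lemma dexpS n u : dexp n.+1 u *+ n.+1 = Gam (dexp n u).
Proof. by rewrite /= -scaler_nat scalerA ratSV scale1r. Qed.

Hypothesis GamD : {morph Gam : u v / u + v}.
Hypothesis nab_rat : forall q, nab (ratS M rho q) = 0.
Hypothesis GamZ : forall s u, Gam (s *: u) = nab s *: u + s *: Gam u.

Lemma dexpD n : {morph dexp n : u v / u + v}.
Proof. by elim: n => //= n IHn u v; rewrite IHn GamD scalerDr. Qed.

(** [nab] kills rational scalars, so [Gam] commutes with the divisions in [dexp]. *)
Lemma dexp_shift n u : dexp n.+1 u *+ n.+1 = dexp n (Gam u).
Proof.
rewrite dexpS; elim: n => //= n <-.
by rewrite GamZ nab_rat scale0r add0r.
Qed.

End Module.

Hypothesis nabD : {morph nab : s t / s + t}.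
Hypothesis nabM : forall s t, nab (s * t) = s * nab t + t * nab s.

Lemma dexp_leibniz (E : lmodType S) (Gam : E -> E)
    (GamD : {morph Gam : u v / u + v})
    (GamZ : forall s u, Gam (s *: u) = nab s *: u + s *: Gam u) n s u :
  dexp Gam n (s *: u) =
  \sum_(i < n.+1) dexp (nab : S^o -> S^o) i s *: dexp Gam (n - i) u.
Proof.
have Gam0 : Gam 0 = 0 by apply: (addIr (Gam 0)); rewrite -GamD !add0r.
elim: n => [|n IHn]; first by rewrite big_ord1.
apply: (@scalerSn_inj _ n); rewrite dexpS IHn (big_morph Gam GamD Gam0).
pose x i := dexp (nab : S^o -> S^o) i s *: dexp Gam (n.+1 - i) u.
(* The factor n.+1 is shared out as i + (n.+1 - i): the first share accounts for the derivation
   falling on s, the second for it falling on u. *)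
transitivity (\sum_(i < n.+2) (x i *+ i + x i *+ (n.+1 - i))); last first.
  by rewrite -sumrMnl; apply: eq_bigr => i _; rewrite -mulrnDr subnKC // -ltnS.
rewrite big_split [X in _ = X + _]big_ord_recl [X in _ = _ + X]big_ord_recr /=.
rewrite mulr0n add0r subnn mulr0n addr0 -big_split; apply: eq_bigr => i _ /=.
have iLn : (i <= n)%N by rewrite -ltnS.
rewrite GamZ -!dexpS /x /bump leq0n add1n subSS subSn //.
by rewrite scalerMnl scalerMnr.
Qed.

Lemma dexpM n s t : dexp (nab : S^o -> S^o) n (s * t) =
  conv (fun i => dexp (nab : S^o -> S^o) i s) (fun i => dexp (nab : S^o -> S^o) i t) n.
Proof.
apply: (@dexp_leibniz S^o nab) => // u v.
by rewrite [LHS]nabM addrC; congr (_ + _); apply: mulrC.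
Qed.

End Exponential.

Section FlatConnection.
Variables (A : comPzRingType) (M : lmodType A) (rho : {rmorphism rat -> A}).
Notation S := (symalg M).
Variables (D : A -> M) (c c' : M -> Rmod M).

Definition nabla : S -> S :=
  symder (P := S^o) (fun a => symV (D a)) (fun m => Rpos_sym (c m)).
Definition gam : Rmod M -> Rmod M := Rder nabla c.
(** In [c] the direction of differentiation lies in the symmetric factor, in [c'] in the last tensor
    factor. So [nabP] is the covariant derivative with its direction left free, while [nabla]
    corresponds to contraction with the tautological direction, as for a geodesic spray. *)
Definition nabP : S -> Rmod M := symder (fun a => Rone (D a)) c'.
Definition curv_gen (m : M) : Rmod M := nabP (nabla (symV m)) - gam (nabP (symV m)).
Definition curv : Rmod M -> Rmod M := Rlift curv_gen.

(* Along the exponential map, (symdelta, nabP) obeys the Jacobi equation: the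
   iterates of [jacobi] at (0, Rone (D a)) are the vertical derivative and the
   covariant derivative of the exponential of [a] (see [symdelta_hflat]). *)
Definition jacobi (w : Rmod M * Rmod M) : Rmod M * Rmod M :=
  (gam w.1 + w.2, gam w.2 + curv w.1).

Definition hflat (n : nat) (a : A) : S :=
  dexp rho (nabla : S^o -> S^o) n (symC M a).
Definition Tflat (n : nat) (m : M) : Rmod M := dexp rho gam n (Rone m).
(** The first component starts at 0 and is fed by the second without a rise in degree. The index
    n.+1 therefore lands in S^n (x) M and makes the value for n = 0 equal to [Rone m]. *)
Definition Vflat (n : nat) (m : M) : Rmod M :=
  (dexp rho jacobi n.+1 (0, Rone m)).1.

Hypothesis DD : {morph D : a b / a + b}.
Hypothesis DM : forall a b, D (a * b) = a *: D b + b *: D a.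
Hypothesis D_rat : forall q, D (rho q) = 0.
Hypothesis cD : {morph c : m n / m + n}.
Hypothesis cZ : forall a m, c (a *: m) = symC M a *: c m + symV (D a) *: Rone m.

Let dD : {morph (fun a => symV (D a) : S^o) : a b / a + b}.
Proof. by move=> a b; rewrite DD symVD. Qed.

Let dM a b : symV (D (a * b)) =
  symC M a *: (symV (D b) : S^o) + symC M b *: (symV (D a) : S^o).
Proof. by rewrite DM symVD !symVZ. Qed.

Let eD : {morph (fun m => Rpos_sym (c m) : S^o) : m n / m + n}.
Proof. by move=> m n; rewrite cD Rpos_symD. Qed.

Let eZ a m : Rpos_sym (c (a *: m)) = symC M a *: (Rpos_sym (c m) : S^o) +
  symV m *: (symV (D a) : S^o).
Proof. by rewrite cZ Rpos_symD !RsymZ Rsym_one (mulrC (symV _)). Qed.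

Lemma nablaC a : nabla (symC M a) = symV (D a). Proof. exact: (symderC (P := S^o) dD dM eD eZ). Qed.
Lemma nablaV m : nabla (symV m) = Rpos_sym (c m). Proof. exact: (symderV (P := S^o) dD dM eD eZ). Qed.
Lemma nablaD : {morph nabla : s t / s + t}. Proof. exact: (symderD (P := S^o) dD dM eD eZ). Qed.
Lemma nablaM s t : nabla (s * t) = s * nabla t + t * nabla s.
Proof. exact: (symderM (P := S^o) dD dM eD eZ). Qed.

Lemma nabla_rat q : nabla (ratS M rho q) = 0.
Proof.
rewrite nablaC D_rat; apply: (addIr (symV 0)).
by rewrite -symVD !add0r.
Qed.

Lemma nablaZ s (u : S^o) :
  nabla (s *: u) = nabla s *: u + s *: (nabla u : S^o).
Proof.
by rewrite [LHS]nablaM addrC; congr (_ + _); apply: mulrC.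
Qed.

Let cZ' a m : c (a *: m) = symC M a *: c m + nabla (symC M a) *: Rone m.
Proof. by rewrite nablaC cZ. Qed.

Lemma gamD : {morph gam : u v / u + v}.
Proof. by apply: RderD; [apply: nablaD|apply: nablaM|apply: cD|apply: cZ']. Qed.

Lemma gam_one m : gam (Rone m) = c m.
Proof. by apply: Rder_one; [apply: nablaD|apply: nablaM|apply: cD|apply: cZ']. Qed.

Lemma gamZ s u : gam (s *: u) = nabla s *: u + s *: gam u.
Proof. by apply: RderZ; [apply: nablaD|apply: nablaM|apply: cD|apply: cZ']. Qed.

Lemma gam0 : gam 0 = 0.
Proof. by apply: (addIr (gam 0)); rewrite -gamD !add0r. Qed.

Lemma Rpos_sym_gam u : Rpos_sym (gam u) = nabla (Rpos_sym u).
Proof.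
have nabla0 : nabla 0 = 0 by apply: (addIr (nabla 0)); rewrite -nablaD !add0r.
elim/Rmod_ind: u => [|s m|u v IHu IHv].
- by rewrite gam0 Rpos_sym0 nabla0.
- rewrite gamZ gam_one Rpos_symD !RsymZ Rsym_one nablaM nablaV addrC.
  by rewrite (mulrC (symV m)).
- by rewrite gamD !Rpos_symD IHu IHv nablaD.
Qed.

Lemma hflat0 a : hflat 0 a = symC M a. Proof. by []. Qed.

Lemma hflatD n : {morph hflat n : a b / a + b}.
Proof.
by move=> a b; rewrite /hflat symCD; apply: (@dexpD _ _ _ S^o nabla nablaD).
Qed.

Lemma hflatM n a b : hflat n (a * b) = conv (hflat^~ a) (hflat^~ b) n.
Proof. by rewrite /hflat symCM; apply: dexpM; [apply: nablaD|apply: nablaM]. Qed.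

Lemma hflat_const n a : D a = 0 -> hflat n.+1 a = 0.
Proof.
move=> Da0; have nab0 : nabla 0 = 0 by apply: (addIr (nabla 0)); rewrite -nablaD !add0r.
have V0 : symV (0 : M) = 0 by apply: (addIr (symV 0)); rewrite -symVD !add0r.
have step k : hflat k.+1 a = ratS M rho k.+1%:R^-1 *: (nabla (hflat k a) : S^o) by [].
elim: n => [|n IHn]; first by rewrite step hflat0 nablaC Da0 V0 scaler0.
by rewrite step IHn nab0 scaler0.
Qed.

Lemma TflatD n : {morph Tflat n : m m' / m + m'}.
Proof.
by move=> m m'; rewrite /Tflat RoneD; apply: dexpD; apply: gamD.
Qed.

Lemma TflatZ n a m :
  Tflat n (a *: m) = \sum_(i < n.+1) hflat i a *: Tflat (n - i) m.
Proof.
rewrite /Tflat RoneZ; apply: dexp_leibniz; [exact: gamD|exact: gamZ].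
Qed.

(** The product map intertwines [gam] with [nabla] and sends [Rone (D a)] to the value of [nabla] at
    a; [dexp_shift] absorbs this extra application of [nabla] into the exponential. *)
Lemma hflatS n a : hflat n.+1 a *+ n.+1 = Rpos_sym (Tflat n (D a)).
Proof.
have -> : Rpos_sym (Tflat n (D a)) =
    dexp rho (nabla : S^o -> S^o) n (Rpos_sym (Rone (D a))).
  rewrite /Tflat; elim: n => //= n <-.
  by rewrite RsymZ Rpos_sym_gam.
rewrite Rsym_one -nablaC.
apply: (@dexp_shift _ _ _ nabla S^o nabla); [exact: nabla_rat|exact: nablaZ].
Qed.

Hypothesis c'D : {morph c' : m n / m + n}.
Hypothesis c'Z : forall a m, c' (a *: m) = symC M a *: c' m + symV m *: Rone (D a).
Hypothesis c_delta : forall m, symdelta (Rpos_sym (c m)) = c m + c' m.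
Hypothesis c_flat : forall a, c (D a) = c' (D a).

Let pD : {morph (fun a => Rone (D a)) : a b / a + b}.
Proof. by move=> a b; rewrite DD RoneD. Qed.

Let pM a b : Rone (D (a * b)) = symC M a *: Rone (D b) + symC M b *: Rone (D a).
Proof. by rewrite DM RoneD !RoneZ. Qed.

Lemma nabPC a : nabP (symC M a) = Rone (D a). Proof. exact: (symderC pD pM c'D c'Z). Qed.
Lemma nabPV m : nabP (symV m) = c' m. Proof. exact: (symderV pD pM c'D c'Z). Qed.
Lemma nabPD : {morph nabP : s t / s + t}. Proof. exact: (symderD pD pM c'D c'Z). Qed.
Lemma nabPM s t : nabP (s * t) = s *: nabP t + t *: nabP s.
Proof. exact: (symderM pD pM c'D c'Z). Qed.

(** Product rule for the vertical derivative of [nabla s]: either s is differentiated, or the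
    direction contracted in [nabla] is, which sets it free and leaves [nabP s]. On generators this
    is [c_delta]. *)
Lemma delta_nabla s : symdelta (nabla s) = gam (symdelta s) + nabP s.
Proof.
elim/symalg_ind: s => [a|m|s t IHs IHt|s t IHs IHt].
- by rewrite nablaC symdeltaC symdeltaV gam0 add0r nabPC.
- by rewrite nablaV symdeltaV gam_one nabPV c_delta.
- by rewrite nablaD !symdeltaD gamD nabPD IHs IHt addrACA.
- rewrite nablaM symdeltaD !symdeltaM gamD !gamZ nabPM IHs IHt !scalerDr.
  by rewrite [LHS](AC ((2*1)*(2*1)) ((6*1)*(3*4)*(2*5))).
Qed.

(* The commutator of the two covariant derivatives is a derivation vanishing on
   A, by flatness; hence it is linear in the vertical derivative. *)
Definition commutator (s : S) : Rmod M := nabP (nabla s) - gam (nabP s).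

Lemma commutatorC a : commutator (symC M a) = 0.
Proof. by rewrite /commutator nablaC !nabPC nabPV gam_one c_flat subrr. Qed.

Lemma commutatorD : {morph commutator : s t / s + t}.
Proof.
by move=> s t; rewrite /commutator nablaD !nabPD gamD opprD addrACA.
Qed.

Lemma commutatorM s t : commutator (s * t) = s *: commutator t + t *: commutator s.
Proof.
rewrite /commutator nablaM !nabPD !nabPM gamD !gamZ !scalerBr !opprD.
rewrite [LHS](AC ((2*2)*(2*2)) ((1*6)*(3*8)*((2*7)*(4*5)))) /=.
by rewrite !addrN !addr0.
Qed.

Lemma curv_genD : {morph curv_gen : m n / m + n}.
Proof. by move=> m n; rewrite /curv_gen symVD; apply: commutatorD. Qed.

Lemma curv_genZ a m : curv_gen (a *: m) = symC M a *: curv_gen m.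
Proof.
have := commutatorM (symC M a) (symV m).
by rewrite commutatorC scaler0 addr0 -symVZ.
Qed.

Lemma curvD : {morph curv : u v / u + v}.
Proof. by apply: RliftD; [exact: curv_genD|exact: curv_genZ]. Qed.

Lemma curvZ s u : curv (s *: u) = s *: curv u.
Proof. by apply: RliftZ; [exact: curv_genD|exact: curv_genZ]. Qed.

Lemma curv_one m : curv (Rone m) = curv_gen m.
Proof. by apply: Rlift_one; [exact: curv_genD|exact: curv_genZ]. Qed.

Lemma curv0 : curv 0 = 0.
Proof. by apply: (addIr (curv 0)); rewrite -curvD !add0r. Qed.

Lemma nabP_nabla s : nabP (nabla s) = gam (nabP s) + curv (symdelta s).
Proof.
suff <- : commutator s = curv (symdelta s) by rewrite addrC subrK.
elim/symalg_ind: s => [a|m|s t IHs IHt|s t IHs IHt].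
- by rewrite commutatorC symdeltaC curv0.
- by rewrite symdeltaV curv_one.
- by rewrite commutatorD symdeltaD curvD IHs IHt.
- by rewrite commutatorM symdeltaM curvD !curvZ IHs IHt.
Qed.

Lemma jacobiD : {morph jacobi : u v / u + v}.
Proof.
by move=> u v; congr pair; rewrite /= gamD ?curvD addrACA.
Qed.

Lemma jacobiZ s u : jacobi (s *: u) = nabla s *: u + s *: jacobi u.
Proof.
by congr pair; rewrite /= gamZ ?curvZ scalerDr addrA.
Qed.

Lemma VflatD n : {morph Vflat n : m m' / m + m'}.
Proof.
move=> m m'; rewrite /Vflat RoneD.
have -> : (0, Rone m + Rone m') = (0, Rone m) + (0, Rone m') :> Rmod M * Rmod M.
  by congr pair; rewrite addr0.
by rewrite dexpD //; apply: jacobiD.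
Qed.

Lemma Vflat0 m : Vflat 0 m = Rone m.
Proof.
rewrite /Vflat /= gam0 add0r -[ratS M rho _ *: _]mulr1n.
by rewrite -scaler_nat scalerA ratSV scale1r.
Qed.

Lemma VflatZ n a m :
  Vflat n (a *: m) = \sum_(i < n.+1) hflat i a *: Vflat (n - i) m.
Proof.
have -> : Vflat n (a *: m) = (dexp rho jacobi n.+1 (symC M a *: (0, Rone m))).1.
  by rewrite /Vflat RoneZ; congr (dexp _ _ _ (_, _)).1; rewrite scaler0.
rewrite (dexp_leibniz _ jacobiD jacobiZ) (raddf_sum fst) big_ord_recr /= subnn /=.
rewrite scaler0 addr0; apply: eq_bigr => i _.
by rewrite subSn // -ltnS.
Qed.

(** By [delta_nabla] and [nabP_nabla] the pair of [symdelta] and [nabP] intertwines [nabla] with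
    [jacobi]. Both derivations kill rational constants, so this passes to the exponentials, and the
    initial pair depends on a only through [D a]. *)
Lemma symdelta_hflat n a : symdelta (hflat n.+1 a) = Vflat n (D a).
Proof.
rewrite /Vflat; move: n.+1 => {}n.
suff -> : dexp rho jacobi n (0, Rone (D a)) = (symdelta (hflat n a), nabP (hflat n a)).
  by [].
elim: n => [|n IHn]; first by rewrite /hflat /= symdeltaC nabPC.
have hS : hflat n.+1 a = ratS M rho (n.+1%:R^-1) * nabla (hflat n a) by [].
rewrite hS symdeltaM nabPM symdeltaC nabPC D_rat.
have -> : Rone (0 : M) = 0 by apply: (addIr (Rone 0)); rewrite -RoneD !add0r.
by rewrite !scaler0 !addr0 delta_nabla nabP_nabla /= IHn /=; congr pair.
Qed.

End FlatConnection.

(** * Locality of families of stalk elements *)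

Section Squares.
Variables (A : comPzRingType) (M : lmodType A).

(* u (x) v is sent to u (x) v and v (x) u in the degree 2 part of S(M) (x) M. *)
Definition T2R : tensor M M -> Rmod M := tens_lift (fun m n => symV m *: Rone n).
Definition T2R' : tensor M M -> Rmod M := tens_lift (fun m n => symV n *: Rone m).

Let fDl n : {morph (fun m : M => symV m *: Rone n) : s t / s + t}.
Proof. by move=> s t; rewrite symVD scalerDl. Qed.
Let fDr m : {morph (fun n : M => symV m *: Rone n) : s t / s + t}.
Proof. by move=> s t; rewrite RoneD scalerDr. Qed.
Let f_bal a (m n : M) : symV m *: Rone (a *: n) = symV (a *: m) *: Rone n.
Proof. by rewrite RoneZ scalerA mulrC -symVZ. Qed.
Let f_bal' a (m n : M) : symV (a *: n) *: Rone m = symV n *: Rone (a *: m).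
Proof. by rewrite RoneZ scalerA mulrC -symVZ. Qed.

Lemma T2R_tens m n : T2R (tens m n) = symV m *: Rone n.
Proof. exact: (tens_lift_tens fDl fDr f_bal). Qed.
Lemma T2RD : {morph T2R : u v / u + v}.
Proof. exact: (tens_liftD fDl fDr f_bal). Qed.
Lemma T2R'_tens m n : T2R' (tens m n) = symV n *: Rone m.
Proof. exact: (tens_lift_tens fDr fDl f_bal'). Qed.
Lemma T2R'D : {morph T2R' : u v / u + v}.
Proof. exact: (tens_liftD fDr fDl f_bal'). Qed.

Lemma T2R0 : T2R 0 = 0.
Proof. by apply: (addIr (T2R 0)); rewrite -T2RD !add0r. Qed.
Lemma T2R'0 : T2R' 0 = 0.
Proof. by apply: (addIr (T2R' 0)); rewrite -T2R'D !add0r. Qed.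

Lemma T2RZ a u : T2R (a *: u) = symC M a *: T2R u.
Proof.
elim/tensor_ind: u => [|m n|u v IHu IHv]; first by rewrite !scaler0 T2R0 scaler0.
  by rewrite -tensZl !T2R_tens symVZ scalerA.
by rewrite scalerDr !T2RD scalerDr IHu IHv.
Qed.

Lemma T2R'Z a u : T2R' (a *: u) = symC M a *: T2R' u.
Proof.
elim/tensor_ind: u => [|m n|u v IHu IHv]; first by rewrite !scaler0 T2R'0 scaler0.
  by rewrite -tensZr !T2R'_tens symVZ scalerA.
by rewrite scalerDr !T2R'D scalerDr IHu IHv.
Qed.

Lemma symdelta_T2R u : symdelta (Rpos_sym (T2R u)) = T2R u + T2R' u.
Proof.
have delta0 : symdelta (0 : symalg M) = 0 by rewrite -symC0 symdeltaC.
elim/tensor_ind: u => [|m n|u v IHu IHv].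
- by rewrite T2R0 T2R'0 Rpos_sym0 delta0 addr0.
- by rewrite T2R_tens T2R'_tens RsymZ Rsym_one symdeltaM !symdeltaV.
- by rewrite T2RD T2R'D Rpos_symD symdeltaD IHu IHv addrACA.
Qed.

(** This difference vanishes on m (x) m and so descends to the exterior square. It converts
    flatness, formulated in A^2, into the equality of the two images in S (x) M. *)
Definition wedge_alt (m n : M) : Rpos M := T2R (tens m n) - T2R' (tens m n).

Lemma wedge_alt_rel s t : @alt_rel A M s t ->
  meval (fun p => wedge_alt p.1 p.2) s = meval (fun p => wedge_alt p.1 p.2) t.
Proof.
rewrite /wedge_alt; case=> {s t} [s t|m] /=; last first.
  by rewrite T2R_tens T2R'_tens subrr.
have sub2 (a b c d : Rpos M) : a + b - (c + d) = (a - c) + (b - d).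
  by rewrite opprD addrACA.
case=> * /=.
- by rewrite tensDl T2RD T2R'D; apply: sub2.
- by rewrite tensDr T2RD T2R'D; apply: sub2.
- by rewrite tensZl T2RZ T2R'Z -scalerBr -RposZ.
- by rewrite tensZr T2RZ T2R'Z -scalerBr -RposZ.
Qed.

Lemma T2R_wedge0 u : tens_wedge u = 0 -> T2R u = T2R' u.
Proof.
have altE : pmlift (fun p => wedge_alt p.1 p.2) (tens_wedge u) = T2R u - T2R' u.
  elim/tensor_ind: u => [|m n|u v IHu IHv].
  - by rewrite tens_wedge0 (pmlift0 wedge_alt_rel) T2R0 T2R'0 subr0.
  - by rewrite tens_wedge_tens [LHS](pmlift_gen wedge_alt_rel).
  - rewrite tens_wedgeD (pmliftD wedge_alt_rel) IHu IHv T2RD T2R'D.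
    by rewrite opprD [RHS]addrACA.
move=> u0; move: altE; rewrite u0 (pmlift0 wedge_alt_rel).
by move=> /esym/subr0_eq.
Qed.

End Squares.

Section StalkFunction.
Variables (X : topologicalType) (U : opens X) (x : X) (Ux : U x).

Lemma germU1 (P : presheaf X) (u : stalk P x) :
  exists (V : opens X) (VU : V `<=` U) (Vx : V x) s, u = germ Vx s.
Proof.
have [V [Vx [s ->]]] := germP u.
have Ix : interO U V x by [].
exists (interO U V), (@interOl _ _ _), Ix, (pres (@interOr _ _ _) s).
by rewrite germ_res.
Qed.

Lemma germU2 (P Q : presheaf X) (u : stalk P x) (v : stalk Q x) :
  exists (V : opens X) (VU : V `<=` U) (Vx : V x) s t,
    u = germ Vx s /\ v = germ Vx t.
Proof.
have [V [Vx [s [t [-> ->]]]]] := germP2 u v.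
have Ix : interO U V x by [].
exists (interO U V), (@interOl _ _ _), Ix, (pres (@interOr _ _ _) s),
  (pres (@interOr _ _ _) t).
by rewrite !germ_res.
Qed.

Variables (P : presheaf X) (Z : Type).
Variable v : forall V : opens X, V `<=` U -> V x -> P V -> Z.

(** [v] is defined only over open sets inside U, so the chosen representative is restricted to its
    intersection with U before [v] is applied. *)
Definition stalk_fun (u : stalk P x) : Z :=
  let p := rep u in
  @v (interO U (gdom p)) (@interOl _ _ _) (conj Ux (gin p))
     (pres (@interOr _ _ _) (gval p)).

Hypothesis v_res : forall (V W : opens X) (VU : V `<=` U) (WU : W `<=` U)
  (WV : W `<=` V) (Vx : V x) (Wx : W x) s, v WU Wx (pres WV s) = v VU Vx s.

Lemma stalk_funE (V : opens X) (VU : V `<=` U) (Vx : V x) s :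
  stalk_fun (germ Vx s) = v VU Vx s.
Proof.
rewrite /stalk_fun.
have := @rep_cls _ (geq_eqv P x) (Gpair Vx s); rewrite /germ.
case: (rep _) => V' V'x s' /= [W] /= [WV'] [WV] [Wx e].
have WI : W `<=` interO U V' by move=> y Wy; split; [apply/VU/WV|exact: (WV' y Wy)].
rewrite -(v_res _ (subset_trans WV VU) WI _ Wx).
by rewrite (pres_comp _ WI WV') e (v_res VU _ WV Vx).
Qed.

End StalkFunction.

Section Local.
Variables (X : topologicalType) (O : ringSheaf X).

Section One.
Variable E : famData O.

Lemma local_ext (V : opens X) (e e' : forall x, V x -> fE E x) :
  (forall x Vx, e x Vx = e' x Vx) -> is_local e -> is_local e'.
Proof.
move=> ee'; have -> // : e = e'.
by apply: functional_extensionality_dep => x; apply: functional_extensionality_dep.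
Qed.

Lemma local_add (V : opens X) (e e' : forall x, V x -> fE E x) :
  is_local e -> is_local e' -> is_local (fun x Vx => e x Vx + e' x Vx).
Proof. by move=> eP e'P; apply: (famD_local (Fam eP) (Fam e'P)). Qed.

Lemma local_0 (V : opens X) : is_local (fun x (_ : V x) => 0 : fE E x).
Proof. exact: fam0_local. Qed.

Lemma local_res (V W : opens X) (WV : W `<=` V) (e : forall x, V x -> fE E x) :
  is_local e -> is_local (fun x Wx => e x (WV x Wx)).
Proof. by move=> eP; apply: (fres_local WV (Fam eP)). Qed.

Lemma local_cover (V : opens X) (e : forall x, V x -> fE E x) :
  (forall x, V x -> exists (W : opens X) (WV : W `<=` V),
     W x /\ is_local (fun y Wy => e y (WV y Wy))) -> is_local e.
Proof.
move=> H x Vx; have [W [WV [Wx /(_ x Wx)]]] := H x Vx.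
move=> [Z [ZW [l [Zx el]]]]; exists Z, (subset_trans ZW WV), l; split=> // y Zy Vy.
by rewrite -(el y Zy (ZW y Zy)); congr e; apply: Prop_irrelevance.
Qed.

Lemma local_sum (V : opens X) (I : Type) (r : seq I)
    (e : I -> forall x, V x -> fE E x) :
  (forall i, is_local (e i)) -> is_local (fun x Vx => \sum_(i <- r) e i x Vx).
Proof.
move=> eP; elim: r => [|i r IHr].
  by apply: local_ext (@local_0 V) => x Vx; rewrite big_nil.
by apply: local_ext (local_add (eP i) IHr) => x Vx; rewrite big_cons.
Qed.

End One.

Lemma additive_sum (P Q : zmodType) (f : P -> Q) (I : Type) (r : seq I) F :
  {morph f : u v / u + v} ->
  f (\sum_(i <- r) F i) = \sum_(i <- r) f (F i).
Proof.
move=> fD; apply: big_morph => //; apply: (addIr (f 0)).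
by rewrite -fD !add0r.
Qed.

Section Two.
Variables (E E' : famData O) (U : opens X).
Variable f : forall x, U x -> fE E x -> fE E' x.

Definition preserves_local : Prop :=
  forall (V : opens X) (VU : V `<=` U) e, is_local (E := E) e ->
    is_local (E := E') (fun x (Vx : V x) => f (VU x Vx) (e x Vx)).

Lemma preserves_local_pure :
  (forall x (Ux : U x), {morph f Ux : u v / u + v}) ->
  (forall (V : opens X) (VU : V `<=` U) (g : fG E V),
     is_local (fun x (Vx : V x) => f (VU x Vx) (fpure g Vx))) ->
  preserves_local.
Proof.
move=> fD fg V VU e eP; apply: local_cover => x Vx.
have [W [WV [l [Wx el]]]] := eP x Vx; exists W, WV; split=> //.
apply: local_ext (local_sum l (fun g => fg W (subset_trans WV VU) g)) => y Wy.
rewrite (el y Wy) (additive_sum _ _ (@fD _ _)); apply: eq_bigr => g _.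
by congr (f _ _); apply: Prop_irrelevance.
Qed.

End Two.

End Local.

Section LocalSym.
Variables (X : topologicalType) (O : ringSheaf X) (F : modSheaf O).

(** The predicate certifies degree as well as locality: under [locS n] every member of the family is
    homogeneous of degree n. For [locR] the index is the degree of the symmetric factor, one less
    than the degree in R(F). *)
Definition locS n (V : opens X) (e : forall x, V x -> symalg (mstalk F x)) : Prop :=
  is_local (E := Sdata F n) e.

Definition locR n (V : opens X) (u : forall x, V x -> Rmod (mstalk F x)) : Prop :=
  is_local (E := Rdata F n) u.

Lemma locS_ext n (V : opens X) (e e' : forall x, V x -> symalg (mstalk F x)) :
  (forall x Vx, e x Vx = e' x Vx) -> locS n e -> locS n e'.
Proof. exact: (@local_ext _ _ (Sdata F n)). Qed.

Lemma locR_ext n (V : opens X) (e e' : forall x, V x -> Rmod (mstalk F x)) :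
  (forall x Vx, e x Vx = e' x Vx) -> locR n e -> locR n e'.
Proof. exact: (@local_ext _ _ (Rdata F n)). Qed.

Lemma locS_0 n (V : opens X) :
  locS n (fun x (_ : V x) => 0 : symalg (mstalk F x)).
Proof. exact: (@local_0 _ _ (Sdata F n)). Qed.

Lemma locS_mul i j n (V : opens X) (e e' : forall x, V x -> symalg (mstalk F x)) :
  (i + j)%N = n -> locS i e -> locS j e' -> locS n (fun x Vx => e x Vx * e' x Vx).
Proof.
move=> ijn eP e'P.
exact: (@Smul_local X O F V i j n (Fam eP : msec (Ssh F i) V) (Fam e'P : msec (Ssh F j) V)).
Qed.

Lemma locS_const (V : opens X) (a : rsec O V) :
  locS 0 (fun x (Vx : V x) => symC _ (rgerm Vx a)).
Proof.
apply: local_ext (fvalP (Scst F a)) => x Vx.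
by rewrite /= /Spure big_nil mulr1.
Qed.

Lemma locS_gen (V : opens X) (m : msec F V) :
  locS 1 (fun x (Vx : V x) => symV (mgerm Vx m)).
Proof.
apply: local_ext (fvalP (Sgen m)) => x Vx.
by rewrite /= /Spure big_cons big_nil mulr1 rgerm1 symC1 mul1r.
Qed.

Lemma locR_one (V : opens X) (m : msec F V) :
  locR 0 (fun x (Vx : V x) => Rone (mgerm Vx m)).
Proof.
apply: local_ext (fvalP (Rgen m)) => x Vx.
by rewrite /= /Rpure /= /Spure big_nil mulr1 rgerm1 symC1.
Qed.

Lemma locR_scale i j n (V : opens X) (e : forall x, V x -> symalg (mstalk F x))
    (u : forall x, V x -> Rmod (mstalk F x)) :
  (i + j)%N = n -> locS i e -> locR j u -> locR n (fun x Vx => e x Vx *: u x Vx).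
Proof.
move=> ijn eP uP; apply: local_cover => x Vx.
have [W [WV [l [Wx ul]]]] := uP x Vx; exists W, WV; split=> //.
(* A pure element of R has a whole section of S^j(F) as its first factor, so the scalar is merged
   into that section without being decomposed. *)
have gP (g : RG F j W) : locS n (fun y Wy => e y (WV y Wy) * fval g.1 Wy).
  by apply: (locS_mul ijn); [apply: (local_res (E := Sdata F i)) eP|apply: fvalP].
pose t (g : RG F j W) : RG F n W := (Fam (gP g) : msec (Ssh F n) W, g.2).
have tP := local_sum l (fun g => pure_local (E := Rdata F n) (t g)).
apply: local_ext tP => y Wy.
rewrite (ul y Wy) scaler_sumr; apply: eq_bigr => g _.
by rewrite /= /Rpure !RtensE scalerA.
Qed.

Lemma locS_natmul k n (V : opens X) (e : forall x, V x -> symalg (mstalk F x)) :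
  locS n e -> locS n (fun x Vx => e x Vx *+ k).
Proof.
move=> eP; elim: k => [|k IHk]; first exact: (@local_0 _ _ (Sdata F n)).
apply: local_ext (local_add (E := Sdata F n) eP IHk) => x Vx.
by rewrite mulrS.
Qed.

(* Pure elements of degree n + 1 are products of a pure element of degree n and
   an element of degree 1. *)
Lemma locS_pure_ind (U : opens X) (Q : nat -> forall V : opens X, V `<=` U ->
    (forall x, V x -> symalg (mstalk F x)) -> Prop) :
  (forall n (V : opens X) (VU : V `<=` U) e e',
     (forall x (Vx : V x), e x Vx = e' x Vx) ->
     Q n V VU e -> Q n V VU e') ->
  (forall (V : opens X) (VU : V `<=` U) a, Q 0%N V VU (fun x (Vx : V x) => symC _ (rgerm Vx a))) ->
  (forall n (V : opens X) (VU : V `<=` U) m e, locS n e -> Q n V VU e ->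
     Q n.+1 V VU (fun x (Vx : V x) => symV (mgerm Vx m) * e x Vx)) ->
  forall n (V : opens X) (VU : V `<=` U) (g : SG F n V),
    Q n V VU (fun x (Vx : V x) => Spure g Vx).
Proof.
move=> Qext Q0 QS; elim=> [|n IHn] V VU [a t].
  apply: Qext (Q0 V VU a) => x Vx; rewrite /Spure (tuple0 t) big_nil mulr1.
  by [].
pose g : SG F n V := (a, [tuple of behead t]).
apply: Qext (QS n V VU (thead t) _ (pure_local (E := Sdata F n) g) (IHn V VU g)) => x Vx.
by rewrite /Spure /= [in RHS](tuple_eta t) big_cons mulrCA.
Qed.

End LocalSym.

Section LocalOperators.
Variables (X : topologicalType) (O : ringSheaf X) (F : modSheaf O) (U : opens X).
Notation Sx x := (symalg (mstalk F x)).
Notation Rx x := (Rmod (mstalk F x)).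

Section Derivation.
Variables (P : forall x, lmodType (Sx x)).
Variable loc : nat -> forall V : opens X, (forall x, V x -> P x) -> Prop.
Hypothesis loc_ext : forall n (V : opens X) (e e' : forall x, V x -> P x),
  (forall x Vx, e x Vx = e' x Vx) -> loc n e -> loc n e'.
Hypothesis loc_add : forall n (V : opens X) (e e' : forall x, V x -> P x),
  loc n e -> loc n e' -> loc n (fun x Vx => e x Vx + e' x Vx).
Hypothesis loc_scale : forall i j n (V : opens X) (s : forall x, V x -> Sx x)
    (e : forall x, V x -> P x), (i + j)%N = n ->
  locS i s -> loc j e -> loc n (fun x Vx => s x Vx *: e x Vx).

Variables (f : forall x, U x -> Sx x -> P x) (k : nat).
Hypothesis fM : forall x (Ux : U x) s t,
  f Ux (s * t) = s *: f Ux t + t *: f Ux s.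
Hypothesis f_const : forall (V : opens X) (VU : V `<=` U) a,
  loc k (fun x (Vx : V x) => f (VU x Vx) (symC _ (rgerm Vx a))).
Hypothesis f_gen : forall (V : opens X) (VU : V `<=` U) m,
  loc k.+1 (fun x (Vx : V x) => f (VU x Vx) (symV (mgerm Vx m))).

(** A derivation is controlled by its values on constants and generators, and k is its rise in
    degree. The abstract predicate [loc] serves S-valued and R-valued derivations alike. *)
Lemma local_derivation n (V : opens X) (VU : V `<=` U) (g : SG F n V) :
  loc (n + k) (fun x (Vx : V x) => f (VU x Vx) (Spure g Vx)).
Proof.
apply: (locS_pure_ind (Q := fun n V VU e =>
  loc (n + k) (fun x (Vx : V x) => f (VU x Vx) (e x Vx)))) => {n V VU g}.
- by move=> n V VU e e' ee'; apply: loc_ext => x Vx; rewrite ee'.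
- by move=> V VU a; apply: f_const.
- move=> n V VU m e eP fe.
  apply: (loc_ext (e := fun x Vx => symV (mgerm Vx m) *: f (VU x Vx) (e x Vx) +
    e x Vx *: f (VU x Vx) (symV (mgerm Vx m)))); first by move=> x Vx; rewrite fM.
  apply: loc_add; first by apply: (loc_scale (i := 1) (j := n + k)) => //; apply: locS_gen.
  by apply: (loc_scale (i := n) (j := k.+1)) => //; rewrite addSn addnS.
Qed.

End Derivation.

Lemma locS_derivation (f : forall x, U x -> Sx x -> Sx x) k
    (fD : forall x (Ux : U x), {morph f x Ux : s t / s + t})
    (fM : forall x (Ux : U x) s t, f x Ux (s * t) = s * f x Ux t + t * f x Ux s)
    (f_const : forall (V : opens X) (VU : V `<=` U) a,
      locS k (fun x (Vx : V x) => f x (VU x Vx) (symC _ (rgerm Vx a))))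
    (f_gen : forall (V : opens X) (VU : V `<=` U) m,
      locS k.+1 (fun x (Vx : V x) => f x (VU x Vx) (symV (mgerm Vx m)))) n :
  preserves_local (E := Sdata F n) (E' := Sdata F (n + k)) f.
Proof.
apply: preserves_local_pure => // V VU g.
apply: (@local_derivation (fun x => (Sx x)^o) (fun n V e => locS n e)) => //.
- by move=> m W e e' ee'; apply: local_ext.
- by move=> m W e e'; apply: (@local_add _ _ (Sdata F m)).
- by move=> i j m W s e; apply: locS_mul.
Qed.

Lemma locR_derivation (f : forall x, U x -> Sx x -> Rx x) k
    (fD : forall x (Ux : U x), {morph f x Ux : s t / s + t})
    (fM : forall x (Ux : U x) s t, f x Ux (s * t) = s *: f x Ux t + t *: f x Ux s)
    (f_const : forall (V : opens X) (VU : V `<=` U) a,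
      locR k (fun x (Vx : V x) => f x (VU x Vx) (symC _ (rgerm Vx a))))
    (f_gen : forall (V : opens X) (VU : V `<=` U) m,
      locR k.+1 (fun x (Vx : V x) => f x (VU x Vx) (symV (mgerm Vx m)))) n :
  preserves_local (E := Sdata F n) (E' := Rdata F (n + k)) f.
Proof.
apply: preserves_local_pure => // V VU g.
apply: (@local_derivation (fun x => Rx x) (fun n V e => locR n e)) => //.
- by move=> m W e e' ee'; apply: local_ext.
- by move=> m W e e'; apply: (@local_add _ _ (Rdata F m)).
- by move=> i j m W s e; apply: locR_scale.
Qed.

Lemma preserves_local_R (E : famData O) n (f : forall x, U x -> Rx x -> fE E x)
    (fD : forall x (Ux : U x), {morph f x Ux : s t / s + t})
    (f_gen : forall (V : opens X) (VU : V `<=` U) (s : msec (Ssh F n) V) m,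
      is_local (E := E) (fun x (Vx : V x) =>
        f x (VU x Vx) (symval s Vx *: Rone (mgerm Vx m)))) :
  preserves_local (E := Rdata F n) (E' := E) f.
Proof.
apply: preserves_local_pure => // V VU [s m].
by apply: local_ext (f_gen V VU s m) => x Vx; rewrite -RtensE.
Qed.

Section Solve.
Variable rho : forall x, {rmorphism rat -> rstalk O x}.
Hypothesis rho_local : forall q (V : opens X),
  locS 0 (fun x (_ : V x) => symC (mstalk F x) (rho x q)).

Lemma locS_rat q n (V : opens X) (e : forall x, V x -> Sx x) :
  locS n e -> locS n (fun x Vx => ratS (mstalk F x) (rho x) q * e x Vx).
Proof. by move=> eP; apply: (locS_mul (add0n n) (@rho_local q V) eP). Qed.

Lemma locR_rat q n (V : opens X) (e : forall x, V x -> Rx x) :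
  locR n e -> locR n (fun x Vx => ratS (mstalk F x) (rho x) q *: e x Vx).
Proof. by move=> eP; apply: (locR_scale (add0n n) (@rho_local q V) eP). Qed.

Section Phi.
Variable f : forall x, U x -> nat -> mstalk F x -> Sx x.
Hypothesis f_lin : forall x (Ux : U x), linear_coefs (f Ux).
Hypothesis f_local : forall (V : opens X) (VU : V `<=` U) j m,
  locS j.+1 (fun x (Vx : V x) => f (VU x Vx) j (mgerm Vx m)).

Lemma phi_local n q : preserves_local (E := Sdata F n) (E' := Sdata F (n + q))
  (fun x (Ux : U x) s => phi (f Ux) s q).
Proof.
apply: preserves_local_pure => [x Ux s t|V VU g]; first by rewrite (phiD (f_lin Ux)).
move: q; apply: (locS_pure_ind (Q := fun n V VU e => forall q,
  locS (n + q) (fun x (Vx : V x) => phi (f (VU x Vx)) (e x Vx) q))) => {n V VU g}.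
- move=> n V VU e e' ee' H q; apply: locS_ext (H q) => x Vx; by rewrite ee'.
- move=> V VU a [|q].
    by rewrite addn0; apply: locS_ext (locS_const F a) => x Vx; rewrite phiC.
  by apply: locS_ext (locS_0 F _ (V:=V)) => x Vx; rewrite phiC.
- move=> n V VU m e eP IH q.
  have loc1 (i : 'I_q.+1) : locS (n.+1 + q) (fun x (Vx : V x) =>
      f (VU x Vx) i (mgerm Vx m) * phi (f (VU x Vx)) (e x Vx) (q - i)%N).
    apply: (locS_mul _ (f_local VU i m) (IH (q - i)%N)).
    by rewrite !addSn addnCA subnKC // -ltnS.
  apply: locS_ext (local_sum (E := Sdata F _) (index_enum _) loc1) => x Vx.
  by rewrite phiM // seriesME phiV.
Qed.

(** The extra successor is the weight of the last tensor factor. *)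
Lemma phiR_local n q : preserves_local (E := Rdata F n) (E' := Sdata F (n + q).+1)
  (fun x (Ux : U x) u => phiR (f Ux) u q).
Proof.
apply: preserves_local_R => [x Ux s t|V VU s m]; first by rewrite (phiRD (f_lin Ux)).
have loc1 (i : 'I_q.+1) : locS (n + q).+1 (fun x (Vx : V x) =>
    phi (f (VU x Vx)) (symval s Vx) i *
    (f (VU x Vx) (q - i)%N (mgerm Vx m) *+ (q - i).+1)).
  apply: (@locS_mul _ _ _ (n + i) (q - i).+1).
  - by rewrite addnS -addnA subnKC // -ltnS.
  - by apply: phi_local; apply: fvalP.
  - exact/locS_natmul/f_local.
apply: locS_ext (local_sum (E := Sdata F _) (index_enum _) loc1) => x Vx.
rewrite phiRZ // phiR_one // seriesME; apply: eq_bigr => i _.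
by rewrite seriesD /euler -mulrS.
Qed.

End Phi.

Variables (V : forall x, U x -> nat -> mstalk F x -> Rx x).
Variables (t' : forall x, U x -> nat -> mstalk F x -> Sx x).
Hypothesis V_local : forall (W : opens X) (WU : W `<=` U) n m,
  locR n (fun x (Wx : W x) => V (WU x Wx) n (mgerm Wx m)).
Hypothesis t'_local : forall (W : opens X) (WU : W `<=` U) n m,
  locS n.+1 (fun x (Wx : W x) => t' (WU x Wx) n (mgerm Wx m)).
Hypothesis solve_lin : forall x (Ux : U x) q,
  linear_coefs (solve_upto (rho x) (V Ux) (t' Ux) q).

Lemma solve_upto_local q (W : opens X) (WU : W `<=` U) j m :
  locS j.+1 (fun x (Wx : W x) =>
    solve_upto (rho x) (V (WU x Wx)) (t' (WU x Wx)) q j (mgerm Wx m)).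
Proof.
elim: q W WU j m => [|q IHq] W WU j m; first exact: (local_0 (Sdata F _)).
rewrite /= /solve_step; have [->|_] := eqVneq j q; last exact: IHq.
have IHloc := phiR_local (fun x Ux => solve_lin Ux q) IHq.
have loc1 (i : 'I_q.+1) : locS q.+1 (fun x (Wx : W x) =>
    phiR (solve_upto (rho x) (V (WU x Wx)) (t' (WU x Wx)) q)
      (V (WU x Wx) i (mgerm Wx m)) (q - i)%N).
  have := IHloc i (q - i)%N W WU _ (V_local WU i m).
  by rewrite subnKC // -ltnS.
have loc2 := local_sum (E := Sdata F _) (index_enum _) loc1.
apply: locS_rat.
have locN := locS_rat (-1) loc2.
apply: locS_ext (local_add (E := Sdata F _) (t'_local WU q m) locN) => x Wx.
by rewrite /ratS !rmorphN1 mulN1r.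
Qed.

Lemma solution_local q (W : opens X) (WU : W `<=` U) m :
  locS q.+1 (fun x (Wx : W x) =>
    solution (rho x) (V (WU x Wx)) (t' (WU x Wx)) q (mgerm Wx m)).
Proof. exact: solve_upto_local. Qed.

End Solve.

End LocalOperators.

(** Bundles the hypotheses of the exponential construction at one stalk, so that a family over the
    points of U can assume them at once. *)
Record connection_data (A : comPzRingType) (M : lmodType A)
    (rho : {rmorphism rat -> A}) (D : A -> M) (c : M -> Rmod M) : Prop :=
  ConnectionData {
  cdDD : {morph D : a b / a + b};
  cdDM : forall a b, D (a * b) = a *: D b + b *: D a;
  cdD_rat : forall q, D (rho q) = 0;
  cdcD : {morph c : m n / m + n};
  cdcZ : forall a m, c (a *: m) = symC M a *: c m + symV (D a) *: Rone m }.

Record flat_data (A : comPzRingType) (M : lmodType A)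
    (rho : {rmorphism rat -> A}) (D : A -> M) (c c' : M -> Rmod M) : Prop :=
  FlatData {
  fd_conn : connection_data rho D c;
  fdc'D : {morph c' : m n / m + n};
  fdc'Z : forall a m, c' (a *: m) = symC M a *: c' m + symV m *: Rone (D a);
  fd_delta : forall m, symdelta (Rpos_sym (c m)) = c m + c' m;
  fd_flat : forall a, c (D a) = c' (D a) }.

Section FlatLocal.
Variables (X : topologicalType) (O : ringSheaf X) (F : modSheaf O) (U : opens X).
Notation Sx x := (symalg (mstalk F x)).
Notation Rx x := (Rmod (mstalk F x)).
Variable rho : forall x, {rmorphism rat -> rstalk O x}.
Hypothesis rho_local : forall q (V : opens X),
  locS 0 (fun x (_ : V x) => symC (mstalk F x) (rho x q)).

Lemma Rpos_sym_local n : preserves_local (E := Rdata F n) (E' := Sdata F n.+1)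
  (fun x (_ : U x) (u : Rx x) => Rpos_sym u).
Proof.
apply: preserves_local_R => [x Ux|V VU s m]; first exact: Rpos_symD.
apply: (@locS_ext _ _ F _ _ (fun x Vx => symval s Vx * symV (mgerm Vx m))).
  by move=> x Vx; rewrite RsymZ Rsym_one.
by apply: (locS_mul (addn1 n)); [apply: fvalP|apply: locS_gen].
Qed.

Variables (D : forall x, U x -> rstalk O x -> mstalk F x).
Variables (c c' : forall x, U x -> mstalk F x -> Rx x).
Variable Ds : forall V : opens X, V `<=` U -> rsec O V -> msec F V.
Hypothesis DsE : forall (V : opens X) (VU : V `<=` U) a x (Vx : V x),
  D (VU x Vx) (rgerm Vx a) = mgerm Vx (Ds VU a).
Hypothesis c_local : forall (V : opens X) (VU : V `<=` U) m,
  locR 1 (fun x (Vx : V x) => c (VU x Vx) (mgerm Vx m)).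

Section Connection.
Hypothesis H : forall x (Ux : U x), connection_data (rho x) (D Ux) (c Ux).

Lemma nabla_local n : preserves_local (E := Sdata F n) (E' := Sdata F n.+1)
  (fun x (Ux : U x) s => nabla (D Ux) (c Ux) s).
Proof.
rewrite -(addn1 n); apply: locS_derivation => [x Ux|x Ux s t|V VU a|V VU m].
- by apply: nablaD; case: (H Ux).
- by apply: nablaM; case: (H Ux).
- apply: (@locS_ext _ _ F _ _ (fun x Vx => symV (mgerm Vx (Ds VU a)))).
    by move=> x Vx; rewrite -DsE nablaC //; case: (H (VU x Vx)).
  exact: locS_gen.
- have := Rpos_sym_local VU (c_local VU m).
  by apply: locS_ext => x Vx; rewrite nablaV //; case: (H (VU x Vx)).
Qed.

Lemma gam_local n : preserves_local (E := Rdata F n) (E' := Rdata F n.+1)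
  (fun x (Ux : U x) u => gam (D Ux) (c Ux) u).
Proof.
apply: preserves_local_R => [x Ux|V VU s m].
  by apply: gamD; case: (H Ux).
have sP := fvalP s; have nabs := nabla_local VU sP.
have l1 : locR n.+1 (fun x (Vx : V x) =>
    nabla (D (VU x Vx)) (c (VU x Vx)) (symval s Vx) *: Rone (mgerm Vx m)).
  by apply: (locR_scale (addn0 _) nabs); apply: locR_one.
have l2 : locR n.+1 (fun x (Vx : V x) => symval s Vx *: c (VU x Vx) (mgerm Vx m)).
  by apply: (locR_scale (addn1 n)); [apply: fvalP|apply: c_local].
apply: locR_ext (local_add (E := Rdata F n.+1) l1 l2) => x Vx.
by rewrite gamZ ?gam_one //; case: (H (VU x Vx)).
Qed.

Lemma hflat_local n (V : opens X) (VU : V `<=` U) a : locS n (fun x (Vx : V x) =>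
  hflat (rho x) (D (VU x Vx)) (c (VU x Vx)) n (rgerm Vx a)).
Proof.
elim: n => [|n IHn]; first exact: locS_const.
by apply: (locS_rat rho_local); apply: (nabla_local VU IHn).
Qed.

Lemma Tflat_local n (V : opens X) (VU : V `<=` U) m : locR n (fun x (Vx : V x) =>
  Tflat (rho x) (D (VU x Vx)) (c (VU x Vx)) n (mgerm Vx m)).
Proof.
elim: n => [|n IHn]; first exact: locR_one.
by apply: (locR_rat rho_local); apply: (gam_local VU IHn).
Qed.

End Connection.

Hypothesis H : forall x (Ux : U x), flat_data (rho x) (D Ux) (c Ux) (c' Ux).
Hypothesis c'_local : forall (V : opens X) (VU : V `<=` U) m,
  locR 1 (fun x (Vx : V x) => c' (VU x Vx) (mgerm Vx m)).

Let H0 x (Ux : U x) : connection_data (rho x) (D Ux) (c Ux).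
Proof. exact: fd_conn (H Ux). Qed.

Lemma nabP_local n : preserves_local (E := Sdata F n) (E' := Rdata F n)
  (fun x (Ux : U x) s => nabP (D Ux) (c' Ux) s).
Proof.
rewrite -[in X in preserves_local (E' := X)](addn0 n).
apply: locR_derivation => [x Ux|x Ux s t|V VU a|V VU m].
- by apply: nabPD; case: (H Ux) => -[].
- by apply: nabPM; case: (H Ux) => -[].
- apply: (@locR_ext _ _ F _ _ (fun x Vx => Rone (mgerm Vx (Ds VU a)))).
    by move=> x Vx; rewrite -DsE nabPC //; case: (H (VU x Vx)) => -[].
  exact: locR_one.
- have := c'_local VU m.
  by apply: locR_ext => x Vx; rewrite nabPV //; case: (H (VU x Vx)) => -[].
Qed.

Lemma curv_local n : preserves_local (E := Rdata F n) (E' := Rdata F n.+2)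
  (fun x (Ux : U x) u => curv (D Ux) (c Ux) (c' Ux) u).
Proof.
have curvDx x (Ux : U x) : {morph curv (D Ux) (c Ux) (c' Ux) : u v / u + v}.
  by case: (H Ux) => -[*]; apply: curvD.
apply: preserves_local_R => // V VU s m.
have gP := @locS_gen _ _ F V m.
have l1 := nabP_local VU (nabla_local H0 VU gP).
have l2 := locR_rat rho_local (-1) (gam_local H0 VU (nabP_local VU gP)).
have l3 := local_add (E := Rdata F 2) l1 l2.
have := locR_scale (addn2 n) (fvalP s) l3; apply: locR_ext => x Vx.
have -> : curv (D (VU x Vx)) (c (VU x Vx)) (c' (VU x Vx))
    (symval s Vx *: Rone (mgerm Vx m)) =
    symval s Vx *: curv_gen (D (VU x Vx)) (c (VU x Vx)) (c' (VU x Vx)) (mgerm Vx m).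
  by case: (H (VU x Vx)) => -[*]; rewrite curvZ // curv_one.
by rewrite /ratS !rmorphN1 scaleN1r.
Qed.

Lemma jacobi_local (V : opens X) (VU : V `<=` U) m n :
  let J x (Vx : V x) := dexp (rho x)
    (jacobi (D (VU x Vx)) (c (VU x Vx)) (c' (VU x Vx))) n (0, Rone (mgerm Vx m)) in
  locR n.-1 (fun x (Vx : V x) => (J x Vx).1) /\
  locR n (fun x (Vx : V x) => (J x Vx).2).
Proof.
elim: n => [|n [IH1 IH2]] /=.
  by split; [apply: (local_0 (Rdata F 0))|apply: locR_one].
have l1 := gam_local H0 VU IH1; have l2 := gam_local H0 VU IH2.
have l3 := curv_local VU IH1.
split; apply: (locR_rat rho_local).
  (* At n = 0 the first component is 0, and its image under [gam] would be counted one degree too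
     high because n.-1 is truncated; the term has to be removed by hand. The same happens for the
     curvature term in the second component. *)
  case: n {l2 l3} IH1 IH2 l1 => [|n] IH1 IH2 l1.
    apply: locR_ext IH2 => x Vx /=.
    suff -> : gam (D (VU x Vx)) (c (VU x Vx)) 0 = 0 by rewrite add0r.
    by case: (H0 (VU x Vx)) => *; apply: gam0.
  exact: (local_add (E := Rdata F n.+1) l1 IH2).
case: n {l1} IH1 IH2 l2 l3 => [|n] IH1 IH2 l2 l3.
  apply: locR_ext l2 => x Vx /=.
  suff -> : curv (D (VU x Vx)) (c (VU x Vx)) (c' (VU x Vx)) 0 = 0 by rewrite addr0.
  by case: (H (VU x Vx)) => -[*]; apply: curv0.
exact: (local_add (E := Rdata F n.+2) l2 l3).
Qed.

Lemma Vflat_local n (V : opens X) (VU : V `<=` U) m : locR n (fun x (Vx : V x) =>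
  Vflat (rho x) (D (VU x Vx)) (c (VU x Vx)) (c' (VU x Vx)) n (mgerm Vx m)).
Proof. by have [+ _] := jacobi_local VU m n.+1. Qed.

End FlatLocal.

(** * Iterated Hasse derivations on sheaves *)

Section Weight.
Variables (X : topologicalType) (O : ringSheaf X) (F : modSheaf O).

(** The product map after [symdelta] is the Euler operator of Sym: by the Leibniz rule it multiplies
    a product of n generators by n. This supplies the weight hypothesis [h_weight] of the
    degree-by-degree solution. *)
Lemma locS_weight n (V : opens X) (e : forall x, V x -> symalg (mstalk F x)) x (Vx : V x) :
  locS n e -> Rpos_sym (symdelta (e x Vx)) = e x Vx *+ n.
Proof.
move=> /(_ x Vx) [W [WV [l [Wx el]]]]; rewrite (el x Wx Vx) -sumrMnl.
rewrite (additive_sum _ _ (@symdeltaD _ _)) (additive_sum _ _ (@Rpos_symD _ _)).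
apply: eq_bigr => -[a t] _ /=; rewrite /Spure /= symdeltaM symdeltaC scaler0 addr0.
rewrite RsymZ -mulrnAr; congr (_ * _) => {el l}.
case: t => t /= /eqP <-; elim: t => [|m t IHt].
  by rewrite big_nil -symC1 symdeltaC Rpos_sym0.
rewrite big_cons symdeltaM symdeltaV Rpos_symD !RsymZ IHt Rsym_one /=.
by rewrite mulrnAr [_ * symV _]mulrC -mulrSr.
Qed.

End Weight.

Section GermMorphism.
Variables (X : topologicalType) (O : ringSheaf X) (x : X) (V : opens X) (Vx : V x).

Lemma rgermB : zmod_morphism (@rgerm _ O x V Vx).
Proof.
by move=> a b; apply: (addIr (rgerm Vx b)); rewrite -rgermD !subrK.
Qed.

Lemma rgerm_monoid : monoid_morphism (@rgerm _ O x V Vx).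
Proof. by split=> [|a b]; [apply: rgerm1|apply: rgermM]. Qed.

HB.instance Definition _ := GRing.isZmodMorphism.Build _ _ (@rgerm _ O x V Vx) rgermB.
HB.instance Definition _ :=
  GRing.isMonoidMorphism.Build _ _ (@rgerm _ O x V Vx) rgerm_monoid.

End GermMorphism.

Section RatStalk.
Variables (X : topologicalType) (OB : QSheaf X) (OX : algSheaf OB).

Definition rat_stalk (x : X) : {rmorphism rat -> rstalk OX x} :=
  [the {rmorphism rat -> rstalk OX x} of
    (@rgerm _ OX x fullO I) \o (astr OX fullO \o qstr OB fullO)].

(** A [QSheaf] carries one map from Q for each open set, with no stated compatibility under
    restriction. The two germs agree because both are inverse to n.+1 in the stalk. *)
Lemma rat_germV (V : opens X) x (Vx : V x) n :
  rat_germ OX Vx n.+1%:R^-1 = rat_stalk x n.+1%:R^-1.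
Proof.
have unitV (f : {rmorphism rat -> rstalk OX x}) : n.+1%:R * f n.+1%:R^-1 = 1.
  by rewrite -(rmorph_nat f) -rmorphM mulfV ?rmorph1 ?Num.Theory.pnatr_eq0.
pose g := [the {rmorphism rat -> rstalk OX x} of
  (@rgerm _ OX x V Vx) \o (astr OX V \o qstr OB V)].
have -> : rat_germ OX Vx n.+1%:R^-1 = g n.+1%:R^-1 by [].
by rewrite -[LHS]mulr1 -(unitV (rat_stalk x)) mulrCA mulrA unitV mul1r.
Qed.

Lemma rat_stalk_local (F : modSheaf OX) q (V : opens X) :
  locS 0 (fun x (_ : V x) => symC (mstalk F x) (rat_stalk x q)).
Proof.
apply: locS_ext (locS_const F (rres OX (@fullO_sub _ V) (ratO OX fullO q))) => x Vx.
by rewrite (rgerm_res _ _ (I : @fullO X x)).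
Qed.

End RatStalk.

Section FamilyMap.
Variables (X : topologicalType) (O : ringSheaf X) (U : opens X) (P : presheaf X).
Variables (E : famData O) (f : forall x, U x -> stalk P x -> fE E x).
Hypothesis f_local : forall (V : opens X) (VU : V `<=` U) s,
  is_local (E := E) (fun x (Vx : V x) => f (VU x Vx) (germ Vx s)).

Definition fam_smap : smap U P (famSheaf E).
Proof.
exists (fun V VU s => Fam (f_local VU s)) => V W VU WV WU s.
apply: famP => x Wx /=; rewrite (germ_res WV Wx (WV x Wx)).
by congr (f _ _); apply: Prop_irrelevance.
Defined.

End FamilyMap.

Section Product.
Variables (X : topologicalType) (O : ringSheaf X) (F : modSheaf O) (U : opens X).

Definition Ssec_smap (P : presheaf X) (f : forall n, smap U P (Ssh F n)) :
  smap U P (Salg F).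
Proof.
exists (fun V VU s => (fun n => f n V VU s) : Ssec F V) => V W VU WV WU s.
by apply: functional_extensionality_dep => n; apply: (sapp_res (f n) VU WV WU).
Defined.

Definition Sinj p (V : opens X) (s : msec (Ssh F p) V) : Ssec F V := fun n =>
  match @eqP _ p n with
  | ReflectT e => ecast n (msec (Ssh F n) V) e s
  | ReflectF _ => 0
  end.

Lemma Sv_Sinj p (V : opens X) (s : msec (Ssh F p) V) x (Vx : V x) n :
  Sv (Sinj s) Vx n = if n == p then symval s Vx else 0.
Proof.
rewrite /Sv /Sinj; case: eqP => [e|ne]; first by case: _ / e; rewrite eqxx.
by case: eqP => // e; case: ne.
Qed.

(** For additive f this says that degree n of the value depends only on the degrees up to n of the
    argument. It composes well and spares the homogeneous parts, which [strict_equivalence]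
    recovers. *)
Definition filtered_map (f : smap U (Salg F) (Salg F)) : Prop :=
  forall (V : opens X) (VU : V `<=` U) (w : Ssec F V) n,
    (forall p, (p <= n)%N -> w p = 0) -> (f V VU w : Ssec F V) n = 0.

Definition unipotent_map (f : smap U (Salg F) (Salg F)) : Prop :=
  forall (V : opens X) (VU : V `<=` U) (m : msec F V),
    (f V VU (Sinj (Sgen m)) : Ssec F V) 1%N = Sgen m.

(* the automorphisms of S(F) allowed as equivalences; bijectivity is automatic *)
Definition strict_map (f : smap U (Salg F) (Salg F)) : Prop :=
  [/\ alg_map f, filtered_map f & unipotent_map f].

End Product.

Section StalkData.
Variables (X : topologicalType) (OB : QSheaf X) (OX : algSheaf OB) (F : modSheaf OX).
Variables (U : opens X) (D : smap U OX F).
Hypothesis D_der : is_derivation D.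
Notation Sx x := (symalg (mstalk F x)).
Notation Rx x := (Rmod (mstalk F x)).

Lemma rgermU1 x (Ux : U x) (a : rstalk OX x) :
  exists (V : opens X) (VU : V `<=` U) (Vx : V x) s, a = rgerm Vx s.
Proof. exact: (@germU1 X U x Ux OX). Qed.

Lemma rgermU2 x (Ux : U x) (a b : rstalk OX x) :
  exists (V : opens X) (VU : V `<=` U) (Vx : V x) s t, a = rgerm Vx s /\ b = rgerm Vx t.
Proof. exact: (@germU2 X U x Ux OX OX). Qed.

Lemma mgermU2 x (Ux : U x) (m n : mstalk F x) :
  exists (V : opens X) (VU : V `<=` U) (Vx : V x) s t, m = mgerm Vx s /\ n = mgerm Vx t.
Proof. exact: (@germU2 X U x Ux F F). Qed.

Lemma rmgermU2 x (Ux : U x) (a : rstalk OX x) (n : mstalk F x) :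
  exists (V : opens X) (VU : V `<=` U) (Vx : V x) s t, a = rgerm Vx s /\ n = mgerm Vx t.
Proof. exact: (@germU2 X U x Ux OX F). Qed.

Definition stD x (Ux : U x) : rstalk OX x -> mstalk F x :=
  @stalk_fun X U x Ux OX _ (fun V VU Vx a => mgerm Vx (D V VU a)).

Lemma stDE (V : opens X) (VU : V `<=` U) a x (Vx : V x) :
  stD (VU x Vx) (rgerm Vx a) = mgerm Vx (D V VU a).
Proof.
apply: stalk_funE => {V VU a Vx} V W VU WU WV Vx Wx s.
by rewrite (sapp_res D VU WV WU) (mgerm_res WV Wx Vx).
Qed.

Lemma stDE' x (Ux : U x) (V : opens X) (VU : V `<=` U) a (Vx : V x) :
  stD Ux (rgerm Vx a) = mgerm Vx (D V VU a).
Proof. by rewrite -stDE; congr (stD _ _); apply: Prop_irrelevance. Qed.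

Lemma stD_add x (Ux : U x) : {morph stD Ux : a b / a + b}.
Proof.
move=> a b; have [V [VU [Vx [s [t [-> ->]]]]]] := rgermU2 Ux a b.
have [DD _ _] := D_der VU.
by rewrite -rgermD !(stDE' Ux VU) DD mgermD.
Qed.

Lemma stD_mul x (Ux : U x) a b : stD Ux (a * b) = a *: stD Ux b + b *: stD Ux a.
Proof.
have [V [VU [Vx [s [t [-> ->]]]]]] := rgermU2 Ux a b.
have [_ DM _] := D_der VU.
by rewrite -rgermM !(stDE' Ux VU) DM mgermD !mgermZ.
Qed.

Lemma D_base (V : opens X) (VU : V `<=` U) b : D V VU (astr OX V b) = (0 : msec F V).
Proof.
have [_ DM DZ] := D_der VU; rewrite -[astr OX V b]mulr1 DZ.
have D1 : D V VU (1 : rsec OX V) = (0 : msec F V).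
  have := DM 1 1; rewrite mulr1 scale1r => /esym D11.
  by apply: (addIr (D V VU (1 : rsec OX V) : msec F V)); rewrite add0r.
by rewrite D1 scaler0.
Qed.

Lemma mgerm0 x (V : opens X) (Vx : V x) : mgerm Vx (0 : msec F V) = 0.
Proof. by rewrite -(mst_0E F Vx). Qed.

Lemma stD_rat x (Ux : U x) q : stD Ux (rat_stalk OX x q) = 0.
Proof.
pose a := ratO OX fullO q.
have -> : rat_stalk OX x q = rgerm Ux (rres OX (@fullO_sub _ U) a).
  by rewrite (rgerm_res _ _ (I : @fullO X x)).
rewrite (stDE' Ux (@subset_refl _ U)) -astr_res D_base; exact: mgerm0.
Qed.

Section Connection.
Variable gamma : smap U F (T2 F).
Hypothesis gamma_conn : is_connection D gamma.

Definition stgamma x (Ux : U x) : mstalk F x -> T2E F x :=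
  @stalk_fun X U x Ux F _
    (fun V VU Vx m => fval (gamma V VU m : msec (T2 F) V) Vx).

Lemma stgammaE x (Ux : U x) (V : opens X) (VU : V `<=` U) m (Vx : V x) :
  stgamma Ux (mgerm Vx m) = fval (gamma V VU m : msec (T2 F) V) Vx.
Proof.
apply: stalk_funE => {V VU m Vx} V W VU WU WV Vx Wx s.
have -> := sapp_res gamma VU WV WU s.
exact: (@fval_irr _ _ _ _ (gamma V VU s : msec (T2 F) V) x (WV x Wx) Vx).
Qed.

Lemma stgammaD x (Ux : U x) : {morph stgamma Ux : m n / m + n}.
Proof.
move=> m n; have [V [VU [Vx [s [t [-> ->]]]]]] := mgermU2 Ux m n.
by rewrite -mgermD !(stgammaE Ux VU) (gamma_conn.1.1 V VU).
Qed.

Lemma stgammaZ x (Ux : U x) a m :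
  stgamma Ux (a *: m) = tens (stD Ux a) m + a *: stgamma Ux m.
Proof.
have [V [VU [Vx [s [t [-> ->]]]]]] := rmgermU2 Ux a m.
by rewrite -mgermZ !(stgammaE Ux VU) (gamma_conn.2 V VU) (stDE' Ux VU).
Qed.

Definition stc x (Ux : U x) (m : mstalk F x) : Rx x := T2R (stgamma Ux m).
Definition stc' x (Ux : U x) (m : mstalk F x) : Rx x := T2R' (stgamma Ux m).

Lemma st_connection x (Ux : U x) :
  connection_data (rat_stalk OX x) (stD Ux) (stc Ux).
Proof.
split=> [||q|m n|a m]; [exact: stD_add|exact: stD_mul|exact: stD_rat|..].
  by rewrite /stc stgammaD T2RD.
by rewrite /stc stgammaZ T2RD T2R_tens T2RZ addrC.
Qed.

Lemma st_flat x (Ux : U x) : is_flat D gamma ->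
  flat_data (rat_stalk OX x) (stD Ux) (stc Ux) (stc' Ux).
Proof.
move=> flat; split=> [|m n|a m|m|a]; first exact: st_connection.
- by rewrite /stc' stgammaD T2R'D.
- by rewrite /stc' stgammaZ T2R'D T2R'_tens T2R'Z addrC.
- exact: symdelta_T2R.
- have [V [VU [Vx [s ->]]]] := rgermU1 Ux a.
  apply: T2R_wedge0; rewrite (stDE' Ux VU) (stgammaE Ux VU).
  have := flat V VU s => /(congr1 (fun u => fval u Vx)); exact.
Qed.

Lemma T2R_local (V : opens X) (s : msec (T2 F) V) :
  locR 1 (fun x (Vx : V x) => T2R (fval s Vx)).
Proof.
move=> x Vx; have [W [WV [l [Wx sl]]]] := fvalP s Vx.
pose loc1 (g : T2G F W) := locR_scale (addn0 1) (locS_gen g.1) (locR_one g.2).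
have := local_sum (E := Rdata F 1) l loc1 Wx.
move=> [Z [ZW [k [Zx kE]]]]; exists Z, (subset_trans ZW WV), k; split=> // y Zy Vy.
rewrite (sl y (ZW y Zy)) -(kE y Zy (ZW y Zy)) (additive_sum _ _ (@T2RD _ _)).
by apply: eq_bigr => g _; rewrite T2R_tens.
Qed.

Lemma T2R'_local (V : opens X) (s : msec (T2 F) V) :
  locR 1 (fun x (Vx : V x) => T2R' (fval s Vx)).
Proof.
move=> x Vx; have [W [WV [l [Wx sl]]]] := fvalP s Vx.
pose loc1 (g : T2G F W) := locR_scale (addn0 1) (locS_gen g.2) (locR_one g.1).
have := local_sum (E := Rdata F 1) l loc1 Wx.
move=> [Z [ZW [k [Zx kE]]]]; exists Z, (subset_trans ZW WV), k; split=> // y Zy Vy.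
rewrite (sl y (ZW y Zy)) -(kE y Zy (ZW y Zy)) (additive_sum _ _ (@T2R'D _ _)).
by apply: eq_bigr => g _; rewrite T2R'_tens.
Qed.

Lemma stc_local (V : opens X) (VU : V `<=` U) m :
  locR 1 (fun x (Vx : V x) => stc (VU x Vx) (mgerm Vx m)).
Proof.
apply: locR_ext (T2R_local (gamma V VU m : msec (T2 F) V)) => x Vx.
by rewrite /stc (stgammaE _ VU).
Qed.

Lemma stc'_local (V : opens X) (VU : V `<=` U) m :
  locR 1 (fun x (Vx : V x) => stc' (VU x Vx) (mgerm Vx m)).
Proof.
apply: locR_ext (T2R'_local (gamma V VU m : msec (T2 F) V)) => x Vx.
by rewrite /stc' (stgammaE _ VU).
Qed.

Definition hconn : smap U OX (Salg F) :=
  Ssec_smap (fun n => @fam_smap X OX U OX (Sdata F n)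
    (fun x Ux a => hflat (rat_stalk OX x) (stD Ux) (stc Ux) n a)
    (hflat_local (@rat_stalk_local _ _ OX F) stDE stc_local st_connection n)).

Definition Tconn n : smap U F (Rsh F n) :=
  @fam_smap X OX U F (Rdata F n)
    (fun x Ux m => Tflat (rat_stalk OX x) (stD Ux) (stc Ux) n m)
    (Tflat_local (@rat_stalk_local _ _ OX F) stDE stc_local st_connection n).

Lemma hconnE (V : opens X) (VU : V `<=` U) a x (Vx : V x) n :
  Sv (hconn V VU a : Ssec F V) Vx n =
  hflat (rat_stalk OX x) (stD (VU x Vx)) (stc (VU x Vx)) n (rgerm Vx a).
Proof. by []. Qed.

Lemma TconnE n (V : opens X) (VU : V `<=` U) m x (Vx : V x) :
  Rval (Tconn n V VU m) Vx =
  Tflat (rat_stalk OX x) (stD (VU x Vx)) (stc (VU x Vx)) n (mgerm Vx m).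
Proof. by []. Qed.

Lemma hflat_iterated n x (Ux : U x) (V : opens X) (VU : V `<=` U) (Vx : V x) a :
  hflat (rat_stalk OX x) (stD Ux) (stc Ux) n.+1 (rgerm Vx a) =
  symC _ (rat_germ OX Vx n.+1%:R^-1) * Rpos_sym (Tflat (rat_stalk OX x) (stD Ux) (stc Ux) n
    (mgerm Vx (D V VU a))).
Proof.
rewrite -(stDE' Ux VU) rat_germV -hflatS; try by case: (st_connection Ux).
by rewrite ratS_mulrnK.
Qed.

Lemma hconn_iterated : iterated_hasse D hconn.
Proof.
split; [split| |].
- split=> [V VU|V VU b].
    split=> [|a b|a b]; apply: SsecP => x Vx n; rewrite hconnE.
    - rewrite -[RHS]/(Sv (Sconst F (1 : rsec OX V)) Vx n) SconstE !rgerm1; case: n => [|n]; first by [].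
      rewrite hflat_const //; try by case: (st_connection (VU x Vx)).
      have := stD_rat (VU x Vx) 1; by rewrite rmorph1.
    - rewrite rgermD hflatD //; try by case: (st_connection (VU x Vx)).
    - by rewrite rgermM hflatM //; case: (st_connection (VU x Vx)).
  apply: SsecP => x Vx n; rewrite hconnE SconstE; case: n => [|n]; first by [].
  rewrite hflat_const //; try by case: (st_connection (VU x Vx)).
  by rewrite (stDE' _ VU) D_base mgerm0.
- move=> V VU a; apply: famP => x Vx.
  by rewrite /= /Spure big_nil mulr1.
- move=> V VU a; apply: famP => x Vx /=; rewrite (hflat_iterated _ _ VU) /Spure.
  rewrite big_cons big_nil mulr1 rgerm1 symC1 mul1r Rsym_one.
  by rewrite rat_germV invr1 rmorph1 mul1r.
- exists Tconn; split; last first.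
    by move=> [//|n] V VU a x Vx _; apply: hflat_iterated.
  split=> [i|V VU m|i V VU a m x Vx i0].
  - split=> [V VU m n|V VU b m]; apply: famP => x Vx.
      rewrite [LHS]TconnE [RHS]fvalD mgermD TflatD //;
      by case: (st_connection (VU x Vx)).
    rewrite [LHS]TconnE [RHS]fvalZ RposZ mgermZ.
    rewrite TflatZ; try by case: (st_connection (VU x Vx)).
    (* D kills the sections of O_B, so their [hflat] is constant and only the term i = 0 of the
       semilinearity formula survives. *)
    rewrite big_ord_recl big1 ?addr0 ?subn0 // => j _.
    rewrite hflat_const ?scale0r //; try by case: (st_connection (VU x Vx)).
    by rewrite (stDE' _ VU) D_base mgerm0.
  - apply: famP => x Vx; rewrite -[LHS]/(Rval (Tconn 0 V VU m) Vx) TconnE /Tflat /= /Rpure /= /Spure big_nil.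
    by rewrite mulr1 rgerm1 symC1.
  rewrite !TconnE mgermZ TflatZ; try by case: (st_connection (VU x Vx)).
  rewrite big_ord_recl subn0 RposZ; congr (_ + _).
  rewrite big_add1 /= big_mkord; apply: eq_bigr => j _.
  rewrite (hflat_iterated _ _ VU) RposZ.
exact: (esym (@scalerA _ (Rmod (mstalk F x)) _ _ _)).
Qed.

End Connection.

End StalkData.

Section DiagonalMap.
Variables (X : topologicalType) (OB : QSheaf X) (OX : algSheaf OB) (F : modSheaf OX).
Variable U : opens X.
Notation Sx x := (symalg (mstalk F x)).
Variable f : forall x, U x -> nat -> mstalk F x -> Sx x.
Hypothesis f_lin : forall x (Ux : U x), linear_coefs (f Ux).
Hypothesis f_local : forall (V : opens X) (VU : V `<=` U) j m,
  locS j.+1 (fun x (Vx : V x) => f (VU x Vx) j (mgerm Vx m)).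

Lemma diag_phi_local (V : opens X) (VU : V `<=` U) (w : Ssec F V) n :
  locS n (fun x (Vx : V x) => diag (fun p => phi (f (VU x Vx)) (Sv w Vx p)) n).
Proof.
apply: (local_sum (E := Sdata F n)) => p.
have := phi_local f_lin f_local (n - p)%N VU (fvalP (w p)).
by rewrite subnKC // -ltnS.
Qed.

(** The homogeneous components of w already form a series; [phi] adds a second index for the rise in
    degree, and [diag] collects by total degree. Multiplicativity will be that of [diag]. *)
Definition diag_phi : smap U (Salg F) (Salg F).
Proof.
exists (fun V VU w => (fun n => Fam (diag_phi_local VU w n)) : Ssec F V).
move=> V W VU WV WU w; apply: SsecP => x Wx n.
apply: eq_bigr => p _; congr (phi (f _) _ _); exact: Prop_irrelevance.
Defined.

Lemma diag_phiE (V : opens X) (VU : V `<=` U) (w : Ssec F V) x (Vx : V x) n :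
  Sv (diag_phi V VU w : Ssec F V) Vx n =
  diag (fun p => phi (f (VU x Vx)) (Sv w Vx p)) n.
Proof. by []. Qed.

Lemma diag_phi_const (V : opens X) (VU : V `<=` U) (a : rsec OX V) :
  diag_phi V VU (Sconst F a) = Sconst F a.
Proof.
apply: SsecP => x Vx n; rewrite diag_phiE SconstE.
rewrite /diag big_ord_recl big1 => [|p _]; first by rewrite addr0 subn0 phiC.
by rewrite -symC0 phiC //= rmorph0.
Qed.

Lemma diag_phi_strict :
  (forall x (Ux : U x) m, f Ux 0%N m = symV m) -> strict_map diag_phi.
Proof.
move=> f0; split; first split.
- move=> V VU; split=> [|w v|w v]; first exact: (diag_phi_const VU 1).
    apply: SsecP => x Vx n; rewrite diag_phiE -[RHS]/(_ + _) -!diag_phiE.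
    rewrite /diag -big_split; apply: eq_bigr => p _.
    by rewrite phiD // seriesD.
  apply: SsecP => x Vx n.
  rewrite diag_phiE -[RHS]/((series_mul _ _) n) -[series_mul _ _]diagM.
  congr (diag _ n); apply: seriesP => p; rewrite seriesME.
  rewrite -[Sv _ _ p]/(conv _ _ p) (additive_sum _ _ (phiD (f_lin _))).
  by apply: eq_bigr => i _; rewrite phiM.
- exact: diag_phi_const.
- move=> V VU w n w0; apply: famP => x Vx.
  rewrite -[LHS]/(Sv (diag_phi V VU w : Ssec F V) Vx n) diag_phiE /diag big1 // => p _.
  have -> : Sv w Vx p = symC _ 0 by rewrite /Sv w0 // -ltnS.
  by rewrite phiC // rmorph0.
- move=> V VU m; apply: famP => x Vx.
  rewrite -[LHS]/(Sv (diag_phi V VU _ : Ssec F V) Vx 1) diag_phiE /diag.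
  rewrite big_ord_recl big_ord1 !Sv_Sinj /= -symC0 phiC // rmorph0 add0r.
  rewrite /symval /= /Spure big_cons big_nil mulr1 rgerm1 symC1 mul1r phiV //.
  exact: f0.
Qed.

End DiagonalMap.

(** * Comparison of an iterated Hasse derivation with the exponential of a flat connection *)

Section Compare.
Variables (X : topologicalType) (OB : QSheaf X) (OX : algSheaf OB) (F : modSheaf OX).
Variables (U : opens X) (D : smap U OX F).
Hypothesis D_der : is_derivation D.
Notation Sx x := (symalg (mstalk F x)).
Variables (h : smap U OX (Salg F)) (T : forall i, smap U F (Rsh F i)).
Hypothesis h_hasse : is_hasse h.
Hypothesis T_conn : is_extended_connection D T.
Hypothesis hT : forall i (V : opens X) (VU : V `<=` U) (a : rsec OX V) x (Vx : V x),
  (0 < i)%N -> symval ((h V VU a : Ssec F V) i) Vx =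
    rat_germ OX Vx i%:R^-1 *: Rpos_sym (Rval (T i.-1 V VU (D V VU a)) Vx).

Definition sth x (Ux : U x) n : rstalk OX x -> Sx x :=
  @stalk_fun X U x Ux OX _ (fun V VU Vx a => Sv (h V VU a : Ssec F V) Vx n).

Definition stt x (Ux : U x) n : mstalk F x -> Sx x :=
  @stalk_fun X U x Ux F _ (fun V VU Vx m => Rpos_sym (Rval (T n V VU m) Vx)).

Lemma sthE x (Ux : U x) n (V : opens X) (VU : V `<=` U) a (Vx : V x) :
  sth Ux n (rgerm Vx a) = Sv (h V VU a : Ssec F V) Vx n.
Proof.
apply: stalk_funE => {V VU a Vx} V W VU WU WV Vx Wx s.
have -> := sapp_res h VU WV WU s.
exact: (@fval_irr _ _ _ _ ((h V VU s : Ssec F V) n) x (WV x Wx) Vx).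
Qed.

Lemma sttE x (Ux : U x) n (V : opens X) (VU : V `<=` U) m (Vx : V x) :
  stt Ux n (mgerm Vx m) = Rpos_sym (Rval (T n V VU m) Vx).
Proof.
apply: stalk_funE => {V VU m Vx} V W VU WU WV Vx Wx s.
have -> := sapp_res (T n) VU WV WU s; congr Rpos_sym.
exact: (@fval_irr _ _ _ _ (T n V VU s : msec (Rsh F n) V) x (WV x Wx) Vx).
Qed.

Lemma stt_local (V : opens X) (VU : V `<=` U) n m :
  locS n.+1 (fun x (Vx : V x) => stt (VU x Vx) n (mgerm Vx m)).
Proof.
have := @Rpos_sym_local X OX F U n V VU _ (fvalP (T n V VU m : msec (Rsh F n) V)).
by apply: locS_ext => x Vx; rewrite (sttE _ _ VU).
Qed.

Lemma stt_add x (Ux : U x) n : {morph stt Ux n : m m' / m + m'}.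
Proof.
move=> m m'; have [V [VU [Vx [s [t [-> ->]]]]]] := mgermU2 Ux m m'.
have [TD _ _] := T_conn.
by rewrite -mgermD !(sttE Ux n VU) ((TD n).1 V VU) -Rpos_symD.
Qed.

Lemma sth0 x (Ux : U x) a : sth Ux 0 a = symC _ a.
Proof.
have [V [VU [Vx [s ->]]]] := rgermU1 Ux a.
rewrite (sthE Ux 0 VU) /Sv h_hasse.2 /symval /= /Spure big_nil.
exact: mulr1.
Qed.

Lemma sthS x (Ux : U x) n a : sth Ux n.+1 a *+ n.+1 = stt Ux n (stD D Ux a).
Proof.
have [V [VU [Vx [s ->]]]] := rgermU1 Ux a.
rewrite (sthE Ux n.+1 VU) (stDE' D Ux VU) (sttE Ux n VU) /Sv hT // rat_germV.
by rewrite symZE -mulrnAr ratS_mulrnK.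
Qed.

(** The product map applied to the Leibniz rule of an extended connection turns the coefficients
    (1/j) T_{j-1} D(a) into h_j(a), because h is iterated by this same T. Index 0 is separate, as
    that rule is imposed only in positive index. *)
Lemma stt_scale x (Ux : U x) n a m :
  stt Ux n (a *: m) = \sum_(i < n.+1) sth Ux i a * stt Ux (n - i) m.
Proof.
have [V [VU [Vx [s [t [-> ->]]]]]] := rmgermU2 Ux a m.
have [_ T0 TZ] := T_conn.
rewrite -mgermZ (sttE Ux n VU) big_ord_recl sth0 subn0 (sttE Ux n VU).
case: n => [|n].
  have R1 (u : msec F V) : Rval (Rgen u) Vx = Rone (mgerm Vx u).
    by rewrite /Rval /= /Rpure /= /Spure big_nil mulr1 rgerm1 symC1.
  by rewrite big_ord0 addr0 !T0 !R1 !Rsym_one mgermZ symVZ.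
rewrite TZ // Rpos_symD RposZ RsymZ; congr (_ + _).
rewrite (additive_sum _ _ (@Rpos_symD _ _)) big_add1 /= big_mkord.
apply: eq_bigr => j _; rewrite RposZ RsymZ [Rpos_sym (Rpos_mul _ _)]RsymZ mulrA.
rewrite (sthE Ux _ VU) (sttE Ux _ VU) /Sv hT //; congr (_ * _).
Qed.

Section Flat.
Variable gamma : smap U F (T2 F).
Hypothesis gamma_conn : is_connection D gamma.
Hypothesis gamma_flat : is_flat D gamma.

Let h0 : smap U OX (Salg F) := hconn D_der gamma_conn.

Let V0 x (Ux : U x) :=
  Vflat (rat_stalk OX x) (stD D Ux) (stc gamma Ux) (stc' gamma Ux).
Let H x (Ux : U x) := st_flat D_der gamma_conn Ux gamma_flat.
Let hc x (Ux : U x) := hflat (rat_stalk OX x) (stD D Ux) (stc gamma Ux).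

Let hc_weight x (Ux : U x) n a :
  Rpos_sym (symdelta (hc Ux n a)) = hc Ux n a *+ n.
Proof.
have [V [VU [Vx [s ->]]]] := rgermU1 Ux a.
have := hflat_local (@rat_stalk_local _ _ OX F) (stDE D) (stc_local gamma)
  (st_connection D_der gamma_conn) n VU s.
move=> /(locS_weight Vx).
by rewrite (Prop_irrelevance (VU x Vx) Ux).
Qed.

(** Continuation form: it delivers the four structural properties of [V0] at a point to whatever
    goal uses them. *)
Let spec x (Ux : U x) (P : Prop) :
  ((forall n, {morph V0 Ux n : m m' / m + m'}) ->
   (forall m, V0 Ux 0%N m = Rone m) ->
   (forall n a m, V0 Ux n (a *: m) =
      \sum_(i < n.+1) hc Ux i a *: V0 Ux (n - i)%N m) ->
   (forall n a, symdelta (hc Ux n.+1 a) = V0 Ux n (stD D Ux a)) -> P) -> P.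
Proof.
apply; case: (H Ux) => -[*].
- exact: VflatD.
- exact: Vflat0.
- exact: VflatZ.
- exact: symdelta_hflat.
Qed.

Let f x (Ux : U x) := solution (rat_stalk OX x) (V0 Ux) (stt Ux).

Let f_lin x (Ux : U x) : linear_coefs (f Ux).
Proof.
apply: (spec (Ux := Ux)) => VD V00 VZ Vh.
exact: (solution_linear (rat_stalk OX x) VD V00 VZ Vh (hflat0 _ _ _)
  (hc_weight Ux) (stt_add Ux) (stt_scale Ux) (sth0 Ux) (sthS Ux)).
Qed.

Let upto_lin x (Ux : U x) q :
  linear_coefs (solve_upto (rat_stalk OX x) (V0 Ux) (stt Ux) q).
Proof.
apply: (spec (Ux := Ux)) => VD V00 VZ Vh.
exact: (solve_upto_spec (rat_stalk OX x) VD V00 VZ Vh (hflat0 _ _ _)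
  (hc_weight Ux) (stt_add Ux) (stt_scale Ux) (sth0 Ux) (sthS Ux) q).1.
Qed.

Let V0_local (V : opens X) (VU : V `<=` U) n m :
  locR n (fun x (Vx : V x) => V0 (VU x Vx) n (mgerm Vx m)).
Proof.
exact: (Vflat_local (@rat_stalk_local _ _ OX F) (stDE D) (stc_local gamma)
  H (stc'_local gamma)).
Qed.

Let f_local (V : opens X) (VU : V `<=` U) j m :
  locS j.+1 (fun x (Vx : V x) => f (VU x Vx) j (mgerm Vx m)).
Proof.
exact: (solution_local (@rat_stalk_local _ _ OX F) V0_local stt_local upto_lin).
Qed.

Lemma flat_to_iterated : exists phi : smap U (Salg F) (Salg F), strict_map phi /\
    forall (V : opens X) (VU : V `<=` U) (a : rsec OX V),
    h V VU a = phi V VU (h0 V VU a).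
Proof.
exists (diag_phi f_lin f_local); split.
  apply: diag_phi_strict => x Ux m.
  (* The leading coefficient of the solution comes from [T 0], the identity of F; this is
     unipotency. *)
  have -> : f Ux 0 m = stt Ux 0 m.
    apply: (spec (Ux := Ux)) => VD V00 VZ Vh.
    exact: (solution0 (rat_stalk OX x) VD V00 VZ Vh (hflat0 _ _ _)
      (hc_weight Ux) (stt_add Ux) (stt_scale Ux) (sth0 Ux) (sthS Ux)).
  have [V [VU [Vx [s [_ [-> _]]]]]] := mgermU2 Ux m m.
  have [_ T0 _] := T_conn; rewrite (sttE Ux 0 VU) T0.
  by rewrite /Rval /= /Rpure /= /Spure big_nil mulr1 rgerm1 symC1 Rsym_one.
move=> V VU a; apply: SsecP => x Vx n; rewrite diag_phiE.
rewrite -(sthE (VU x Vx) n VU).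
apply: (spec (Ux := VU x Vx)) => VD V00 VZ Vh; symmetry.
exact: (phi_solution (rat_stalk OX x) VD V00 VZ Vh (hflat0 _ _ _)
  (hc_weight _) (stt_add _) (stt_scale _) (sth0 _) (sthS _)).
Qed.

End Flat.

End Compare.

Lemma integrable_strict (X : topologicalType) (OB : QSheaf X) (OX : algSheaf OB)
    (F : modSheaf OX) (U : opens X) (D : smap U OX F) :
  is_derivation D -> integrable D ->
  exists h0, iterated_hasse D h0 /\ forall h, iterated_hasse D h ->
    exists phi : smap U (Salg F) (Salg F), strict_map phi /\
    forall (V : opens X) (VU : V `<=` U) (a : rsec OX V),
        h V VU a = phi V VU (h0 V VU a).
Proof.
move=> D_der [gamma [conn flat]]; exists (hconn D_der conn).
split=> [|h [hH _ [T [T_conn hT]]]]; first exact: hconn_iterated.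
exact: (flat_to_iterated D_der hH T_conn hT conn flat).
Qed.

(** * Strict automorphisms of S(F) *)

Section AlgMaps.
Variables (X : topologicalType) (O : ringSheaf X) (U : opens X) (R S : algSheaf O).
Variable f : smap U R S.
Hypothesis f_alg : alg_map f.
Variables (V : opens X) (VU : V `<=` U).
Implicit Types s t : rsec R V.

Lemma alg_map1 : f V VU (1 : rsec R V) = (1 : rsec S V).
Proof. by have [+ _ _] := f_alg.1 V VU. Qed.

Lemma alg_mapD s t : f V VU (s + t) = f V VU s + (f V VU t : rsec S V).
Proof. by have [_ + _] := f_alg.1 V VU; apply. Qed.

Lemma alg_mapM s t : f V VU (s * t) = f V VU s * (f V VU t : rsec S V).
Proof. by have [_ _ +] := f_alg.1 V VU; apply. Qed.

Lemma alg_mapC a : f V VU (astr R V a) = astr S V a.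
Proof. exact: f_alg.2. Qed.

Lemma alg_map0 : f V VU (0 : rsec R V) = (0 : rsec S V).
Proof. by apply: (addIr (f V VU (0 : rsec R V) : rsec S V)); rewrite -alg_mapD !add0r. Qed.

Lemma alg_mapB s t : f V VU (s - t) = f V VU s - (f V VU t : rsec S V).
Proof. by apply: (addIr (f V VU t : rsec S V)); rewrite -alg_mapD !subrK. Qed.

End AlgMaps.

Lemma inj_surj_bijective (A B : Type) (f : A -> B) :
  injective f -> (forall b, exists a, f a = b) -> bijective f.
Proof.
move=> f_inj f_surj; pose g b := projT1 (cid (f_surj b)).
have fg b : f (g b) = b := projT2 (cid (f_surj b)).
by exists g => // a; apply: f_inj; rewrite fg.
Qed.

Section SmapFacts.
Variables (X : topologicalType) (U : opens X).

Lemma sapp_irr (P Q : presheaf X) (f : smap U P Q) (V : opens X) (VU VU' : V `<=` U) s :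
  f V VU s = f V VU' s.
Proof. by rewrite (Prop_irrelevance VU VU'). Qed.

Lemma smapP (P Q : presheaf X) (f g : smap U P Q) :
  (forall (V : opens X) (VU : V `<=` U) s, f V VU s = g V VU s) -> f = g.
Proof.
case: f g => [f fP] [g gP] /= fg.
have e : f = g.
  apply: functional_extensionality_dep => V; apply: functional_extensionality_dep => VU.
  exact: functional_extensionality_dep.
by case: _ / e gP {fg} => gP; congr Smap; apply: Prop_irrelevance.
Qed.

Lemma bij_smap_inv (P Q : presheaf X) (f : smap U P Q) : bij_map f ->
  exists g : smap U Q P, forall (V : opens X) (VU : V `<=` U),
    cancel (f V VU) (g V VU) /\ cancel (g V VU) (f V VU).
Proof.
move=> fb.
have ex (V : opens X) (VU : V `<=` U) : exists g : Q V -> P V,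
    cancel (f V VU) g /\ cancel g (f V VU) by case: (fb V VU) => g *; exists g.
pose g V VU := projT1 (cid (ex V VU)).
have gP V VU : cancel (f V VU) (g V VU) /\ cancel (g V VU) (f V VU).
  exact: projT2 (cid (ex V VU)).
suff g_res (V W : opens X) (VU : V `<=` U) (WV : W `<=` V) (WU : W `<=` U) s :
    g W WU (pres WV s) = pres WV (g V VU s) by exists (Smap g_res).
apply: (can_inj (gP W WU).1); rewrite (gP W WU).2 (sapp_res f VU WV WU).
by rewrite (gP V VU).2.
Qed.

End SmapFacts.

Section Strict.
Variables (X : topologicalType) (OB : QSheaf X) (OX : algSheaf OB) (F : modSheaf OX).
Variable U : opens X.

Lemma Sinj_same p (V : opens X) (s : msec (Ssh F p) V) : Sinj s p = s.
Proof.
apply: famP => x Vx; rewrite -[LHS]/(Sv (Sinj s) Vx p) Sv_Sinj eqxx.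
by [].
Qed.

Lemma Sinj_other p n (V : opens X) (s : msec (Ssh F p) V) : n != p -> Sinj s n = 0.
Proof.
move=> np; apply: famP => x Vx; rewrite -[LHS]/(Sv (Sinj s) Vx n) Sv_Sinj.
by rewrite (negPf np).
Qed.

Lemma SinjD p (V : opens X) : {morph @Sinj X OX F p V : s t / s + t}.
Proof.
move=> s t; apply: SsecP => x Vx n.
rewrite -[RHS]/(Sv _ Vx n + Sv _ Vx n) !Sv_Sinj.
by case: (n == p); rewrite ?addr0.
Qed.

Lemma Sinj0 p (V : opens X) : Sinj (0 : msec (Ssh F p) V) = 0.
Proof. by apply: (addIr (Sinj (0 : msec (Ssh F p) V))); rewrite -SinjD !add0r. Qed.

Lemma SinjZ p (V : opens X) (a : rsec OX V) (s : msec (Ssh F p) V) :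
  Sinj (a *: s) = Sconst F a * Sinj s.
Proof.
apply: SsecP => x Vx n; rewrite -[RHS]/(Sv (Smul _ _) Vx n) SmulE SconstE.
rewrite conv_constl !Sv_Sinj; case: (n == p); rewrite ?mulr0 //.
Qed.

Lemma Sinj_res p (V W : opens X) (WV : W `<=` V) (s : msec (Ssh F p) V) :
  Sres WV (Sinj s) = Sinj (mres (Ssh F p) WV s).
Proof. by apply: SsecP => x Wx n; rewrite SresE !Sv_Sinj. Qed.

Lemma Ssec_eq0 (V : opens X) (w : Ssec F V) : (forall p, w p = 0) -> w = 0.
Proof. by move=> w0; apply: functional_extensionality_dep. Qed.

Lemma SmulC0 (V : opens X) (a : rsec OX V) (w : Ssec F V) n :
  (Sconst F a * w : Ssec F V) n = a *: w n.
Proof.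
apply: famP => x Vx; rewrite -[LHS]/(Sv (Smul _ _) Vx n) SmulE SconstE.
by rewrite conv_constl.
Qed.

Lemma Sgen_add (V : opens X) : {morph @Sgen X OX F V : m n / m + n}.
Proof.
move=> m n; apply: famP => x Vx.
by rewrite /= /Spure /= !big_cons !big_nil !mulr1 mgermD symVD mulrDr.
Qed.

Lemma Sgen_scale (V : opens X) a (m : msec F V) : Sgen (a *: m) = a *: Sgen m.
Proof.
apply: famP => x Vx.
rewrite /= /Spure /= !big_cons !big_nil !mulr1 mgermZ symVZ rgerm1 symC1 !mul1r.
by rewrite symZE.
Qed.

Lemma Sgen_res (V W : opens X) (WV : W `<=` V) (m : msec F V) :
  mres (Ssh F 1) WV (Sgen m) = Sgen (mres F WV m).
Proof.
apply: famP => x Wx; rewrite /= /Spure /= !big_cons !big_nil !rgerm1.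
by rewrite (mgerm_res WV Wx (WV x Wx)).
Qed.

(* Homogeneous sections of S(F) are locally sums of products of sections of F. *)
Lemma Sinj_ind (Q : nat -> forall V : opens X, V `<=` U -> Ssec F V -> Prop) :
  (forall (V : opens X) (VU : V `<=` U) a, Q 0%N V VU (Sconst F a)) ->
  (forall n (V : opens X) (VU : V `<=` U) m w, (forall p, p != n -> w p = 0) ->
     Q n V VU w -> Q n.+1 V VU (Sinj (Sgen m) * w)) ->
  (forall n (V : opens X) (VU : V `<=` U), Q n V VU 0) ->
  (forall n (V : opens X) (VU : V `<=` U) w w',
     Q n V VU w -> Q n V VU w' -> Q n V VU (w + w')) ->
  (forall n (V : opens X) (VU : V `<=` U) w,
     (forall x, V x -> exists (W : opens X) (WV : W `<=` V), W x /\
        Q n W (subset_trans WV VU) (Sres WV w)) -> Q n V VU w) ->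
  forall n (V : opens X) (VU : V `<=` U) (s : msec (Ssh F n) V), Q n V VU (Sinj s).
Proof.
move=> Q0 QS Qz QD Qloc n V VU s; apply: Qloc => x Vx.
have [W [WV [l [Wx sl]]]] := fvalP s Vx; exists W, WV; split=> //.
have -> : Sres WV (Sinj s) = \sum_(g <- l) Sinj (fam_pure g : msec (Ssh F n) W).
  apply: SsecP => y Wy k; rewrite Sinj_res Sv_Sinj.
  have -> : Sv (\sum_(g <- l) Sinj (fam_pure g : msec (Ssh F n) W)) Wy k =
      \sum_(g <- l) Sv (Sinj (fam_pure g : msec (Ssh F n) W)) Wy k.
    by apply: (big_morph (fun w : Ssec F W => Sv w Wy k)).
  case: (eqVneq k n) => [->|kn].
    rewrite [LHS](sl y Wy); apply: eq_bigr => g _.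
    by rewrite Sv_Sinj eqxx.
  by rewrite big1 // => g _; rewrite Sv_Sinj (negPf kn).
have WU := subset_trans WV VU; rewrite (Prop_irrelevance (subset_trans WV VU) WU).
apply: (big_ind (Q n W WU)) => [||g _]; [exact: Qz|exact: QD|].
case: g => a [t tn]; elim: n t tn {s sl l} => [|n IHn] t tn.
  suff -> : Sinj (fam_pure (E := Sdata F 0) (a, Tuple tn)) = Sconst F a by apply: Q0.
  apply: SsecP => y Wy k; rewrite Sv_Sinj SconstE; case: k => //=.
  by case: t tn => // tn; rewrite /symval /= /Spure big_nil mulr1.
case: t tn => // m t tn.
have -> : Sinj (fam_pure (E := Sdata F n.+1) (a, Tuple tn)) =
    Sinj (Sgen m) * Sinj (fam_pure (E := Sdata F n) (a, Tuple (tn : size t == n))).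
  apply: SsecP => y Wy k; rewrite -[RHS]/(Sv (Smul _ _) Wy k) SmulE Sv_Sinj.
  case: k => [|k]; first by rewrite /conv big_ord1 !Sv_Sinj mul0r.
  rewrite /conv big_ord_recl Sv_Sinj mul0r add0r big_ord_recl /= !Sv_Sinj subn1 /=.
  rewrite big1 ?addr0 => [|i _]; last by rewrite Sv_Sinj mul0r.
  rewrite eqSS; case: (k == n); rewrite ?mulr0 //.
  rewrite /symval /= /Spure /= !big_cons big_nil mulr1 rgerm1 symC1 mul1r.
  by rewrite mulrCA.
apply: QS; last exact: IHn.
by move=> p pn; apply: Sinj_other.
Qed.

Section One.
Variable phi : smap U (Salg F) (Salg F).
Hypothesis phi_strict : strict_map phi.

Let phi_alg : alg_map phi. Proof. by case: phi_strict. Qed.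

Lemma strict_low (V : opens X) (VU : V `<=` U) (w : Ssec F V) n :
  (forall p, (p <= n)%N -> w p = 0) -> (phi V VU w : Ssec F V) n = 0.
Proof. by case: phi_strict => _ + _; apply. Qed.

Lemma strict_congr (V : opens X) (VU : V `<=` U) (w w' : Ssec F V) n :
  (forall p, (p <= n)%N -> w p = w' p) ->
  (phi V VU w : Ssec F V) n = (phi V VU w' : Ssec F V) n.
Proof.
move=> ww'; apply/eqP; rewrite -subr_eq0; apply/eqP.
rewrite -[LHS]/((phi V VU w - phi V VU w' : Ssec F V) n).
have -> := esym (alg_mapB phi_alg VU w w').
by apply: strict_low => p pn; rewrite -[LHS]/(w p - w' p) ww' // subrr.
Qed.

(** On a product of n sections of F the image starts in degree n, and its component there is the
    product of the degree 1 components, which unipotency fixes. [Sinj_ind] reduces everything to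
    such products. *)
Lemma strict_homogeneous n (V : opens X) (VU : V `<=` U) (s : msec (Ssh F n) V) :
  (phi V VU (Sinj s) : Ssec F V) n = s.
Proof.
rewrite -[RHS]Sinj_same; move: n V VU s.
apply: (Sinj_ind (Q := fun n V VU w => (phi V VU w : Ssec F V) n = w n)).
- by move=> V VU a; rewrite -[Sconst F a]/(astr (Salg F) V a) (alg_mapC phi_alg).
- move=> n V VU m w w0 IH.
  rewrite (alg_mapM phi_alg); apply: famP => x Vx.
  rewrite -[LHS]/(Sv (Smul _ _) Vx n.+1) -[RHS]/(Sv (Smul _ _) Vx n.+1) !SmulE.
  (* In degree n.+1 only i = 1 survives: the image of the factor from F starts in degree 1, that of
     w in degree n. *)
  rewrite /conv !big_ord_recl !Sv_Sinj mul0r.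
  rewrite {1}/Sv strict_low ?mul0r => [|p]; last first.
    by rewrite leqn0 => /eqP->; rewrite Sinj_other.
  rewrite !add0r /= /bump /= subn1 /=; congr (_ + _).
    have [_ _ unip] := phi_strict; rewrite addn0 [Sv w Vx n]/Sv -IH; congr (_ * _).
    by rewrite /Sv unip.
  rewrite !big1 // => i _; rewrite ?Sv_Sinj ?mul0r //=.
  rewrite [X in _ * X]/Sv strict_low ?mulr0 // => p pn; apply: w0.
  apply: contraTneq pn => ->; rewrite -ltnNge /= !add1n subSS.
  by rewrite ltn_subrL andTb; apply: leq_ltn_trans (ltn_ord i).
- by move=> n V VU; rewrite (alg_map0 phi_alg).
- move=> n V VU w w' IH IH'; rewrite (alg_mapD phi_alg).
  by rewrite -[LHS]/((phi V VU w : Ssec F V) n + (phi V VU w' : Ssec F V) n) IH IH'.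
- move=> n V VU w H; apply: famP => x Vx; have [W [WV [Wx]]] := H x Vx.
  rewrite (sapp_res phi VU WV) => /(congr1 (fun s => fval s Wx)).
  rewrite -[LHS]/(fval ((phi V VU w : Ssec F V) n) (WV x Wx)) => e.
  by rewrite !(fval_irr _ Vx (WV x Wx)).
Qed.

Lemma strict_lead (V : opens X) (VU : V `<=` U) (w : Ssec F V) n :
  (forall p, (p < n)%N -> w p = 0) -> (phi V VU w : Ssec F V) n = w n.
Proof.
move=> w0; rewrite -[RHS](strict_homogeneous VU); apply: strict_congr => p.
rewrite leq_eqVlt => /orP[/eqP->|pn]; first by rewrite Sinj_same.
by rewrite Sinj_other ?w0 // ltn_eqF.
Qed.

Lemma strict_lead_inv (V : opens X) (VU : V `<=` U) (w : Ssec F V) n :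
  (forall p, (p < n)%N -> (phi V VU w : Ssec F V) p = 0) ->
  forall p, (p < n)%N -> w p = 0.
Proof.
move=> pw p; elim: p {-2}p (leqnn p) => [|k IHk] p pk pn.
  move: pk; rewrite leqn0 => /eqP p0.
  by rewrite -(strict_lead VU) ?pw // => q; rewrite p0.
rewrite -(strict_lead VU) ?pw // => q qp; apply: IHk; last exact: ltn_trans pn.
by rewrite -ltnS; apply: leq_trans pk.
Qed.

Lemma strict_sum (V : opens X) (VU : V `<=` U) (w : Ssec F V) n :
  (phi V VU w : Ssec F V) n = \sum_(p < n.+1) (phi V VU (Sinj (w p)) : Ssec F V) n.
Proof.
transitivity ((phi V VU (\sum_(p < n.+1) Sinj (w p)) : Ssec F V) n).
  apply: strict_congr => p pn; apply: famP => y Vy.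
  have -> : fval ((\sum_(p < n.+1) Sinj (w p) : Ssec F V) p) Vy =
      \sum_(i < n.+1) Sv (Sinj (w i)) Vy p.
    by apply: (big_morph (fun w : Ssec F V => Sv w Vy p)).
  rewrite (bigD1 (inord p)) //= big1 ?addr0 => [|i ip].
    by rewrite Sv_Sinj inordK ?eqxx.
  by rewrite Sv_Sinj; case: (eqVneq p i) ip => [->|//]; rewrite inord_val eqxx.
have -> : phi V VU (\sum_(p < n.+1) Sinj (w p)) =
    (\sum_(p < n.+1) phi V VU (Sinj (w p)) : Ssec F V).
  apply: (big_morph (phi V VU)); first exact: (alg_mapD phi_alg).
  exact: (alg_map0 phi_alg).
by apply: (big_morph (fun w : Ssec F V => w n)).
Qed.

(** By [strict_lead], phi minus the identity strictly raises the lowest degree. Injectivity is read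
    off the lowest component. For surjectivity, each correction of v by w - phi(v) pushes the error
    up by a degree, and the direct product S(F) contains the limit. *)
Lemma strict_bij : bij_map phi.
Proof.
move=> V VU; apply: inj_surj_bijective => [w w' ww'|w].
  apply/eqP; rewrite -subr_eq0; apply/eqP/Ssec_eq0 => p.
  apply: (@strict_lead_inv V VU _ p.+1) => // q _.
  by rewrite (alg_mapB phi_alg) ww' subrr.
pose v k := iter k (fun v : Ssec F V => v + (w - phi V VU v)) 0.
have vE k p : (p < k)%N -> (w - phi V VU (v k) : Ssec F V) p = 0.
  elim: k p => // k IHk p pk.
  have -> : w - phi V VU (v k.+1) =
      (w - phi V VU (v k)) - (phi V VU (w - phi V VU (v k)) : Ssec F V).
    by rewrite -addrA -opprD -(alg_mapD phi_alg).
  move: (w - phi V VU (v k)) IHk => E IHk.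
  rewrite -[LHS]/(E p - (phi V VU E : Ssec F V) p).
  by rewrite strict_lead ?subrr // => q qp; apply: IHk; apply: leq_trans qp _.
have v_stable p k : (p < k)%N -> v k p = v p.+1 p.
  elim: k => // k IHk; rewrite ltnS leq_eqVlt => /orP[/eqP->//|pk].
  rewrite -IHk // -[LHS]/(v k p + (w - phi V VU (v k) : Ssec F V) p).
  by rewrite vE // addr0.
(* Degree n of the approximations is stationary from index n.+1 on. *)
exists (fun n => v n.+1 n); apply: functional_extensionality_dep => n.
have -> : (phi V VU (fun n => v n.+1 n) : Ssec F V) n = (phi V VU (v n.+1) : Ssec F V) n.
  by apply: strict_congr => p pn; rewrite v_stable.
by apply/esym/subr0_eq; apply: (vE n.+1 n).
Qed.

End One.

Lemma strict_inv (phi g : smap U (Salg F) (Salg F)) : strict_map phi ->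
  (forall (V : opens X) (VU : V `<=` U),
    cancel (phi V VU) (g V VU) /\ cancel (g V VU) (phi V VU)) ->
  strict_map g.
Proof.
move=> phi_strict gK; have [phi_alg phi_low phi_unip] := phi_strict.
have low (V : opens X) (VU : V `<=` U) (w : Ssec F V) n :
    (forall p, (p < n)%N -> w p = 0) ->
    forall p, (p < n)%N -> (g V VU w : Ssec F V) p = 0.
  move=> w0 p pn; apply: (strict_lead_inv phi_strict (VU := VU) _ pn) => q qn.
  by rewrite (gK V VU).2 w0.
split; first split.
- move=> V VU; split=> [|s t|s t]; apply: (can_inj (gK V VU).1).
  + by rewrite (gK V VU).2 (alg_map1 phi_alg).
  + by rewrite (gK V VU).2 (alg_mapD phi_alg) !(gK V VU).2.
  + by rewrite (gK V VU).2 (alg_mapM phi_alg) !(gK V VU).2.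
- by move=> V VU a; apply: (can_inj (gK V VU).1); rewrite (gK V VU).2 (alg_mapC phi_alg).
- by move=> V VU w n w0; apply: (low V VU w n.+1).
- move=> V VU m; rewrite -(strict_lead phi_strict VU) => [|p].
    by rewrite (gK V VU).2 Sinj_same.
  rewrite ltnS leqn0 => /eqP->; apply: (low V VU _ 1%N) => // q.
  by rewrite ltnS leqn0 => /eqP->; rewrite Sinj_other.
Qed.

Lemma strict_comp (phi psi : smap U (Salg F) (Salg F)) :
  strict_map phi -> strict_map psi -> strict_map (scomp phi psi).
Proof.
move=> phi_strict psi_strict; have [phi_alg phi_low phi_unip] := phi_strict.
have [psi_alg psi_low psi_unip] := psi_strict.
split; first split.
- move=> V VU; split=> [|s t|s t] /=.
  + by rewrite (alg_map1 psi_alg) (alg_map1 phi_alg).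
  + by rewrite (alg_mapD psi_alg) (alg_mapD phi_alg).
  + by rewrite (alg_mapM psi_alg) (alg_mapM phi_alg).
- by move=> V VU a /=; rewrite (alg_mapC psi_alg) (alg_mapC phi_alg).
- move=> V VU w n w0; apply: phi_low => p pn; apply: psi_low => q qp.
  by apply: w0; apply: leq_trans pn.
- move=> V VU m /=; rewrite (strict_lead phi_strict) ?psi_unip // => p.
  rewrite ltnS leqn0 => /eqP->; apply: psi_low => q; rewrite leqn0 => /eqP->.
  by rewrite Sinj_other.
Qed.

Section Equivalence.
Variables h h' : smap U OX (Salg F).

Lemma strict_equivalence (phi : smap U (Salg F) (Salg F)) : strict_map phi ->
  (forall (V : opens X) (VU : V `<=` U) (a : rsec OX V),
     h' V VU a = phi V VU (h V VU a)) ->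
  is_equivalence h h' phi.
Proof.
move=> phi_strict hh'; have [phi_alg phi_low phi_unip] := phi_strict.
split=> //; first by split=> //; apply: strict_bij.
have part_res p q (V W : opens X) (VU : V `<=` U) (WV : W `<=` V) (WU : W `<=` U) s :
    (phi W WU (Sinj (mres (Ssh F p) WV s)) : Ssec F W) (p + q)%N =
    mres (Ssh F (p + q)%N) WV ((phi V VU (Sinj s) : Ssec F V) (p + q)%N).
  by rewrite -Sinj_res (sapp_res phi VU WV WU).
exists (fun p q => @Smap X U (Ssh F p) (Ssh F (p + q)%N)
  (fun V VU s => (phi V VU (Sinj s) : Ssec F V) (p + q)%N) (part_res p q)); split; last by move=> V VU m; apply: phi_unip.
split=> [p q|n V VU w x Vx].
  split=> [V VU s t|V VU a s] /=.
    by rewrite SinjD (alg_mapD phi_alg).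
  rewrite SinjZ (alg_mapM phi_alg) -[Sconst F a]/(astr (Salg F) V a).
  by rewrite (alg_mapC phi_alg) SmulC0.
rewrite (strict_sum phi_strict VU).
have -> : symval (\sum_(p < n.+1) (phi V VU (Sinj (w p)) : Ssec F V) n) Vx =
    \sum_(p < n.+1) Sv (phi V VU (Sinj (w p)) : Ssec F V) Vx n.
  by apply: (big_morph (fun w : msec (Ssh F n) V => symval w Vx)).
apply: eq_bigr => p _; rewrite -[RHS]/(Sv (phi V VU (Sinj (w p)) : Ssec F V) Vx (p + (n - p))%N).
by rewrite subnKC // -ltnS.
Qed.

Lemma equivalence_strict (phi : smap U (Salg F) (Salg F)) :
  is_equivalence h h' phi -> strict_map phi.
Proof.
case=> -[phi_alg _] _ [phiq [[phiq_lin phiE] phiq1]].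
have phiq0 p q (V : opens X) (VU : V `<=` U) :
    phiq p q V VU (0 : msec (Ssh F p) V) = (0 : msec (Ssh F (p + q)) V).
  have [+ _] := phiq_lin p q => /(_ V VU 0 0); rewrite addr0 => e.
  by apply: (addIr (phiq p q V VU (0 : msec (Ssh F p) V) : msec (Ssh F (p + q)) V));
    rewrite -e add0r.
split=> // [V VU w n w0|V VU m]; apply: famP => x Vx; rewrite [LHS]phiE.
  by rewrite big1 // => p _; rewrite w0 ?phiq0 // -ltnS.
rewrite big_ord_recl big_ord1 Sinj_other // phiq0 [X in X + _]/(0 : symalg _) add0r.
by rewrite /= Sinj_same phiq1.
Qed.

End Equivalence.

Section Uniqueness.
Variables (D : smap U OX F) (h : smap U OX (Salg F)).
Hypothesis rigid : forall f : smap U F (amod (Salg F)), linear_map f ->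
  (forall (V : opens X) (VU : V `<=` U) (a : rsec OX V),
     f V VU (D V VU a) = (0 : msec (amod (Salg F)) V)) ->
  forall (V : opens X) (VU : V `<=` U) (m : msec F V),
    f V VU m = (0 : msec (amod (Salg F)) V).
Hypothesis h_hasse : is_hasse h.
Hypothesis h_ext : hasse_extends D h.
Variables phi psi : smap U (Salg F) (Salg F).
Hypotheses (phi_strict : strict_map phi) (psi_strict : strict_map psi).
Hypothesis phi_psi : forall (V : opens X) (VU : V `<=` U) (a : rsec OX V),
  phi V VU (h V VU a) = psi V VU (h V VU a).

Let phi_alg : alg_map phi. Proof. by case: phi_strict. Qed.
Let psi_alg : alg_map psi. Proof. by case: psi_strict. Qed.

Let agree (V : opens X) (VU : V `<=` U) (w : Ssec F V) j : Prop :=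
  (phi V VU w : Ssec F V) j = (psi V VU w : Ssec F V) j.

Let agree_gen q := forall (V : opens X) (VU : V `<=` U) (m : msec F V) j,
  (j <= q)%N -> agree VU (Sinj (Sgen m)) j.

Let low0 (chi : smap U (Salg F) (Salg F)) (V : opens X) (VU : V `<=` U) (w : Ssec F V) :
  strict_map chi -> w 0%N = 0 -> (chi V VU w : Ssec F V) 0%N = 0.
Proof. by move=> s w0; apply: strict_low => // p; rewrite leqn0 => /eqP->. Qed.

Let agree_local (V : opens X) (VU : V `<=` U) (w : Ssec F V) j :
  (forall x, V x -> exists (W : opens X) (WV : W `<=` V), W x /\
     agree (subset_trans WV VU) (Sres WV w) j) -> agree VU w j.
Proof.
move=> H; apply: famP => x Vx; have [W [WV [Wx]]] := H x Vx.
rewrite /agree (sapp_res phi VU WV) (sapp_res psi VU WV).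
move=> /(congr1 (fun s => fval s Wx)).
rewrite -[LHS]/(fval ((phi V VU w : Ssec F V) j) (WV x Wx)).
rewrite -[RHS]/(fval ((psi V VU w : Ssec F V) j) (WV x Wx)) => e.
by rewrite !(fval_irr _ Vx (WV x Wx)).
Qed.

Let agree_add (V : opens X) (VU : V `<=` U) (w w' : Ssec F V) j :
  agree VU w j -> agree VU w' j -> agree VU (w + w') j.
Proof.
rewrite /agree (alg_mapD phi_alg) (alg_mapD psi_alg) => e e'.
rewrite -[LHS]/((phi V VU w : Ssec F V) j + (phi V VU w' : Ssec F V) j).
by rewrite e e'.
Qed.

Let agree_const (V : opens X) (VU : V `<=` U) a j : agree VU (Sconst F a) j.
Proof.
rewrite /agree -[Sconst F a]/(astr (Salg F) V a).
by rewrite (alg_mapC phi_alg) (alg_mapC psi_alg).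
Qed.

(** In the boundary terms i = 0 and i = j one factor appears in the full degree j, where agreement
    may not be known yet; such a term vanishes when the other factor has no component of degree
    0. *)
Let agree_mul (V : opens X) (VU : V `<=` U) (u w : Ssec F V) j :
  (forall i, (i <= j)%N -> [\/ agree VU u i /\ agree VU w (j - i)%N,
     i = 0%N /\ u 0%N = 0 | i = j /\ w 0%N = 0]) ->
  agree VU (u * w) j.
Proof.
move=> H; rewrite /agree (alg_mapM phi_alg) (alg_mapM psi_alg).
apply: famP => x Vx; rewrite -[LHS]/(Sv (Smul _ _) Vx j) -[RHS]/(Sv (Smul _ _) Vx j).
rewrite !SmulE; apply: eq_bigr => i _; rewrite /Sv.
have ij : (i <= j)%N by rewrite -ltnS.
have [[-> ->] //|[-> u0]|[-> w0]] := H i ij.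
  by rewrite !low0 // !mul0r.
by rewrite subnn !low0 // !mulr0.
Qed.

(* Agreement up to degree q on F gives agreement up to degree q + 1 on products
   of at least two sections of F, as these vanish in degree 0. *)
Let agree_Sinj q : agree_gen q -> forall n (V : opens X) (VU : V `<=` U)
    (s : msec (Ssh F n) V),
  (forall j, (j <= q)%N -> agree VU (Sinj s) j) /\
  ((1 < n)%N -> agree VU (Sinj s) q.+1).
Proof.
move=> agq n V VU s.
apply: (Sinj_ind (Q := fun n V VU w => (forall j, (j <= q)%N -> agree VU w j) /\
  ((1 < n)%N -> agree VU w q.+1))) => {n V VU s}.
- by move=> V VU a; split=> // *; apply: agree_const.
- move=> n V VU m w w0 [IH _]; split=> [j jq|].
    apply: agree_mul => i ij; constructor 1; split.
      by apply: agq; apply: leq_trans jq.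
    by apply: IH; apply: leq_trans jq; apply: leq_subr.
  rewrite ltnS => n0; apply: agree_mul => -[|i].
    by move=> _; constructor 2; rewrite Sinj_other.
  rewrite ltnS leq_eqVlt => /orP[/eqP->|iq].
    by constructor 3; rewrite w0 // eq_sym -lt0n.
  constructor 1; split; first by apply: agq.
  by apply: IH; rewrite subSS leq_subr.
- move=> n V VU; suff H j : agree VU 0 j by split=> *; apply: H.
  by rewrite /agree (alg_map0 phi_alg) (alg_map0 psi_alg).
- move=> n V VU w w' [IH1 IH2] [IH1' IH2']; split=> [j jq|n1]; apply: agree_add;
    by [apply: IH1|apply: IH1'|apply: IH2|apply: IH2'].
- move=> n V VU w H; split=> [j jq|n1]; apply: agree_local => x Vx;
    have [W [WV [Wx [H1 H2]]]] := H x Vx; exists W, WV; split=> //;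
    by [apply: H1|apply: H2].
Qed.

(** The difference in a single degree is put back into S(F), to give a map of the kind [rigid]
    speaks about. *)
Definition strict_diff (q : nat) : smap U F (amod (Salg F)).
Proof.
exists (fun V VU m => Sinj ((phi V VU (Sinj (Sgen m)) : Ssec F V) q -
  (psi V VU (Sinj (Sgen m)) : Ssec F V) q)).
move=> V W VU WV WU m; rewrite [RHS]Sinj_res; congr Sinj.
rewrite raddfB -[pres WV m]/(mres F WV m) -Sgen_res -Sinj_res.
by rewrite (sapp_res phi VU WV WU) (sapp_res psi VU WV WU).
Defined.

Let diff_linear q : linear_map (strict_diff q).
Proof.
split=> [V VU m n|V VU a m] /=.
  rewrite -[RHS]/((_ : Ssec F V) + (_ : Ssec F V)) -SinjD; congr Sinj.
  rewrite Sgen_add SinjD (alg_mapD phi_alg) (alg_mapD psi_alg).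
  rewrite -[LHS]/(_ + _ - (_ + _)) opprD addrACA.
  by [].
rewrite -[RHS]/(Sconst F a * (_ : Ssec F V)) -SinjZ; congr Sinj; rewrite Sgen_scale SinjZ.
rewrite (alg_mapM phi_alg) (alg_mapM psi_alg) -[Sconst F a]/(astr (Salg F) V a).
rewrite (alg_mapC phi_alg) (alg_mapC psi_alg).
by rewrite !SmulC0 scalerBr.
Qed.

(** Degrees 0 and 1 hold by filtration and unipotency. In degree q.+2 both maps agree on h(a), on
    its constant part, and on its parts of degree at least 2; hence they agree on its degree 1 part
    D(a), and rigidity extends this to all of F. *)
Let agree_all q : agree_gen q.
Proof.
elim: q => [|[|q] IHq] V VU m j; rewrite leq_eqVlt => /orP[/eqP->|jq];
  do ?[by []|by apply: IHq].
- by rewrite /agree !low0 // Sinj_other.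
- by rewrite /agree; case: phi_strict psi_strict => _ _ -> [_ _ ->].
have Dzero (W : opens X) (WU : W `<=` U) (a : rsec OX W) :
    strict_diff q.+2 W WU (D W WU a) = (0 : msec (amod (Salg F)) W).
  rewrite /= -[RHS]/(0 : Ssec F W) -[RHS](Sinj0 q.+2); congr Sinj.
  have := congr1 (fun s : Ssec F W => s q.+2) (phi_psi WU a).
  rewrite /= (strict_sum phi_strict) (strict_sum psi_strict).
  rewrite [X in X = _ -> _]big_ord_recl [X in _ + X = _ -> _]big_ord_recl.
  rewrite [X in _ = X -> _]big_ord_recl [X in _ = _ + X -> _]big_ord_recl.
  rewrite h_hasse.2.
  have -> : Sinj (Scst F a) = Sconst F a.
    apply: SsecP => x Wx k; rewrite Sv_Sinj SconstE; case: k => //=.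
    by rewrite /symval /= /Spure big_nil mulr1.
  rewrite [X in X + _ = _](agree_const WU a q.+2) => /addrI.
  (* The components of h(a) of degree at least 2 are where [agree_Sinj] gains a degree, reaching
     q.+2 from agreement up to q.+1. *)
  have e1 (i : 'I_q.+1) : agree WU
      (Sinj ((h W WU a : Ssec F W) (lift ord0 (lift ord0 i)))) q.+2.
    by have [_] := agree_Sinj IHq WU
      ((h W WU a : Ssec F W) (lift ord0 (lift ord0 i))); apply.
  rewrite [X in _ + X = _ -> _](eq_bigr _ (fun i _ => e1 i)) => /addIr.
  by rewrite /= /bump /= h_ext => ->; rewrite subrr.
have := rigid (diff_linear q.+2) Dzero VU m.
move=> /(congr1 (fun s : Ssec F V => s q.+2)); rewrite /= Sinj_same.
exact: subr0_eq.
Qed.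

Lemma strict_unique : phi = psi.
Proof.
apply: smapP => V VU w; apply: functional_extensionality_dep => n.
rewrite (strict_sum phi_strict) (strict_sum psi_strict).
by apply: eq_bigr => p _; have [+ _] := agree_Sinj (@agree_all n) VU (w p); apply.
Qed.

End Uniqueness.

End Strict.

(** * Gluing *)

Record atlas (X : topologicalType) := Atlas {
  chart : opens X -> Type;
  chres : forall U V : opens X, V `<=` U -> chart U -> chart V;
  chres_id : forall (U : opens X) (UU : U `<=` U) h, chres UU h = h;
  chres_comp : forall (U V W : opens X) (VU : V `<=` U) (WV : W `<=` V)
    (WU : W `<=` U) h, chres WV (chres VU h) = chres WU h;
  ch_cover : forall x, exists U : opens X, U x /\ exists h : chart U, True }.

(** Transitions relate charts on the same open set; charts on different open sets are compared after
    [chres]. *)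
Record descent (X : topologicalType) (O : ringSheaf X) (T : atlas X) (B : algSheaf O) :=
  Descent {
  trans : forall U, chart T U -> chart T U -> smap U B B;
  trans_alg : forall U (h h' : chart T U), alg_map (trans h h');
  trans_id : forall U (h : chart T U) (V : opens X) (VU : V `<=` U) s,
    trans h h V VU s = s;
  trans_comp : forall U (h h' h'' : chart T U) (V : opens X) (VU : V `<=` U) s,
    trans h' h'' V VU (trans h h' V VU s) = trans h h'' V VU s;
  trans_res : forall (U V : opens X) (VU : V `<=` U) (h h' : chart T U) (W : opens X)
    (WV : W `<=` V) (WU : W `<=` U) s,
    trans (chres VU h) (chres VU h') W WV s = trans h h' W WU s }.

Section Glue.
Variables (X : topologicalType) (O : ringSheaf X) (T : atlas X) (B : algSheaf O).
Variable G : descent T B.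

(** A glued section over V will be the family of its expressions in all charts on open subsets of V.
    Using every chart avoids the choice of a cover and makes restriction a mere reindexing. *)
Record local_chart (V : opens X) := LocalChart {
  cdom : opens X;
  csub : cdom `<=` V;
  cind : chart T cdom }.
Arguments csub [V] l t _.

Lemma local_chart_cover (V : opens X) x : V x -> exists c : local_chart V, cdom c x.
Proof.
move=> Vx; have [U [Ux [h _]]] := ch_cover T x.
by exists (LocalChart (@interOr _ U V) (chres (@interOl _ U V) h)).
Qed.

Definition tr W (h h' : chart T W) : rsec B W -> rsec B W :=
  trans G h h' W (@subset_refl _ _).

Lemma tr0 W (h h' : chart T W) : tr h h' 0 = 0.
Proof. exact: (alg_map0 (trans_alg G h h')). Qed.
Lemma tr1 W (h h' : chart T W) : tr h h' 1 = 1.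
Proof. exact: (alg_map1 (trans_alg G h h')). Qed.
Lemma trD W (h h' : chart T W) : {morph tr h h' : s t / s + t}.
Proof. exact: (alg_mapD (trans_alg G h h')). Qed.
Lemma trM W (h h' : chart T W) : {morph tr h h' : s t / s * t}.
Proof. exact: (alg_mapM (trans_alg G h h')). Qed.
Lemma trN W (h h' : chart T W) : {morph tr h h' : s / - s}.
Proof. by move=> s; apply: (addIr (tr h h' s)); rewrite -trD !addNr tr0. Qed.
Lemma trC W (h h' : chart T W) a : tr h h' (astr B W a) = astr B W a.
Proof. exact: (alg_mapC (trans_alg G h h')). Qed.

Lemma tr_res (U V : opens X) (VU : V `<=` U) (h h' : chart T U) s :
  tr (chres VU h) (chres VU h') (rres B VU s) = rres B VU (tr h h' s).
Proof.
rewrite /tr (trans_res G VU h h' (@subset_refl _ _) VU).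
exact: (sapp_res (trans G h h') (@subset_refl _ _) VU VU s).
Qed.

Section Sections.
Variable V : opens X.

Definition compatible (s : forall c : local_chart V, rsec B (cdom c)) : Prop :=
  forall (c c' : local_chart V) (cc : cdom c' `<=` cdom c),
    s c' = tr (chres cc (cind c)) (cind c') (rres B cc (s c)).

Record gsec := Gsec { gv :> forall c : local_chart V, rsec B (cdom c);
                      gvP : compatible gv }.

HB.instance Definition _ := gen_eqMixin gsec.
HB.instance Definition _ := gen_choiceMixin gsec.

Lemma gsecP (s t : gsec) : (forall c, s c = t c) -> s = t.
Proof.
case: s t => [s sP] [t tP] /= st.
have e : s = t by apply: functional_extensionality_dep.
by case: _ / e tP {st} => tP; congr Gsec; apply: Prop_irrelevance.
Qed.

Lemma gvE (s : gsec) (c c' : local_chart V) (cc : cdom c' `<=` cdom c) :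
  s c' = tr (chres cc (cind c)) (cind c') (rres B cc (s c)).
Proof. exact: gvP. Qed.

Lemma g0P : compatible (fun c => 0).
Proof. by move=> c c' cc; rewrite rmorph0 tr0. Qed.
Lemma g1P : compatible (fun c => 1).
Proof. by move=> c c' cc; rewrite rmorph1 tr1. Qed.
Lemma gaddP (s t : gsec) : compatible (fun c => s c + t c).
Proof. by move=> c c' cc; rewrite rmorphD trD -!gvE. Qed.
Lemma gmulP (s t : gsec) : compatible (fun c => s c * t c).
Proof. by move=> c c' cc; rewrite rmorphM trM -!gvE. Qed.
Lemma goppP (s : gsec) : compatible (fun c => - s c).
Proof. by move=> c c' cc; rewrite rmorphN trN -gvE. Qed.
Lemma gstrP (a : rsec O V) : compatible (fun c => astr B _ (rres O (csub c) a)).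
Proof.
move=> c c' cc; rewrite -astr_res (rres_comp _ cc (subset_trans cc (csub c))) trC.
by congr (astr _ _ (rres _ _ _)); apply: Prop_irrelevance.
Qed.

Definition gzero := Gsec g0P.
Definition gone := Gsec g1P.
Definition gadd s t := Gsec (gaddP s t).
Definition gmul s t := Gsec (gmulP s t).
Definition gopp s := Gsec (goppP s).
Definition gstr a := Gsec (gstrP a).

Lemma gaddA : associative gadd.
Proof. by move=> s t u; apply: gsecP => c; apply: addrA. Qed.
Lemma gaddC : commutative gadd.
Proof. by move=> s t; apply: gsecP => c; apply: addrC. Qed.
Lemma gadd0 : left_id gzero gadd.
Proof. by move=> s; apply: gsecP => c; apply: add0r. Qed.
Lemma gaddN : left_inverse gzero gopp gadd.
Proof. by move=> s; apply: gsecP => c; apply: addNr. Qed.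

HB.instance Definition _ := GRing.isZmodule.Build gsec gaddA gaddC gadd0 gaddN.

Lemma gmulA : associative gmul.
Proof. by move=> s t u; apply: gsecP => c; apply: mulrA. Qed.
Lemma gmulC : commutative gmul.
Proof. by move=> s t; apply: gsecP => c; apply: mulrC. Qed.
Lemma gmul1 : left_id gone gmul.
Proof. by move=> s; apply: gsecP => c; apply: mul1r. Qed.
Lemma gmulDl : left_distributive gmul +%R.
Proof. by move=> s t u; apply: gsecP => c; apply: mulrDl. Qed.

HB.instance Definition _ := GRing.Zmodule_isComPzRing.Build gsec
  gmulA gmulC gmul1 gmulDl.

Lemma gstrB : zmod_morphism gstr.
Proof. by move=> a b; apply: gsecP => c /=; rewrite !rmorphB. Qed.
Lemma gstr_monoid : monoid_morphism gstr.
Proof.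
by split=> [|a b]; apply: gsecP => c /=; rewrite ?rmorph1 // !rmorphM.
Qed.

HB.instance Definition _ := GRing.isZmodMorphism.Build _ _ gstr gstrB.
HB.instance Definition _ := GRing.isMonoidMorphism.Build _ _ gstr gstr_monoid.

Lemma gv_res (s : gsec) (c : local_chart V) (W : opens X) (Wc : W `<=` cdom c)
    (WV : W `<=` V) :
  rres B Wc (s c) = s (LocalChart WV (chres Wc (cind c))).
Proof. by rewrite (@gvE s c (LocalChart WV _) Wc) /tr trans_id. Qed.

Lemma gv_trans (s : gsec) (W : opens X) (WV : W `<=` V) h h' :
  s (LocalChart WV h') = tr h h' (s (LocalChart WV h)).
Proof.
rewrite (@gvE s (LocalChart WV h) (LocalChart WV h') (@subset_refl _ W)).
by rewrite /= chres_id rres_id.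
Qed.

End Sections.

Section Restriction.
Variables (U V : opens X) (VU : V `<=` U).

Definition widen_chart (c : local_chart V) : local_chart U :=
  LocalChart (subset_trans (csub c) VU) (cind c).

Lemma gresP (s : gsec U) : compatible (fun c => s (widen_chart c)).
Proof. by move=> c c' cc; apply: (@gvE _ s (widen_chart c) (widen_chart c')). Qed.

Definition gres (s : gsec U) : gsec V := Gsec (gresP s).

Lemma gresB : zmod_morphism gres.
Proof. by move=> s t; apply: gsecP. Qed.
Lemma gres_monoid : monoid_morphism gres.
Proof. by split=> [|s t]; apply: gsecP. Qed.

HB.instance Definition _ := GRing.isZmodMorphism.Build _ _ gres gresB.
HB.instance Definition _ := GRing.isMonoidMorphism.Build _ _ gres gres_monoid.

End Restriction.

Lemma gv_irr (V : opens X) (s : gsec V) (W : opens X) (WV WV' : W `<=` V) (h : chart T W) :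
  s (LocalChart WV h) = s (LocalChart WV' h).
Proof. by rewrite (Prop_irrelevance WV WV'). Qed.

Lemma gres_id (U : opens X) (UU : U `<=` U) (s : gsec U) : gres UU s = s.
Proof. by apply: gsecP => -[W WU h] /=; exact: (@gv_irr U s W _ WU h). Qed.

Lemma gres_comp (U V W : opens X) (VU : V `<=` U) (WV : W `<=` V)
  (WU : W `<=` U) (s : gsec U) : gres WV (gres VU s) = gres WU s.
Proof. by apply: gsecP => -[Z ZW h] /=; exact: (@gv_irr U s Z _ _ h). Qed.

Lemma sheaf_ext (U : opens X) (I : Type) (V : I -> opens X) (VU : forall i, V i `<=` U)
  (S : ringSheaf X) (s t : rsec S U) : (forall x, U x -> exists i, V i x) ->
  (forall i, rres S (VU i) s = rres S (VU i) t) -> s = t.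
Proof.
move=> cov st; have [i j|u [uE u_uniq]] := @rsheaf _ S U I V VU cov (fun i => rres S (VU i) t).
  have IU : interO (V i) (V j) `<=` U by apply: subset_trans (VU i); apply: interOl.
  exact: etrans (rres_comp _ _ IU t) (esym (rres_comp _ _ IU t)).
by rewrite -(u_uniq s st) -(u_uniq t).
Qed.

(** A chart inside U need not lie inside any member of the cover. Its value is therefore glued in B
    from the intersections [D c i], each of which carries a chart inside [V i]; compatibility is
    then checked on these pieces. *)
Lemma g_sheaf : is_sheaf (Presheaf gres_id gres_comp).
Proof.
move=> U I V VU cov s compat.
pose D (c : local_chart U) i := interO (cdom c) (V i).
pose Dc (c : local_chart U) (i : I) : D c i `<=` cdom c := @interOl _ _ _.
pose DV (c : local_chart U) (i : I) : D c i `<=` V i := @interOr _ _ _.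
have covD c x : cdom c x -> exists i, D c i x.
  by move=> cx; have [i Vx] := cov x (csub c x cx); exists i.
pose loc c i : rsec B (D c i) := s i (LocalChart (@DV c i) (chres (@Dc c i) (cind c))).
have sE i j (W : opens X) (Wi : W `<=` V i) (Wj : W `<=` V j) (h : chart T W) :
    s i (LocalChart Wi h) = s j (LocalChart Wj h).
  have WI : W `<=` interO (V i) (V j) by move=> x Wx; split; [apply: Wi|apply: Wj].
  have /(congr1 (fun u : gsec _ => u (LocalChart WI h))) /= := compat i j.
  by move=> e; rewrite (gv_irr _ Wi (subset_trans WI (@interOl _ _ _))) [LHS]e;
    apply: gv_irr.
have ex c : exists! t : rsec B (cdom c), forall i, rres B (@Dc c i) t = loc c i.
  apply: (@rsheaf _ B _ _ _ (@Dc c) (covD c)) => i j.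
  have Wi : interO (D c i) (D c j) `<=` V i by move=> x [[]].
  have Wj : interO (D c i) (D c j) `<=` V j by move=> x [_ []].
  have Wc : interO (D c i) (D c j) `<=` cdom c by move=> x [[]].
  rewrite [LHS](gv_res (s i) _ Wi) [RHS](gv_res (s j) _ Wj) /=.
  by rewrite !(chres_comp _ _ Wc); apply: sE.
pose t c := projT1 (cid (ex c)).
have tE c i : rres B (@Dc c i) (t c) = loc c i.
  by have [+ _] := projT2 (cid (ex c)); apply.
have tP : compatible t.
  move=> c c' cc; apply: (sheaf_ext (VU := @Dc c') (covD c')) => i.
  rewrite tE -tr_res.
  have WD : D c' i `<=` D c i by move=> x [cx Vx]; split=> //; apply: cc.
  have Wc : D c' i `<=` cdom c := subset_trans (@Dc c' i) cc.
  rewrite (rres_comp _ _ Wc) -(rres_comp (@Dc c i) WD) tE.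
  rewrite (@gv_res _ (s i) (LocalChart (@DV c i) (chres (@Dc c i) (cind c))) _ WD (@DV c' i)) /= (chres_comp _ _ Wc) (chres_comp _ _ Wc).
  exact: gv_trans.
exists (Gsec tP); split=> [i|u uE]; apply: gsecP => c.
  have cD : cdom c `<=` D (widen_chart (VU i) c) i by move=> x cx; split; [exact: cx|exact: (csub c x cx)].
  have cc : cdom c `<=` cdom c := @subset_refl _ _.
  have := congr1 (rres B cD) (tE (widen_chart (VU i) c) i).
  rewrite (rres_comp _ _ cc) rres_id /= => ->.
  rewrite (@gv_res _ (s i) (LocalChart (@DV (widen_chart (VU i) c) i)
    (chres (@Dc (widen_chart (VU i) c) i) (cind c))) _ cD (csub c)) /= (chres_comp _ _ cc) chres_id.
  by case: c {cD cc}.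
apply: (sheaf_ext (VU := @Dc c) (covD c)) => i; rewrite tE.
have WU := subset_trans (@DV c i) (VU i).
rewrite (gv_res u (@Dc c i) WU) /loc -uE /=; exact: gv_irr.
Qed.

Definition glue_ring : ringSheaf X :=
  @RingSheaf X gsec (fun U V VU => gres VU) gres_id gres_comp g_sheaf.

Lemma gstr_res (U V : opens X) (VU : V `<=` U) a :
  gstr (rres O VU a) = gres VU (gstr a).
Proof.
apply: gsecP => c /=; congr (astr _ _ _).
by rewrite (rres_comp _ _ (subset_trans (csub c) VU)).
Qed.

Definition glue : algSheaf O :=
  @AlgSheaf X O glue_ring (fun U => @gstr U) gstr_res.

Definition glue_chart U (h : chart T U) : smap U glue B.
Proof.
exists (fun V VU (s : gsec V) => s (LocalChart (@subset_refl _ V) (chres VU h))).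
move=> V W VU WV WU s /=.
rewrite [RHS](@gv_res _ s (LocalChart (@subset_refl _ V) (chres VU h)) _ WV WV).
by rewrite /= (chres_comp _ _ WU); exact: (@gv_irr V s W _ WV).
Defined.

(** A compatible family is determined by its expression in the chart h over V. Conversely a section
    of B is carried from there to every chart inside V by the transitions, and compatibility is
    their cocycle identity. *)
Lemma glue_chart_iso U (h : chart T U) : alg_iso (glue_chart h).
Proof.
split; first split.
- by move=> V VU; split.
- by move=> V VU a /=; rewrite rres_id.
move=> V VU; set c0 : local_chart V := LocalChart (@subset_refl _ V) (chres VU h).
apply: inj_surj_bijective => [s s' ss'|t].
  apply: gsecP => c; have := congr1 (fun u : rsec B V =>
    tr (chres (csub c) (cind c0)) (cind c) (rres B (csub c) u)) ss'.
  by rewrite /= -/c0 -!(@gvE _ _ c0 c).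
pose s (c : local_chart V) : rsec B (cdom c) :=
  tr (chres (csub c) (chres VU h)) (cind c) (rres B (csub c) t).
have sP : compatible s.
  move=> c c' cc; rewrite /s -tr_res (chres_comp _ cc (csub c')).
  by rewrite (rres_comp _ cc (csub c')) [RHS]trans_comp.
exists (Gsec sP : gsec V); rewrite /= /s /= chres_id rres_id; exact: trans_id.
Qed.

Lemma glue_chart_gres V (c : local_chart V) (s : gsec V) :
  glue_chart (cind c) (cdom c) (@subset_refl _ _) (gres (csub c) s) = s c.
Proof.
by case: c => W WV h /=; rewrite chres_id; exact: (@gv_irr V s W _ WV h).
Qed.

Lemma glue_chart_trans U (h h' : chart T U) :
  glue_chart h' = scomp (trans G h h') (glue_chart h).
Proof.
apply: smapP => V VU s /=.
by rewrite (gv_trans s _ (chres VU h)) /tr (trans_res G VU h h' _ VU).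
Qed.

Lemma glue_chart_res (U V : opens X) (VU : V `<=` U) (h : chart T U) :
  glue_chart (chres VU h) = srestr VU (glue_chart h).
Proof.
apply: smapP => W WV s /=.
by rewrite (chres_comp _ _ (subset_trans WV VU)).
Qed.

End Glue.
Arguments csub {X T V} l t _.

Section GlueMap.
Variables (X : topologicalType) (O : ringSheaf X) (T : atlas X) (B B' : algSheaf O).
Variables (G : descent T B) (G' : descent T B') (q : smap fullO B B').
Hypothesis q_alg : alg_map q.
Hypothesis q_trans : forall U (h h' : chart T U) (V : opens X) (VU : V `<=` U) s,
  q V (@fullO_sub _ V) (trans G h h' V VU s) =
  trans G' h h' V VU (q V (@fullO_sub _ V) s).

Lemma glue_mapP (V : opens X) (s : gsec G V) :
  compatible G' (fun c : local_chart T V => q (cdom c) (@fullO_sub _ _) (s c)).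
Proof.
move=> c c' cc; rewrite (gvE s cc) /tr q_trans; congr (trans _ _ _ _ _ _).
exact: (sapp_res q (@fullO_sub _ _) cc (@fullO_sub _ _) (s c)).
Qed.

Definition glue_map : smap fullO (glue G) (glue G').
Proof.
exists (fun V VT s => Gsec (glue_mapP s) : gsec G' V) => V W VU WV WU s.
by apply: gsecP.
Defined.

Lemma glue_map_alg : alg_map glue_map.
Proof.
split=> [V VT|V VT a]; last by apply: gsecP => c /=; rewrite (alg_mapC q_alg).
split=> *; apply: gsecP => c /=.
- exact: (alg_map1 q_alg).
- exact: (alg_mapD q_alg).
- exact: (alg_mapM q_alg).
Qed.

Lemma glue_chart_map (U : opens X) (h : chart T U) (V : opens X) (VU : V `<=` U) (s : gsec G V) :
  glue_chart G' h V VU (glue_map V (@fullO_sub _ V) s) =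
  q V (@fullO_sub _ V) (glue_chart G h V VU s).
Proof. by []. Qed.

Lemma glue_map_quotient :
  (forall V t, exists s, q V (@fullO_sub _ V) s = t) -> alg_quotient glue_map.
Proof.
move=> q_surj; split=> [|V VT t x Vx]; first exact: glue_map_alg.
have [c cx] := local_chart_cover T Vx.
have [b bE] := q_surj _ (glue_chart G' (cind c) _ (@subset_refl _ _) (gres (csub c) t)).
have [g' _ gK] := (glue_chart_iso G (cind c)).2 _ (@subset_refl _ (cdom c)).
exists (cdom c), (csub c), (g' b); split=> //.
apply: (bij_inj ((glue_chart_iso G' (cind c)).2 _ (@subset_refl _ _))).
rewrite [LHS]glue_chart_map -bE; congr (q _ _ _); exact: gK.
Qed.

End GlueMap.

Section Restrict.
Variables (X : topologicalType) (OB : QSheaf X) (OX : algSheaf OB) (F : modSheaf OX).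
Variables (U V : opens X) (VU : V `<=` U).

Lemma base_linear_restr (G H : modSheaf OX) (f : smap U G H) :
  base_linear_map f -> base_linear_map (srestr VU f).
Proof. by case=> fD fZ; split=> [W WV|W WV]; [apply: fD|apply: fZ]. Qed.

Lemma is_derivation_restr (D : smap U OX F) :
  is_derivation D -> is_derivation (srestr VU D).
Proof. by move=> D_der W WV; apply: D_der. Qed.

Lemma integrable_restr (D : smap U OX F) : integrable D -> integrable (srestr VU D).
Proof.
case=> gamma [[g1 g2] g3]; exists (srestr VU gamma).
split; first split; first exact: base_linear_restr.
  by move=> W WV a m; apply: g2.
by move=> W WV a; apply: g3.
Qed.

Lemma iterated_hasse_restr (D : smap U OX F) (h : smap U OX (Salg F)) :
  iterated_hasse D h -> iterated_hasse (srestr VU D) (srestr VU h).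
Proof.
case=> -[[h_ring h_base] h0] h1 [T [[T1 T2 T3] hT]]; split; first split.
- by split=> [W WV|W WV b]; [apply: h_ring|apply: h_base].
- by move=> W WV a; apply: h0.
- by move=> W WV a; apply: h1.
exists (fun i => srestr VU (T i)); split; first split.
- by move=> i; apply: base_linear_restr.
- by move=> W WV m; apply: T2.
- by move=> i W WV a m x Wx i0; apply: T3.
- by move=> i W WV a x Wx i0; apply: hT.
Qed.

Lemma alg_map_restr (O : ringSheaf X) (R S : algSheaf O) (f : smap U R S) :
  alg_map f -> alg_map (srestr VU f).
Proof. by case=> f1 f2; split=> [W WV|W WV a]; [apply: f1|apply: f2]. Qed.

Lemma strict_restr (f : smap U (Salg F) (Salg F)) :
  strict_map f -> strict_map (srestr VU f).
Proof.
case=> f1 f2 f3; split; first exact: alg_map_restr.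
  by move=> W WV w n w0; apply: f2.
by move=> W WV m; apply: f3.
Qed.

Lemma on_open_restr (P Q : presheaf X) (f : smap fullO P Q) :
  srestr VU (on_open f U) = on_open f V.
Proof. by apply: smapP => W WV s; apply: (sapp_irr f). Qed.

End Restrict.

Definition id_smap (X : topologicalType) (U : opens X) (P : presheaf X) : smap U P P :=
  @Smap X U P P (fun V VU s => s) (fun V W VU WV WU s => erefl).

Lemma strict_id (X : topologicalType) (OB : QSheaf X) (OX : algSheaf OB)
  (F : modSheaf OX) (U : opens X) : strict_map (id_smap U (Salg F)).
Proof.
split=> [|V VU w n w0|V VU m].
- by split=> [V VU|V VU a]; split.
- exact: w0.
- exact: Sinj_same.
Qed.

(** * Equivalences as transition maps *)

Section Transition.
Variables (X : topologicalType) (OB : QSheaf X) (OX : algSheaf OB) (F : modSheaf OX).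
Variable D : smap fullO OX F.
Hypothesis D_der : is_derivation D.
Hypothesis D_loc : locally_integrable D.
Hypothesis D_rigid : forall (U : opens X) (f : smap U F (amod (Salg F))),
  linear_map f ->
  (forall (V : opens X) (VU : V `<=` U) (a : rsec OX V),
     f V VU (on_open D U V VU a) = (0 : msec (amod (Salg F)) V)) ->
  forall (V : opens X) (VU : V `<=` U) (m : msec F V),
    f V VU m = (0 : msec (amod (Salg F)) V).

Definition is_chart (U : opens X) (h : smap U OX (Salg F)) : Prop :=
  integrable (on_open D U) /\ iterated_hasse (on_open D U) h.

Lemma is_chart_restr (U V : opens X) (VU : V `<=` U) (h : smap U OX (Salg F)) :
  is_chart h -> is_chart (srestr VU h).
Proof.
by case=> DU hU; split; rewrite -(on_open_restr VU);
  [apply: integrable_restr|apply: iterated_hasse_restr].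
Qed.

Lemma integrable_chart (U : opens X) : integrable (on_open D U) ->
  exists h, iterated_hasse (on_open D U) h.
Proof.
move=> DU; have [h [hU _]] := integrable_strict (is_derivation_restr _ D_der) DU.
by exists h.
Qed.

Section Pair.
Variable U : opens X.

(** Both Hasse derivations are images of one h0 under strict maps f and f'; the equivalence is f'
    after the inverse of f. *)
Lemma transition_exists (h h' : smap U OX (Salg F)) : is_chart h -> is_chart h' ->
  exists phi, is_equivalence h h' phi.
Proof.
move=> [DU hU] [_ hU'].
have [h0 [_ H]] := integrable_strict (is_derivation_restr _ D_der) DU.
have [f [f_strict fE]] := H h hU; have [f' [f'_strict f'E]] := H h' hU'.
have [g gK] := bij_smap_inv (strict_bij f_strict).
exists (scomp f' g); apply: strict_equivalence.
  by apply: strict_comp => //; apply: strict_inv gK.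
by move=> V VU a; rewrite /= fE (gK V VU).1 f'E.
Qed.

Lemma equivalence_unique (h h' : smap U OX (Salg F)) phi psi : is_chart h ->
  is_equivalence h h' phi -> is_equivalence h h' psi -> phi = psi.
Proof.
move=> [_ [h_hasse h_ext _]] phiP psiP.
apply: (strict_unique (@D_rigid U) h_hasse h_ext (equivalence_strict phiP)
  (equivalence_strict psiP)) => V VU a.
by case: phiP psiP => _ <- _ [_ <- _].
Qed.

(** The value is taken by classical choice; the identity is a default where no equivalence exists,
    making the function total. *)
Definition transition (h h' : smap U OX (Salg F)) : smap U (Salg F) (Salg F) :=
  if pselect (exists phi, is_equivalence h h' phi) is left e
  then projT1 (cid e) else id_smap U (Salg F).

Lemma transitionP (h h' : smap U OX (Salg F)) : is_chart h -> is_chart h' ->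
  is_equivalence h h' (transition h h').
Proof.
move=> hU hU'; rewrite /transition; case: pselect => [e|[]].
  exact: projT2 (cid e).
exact: transition_exists.
Qed.

(** Through uniqueness, an identity between transitions reduces to exhibiting a strict map with the
    right effect on h. The cocycle condition and compatibility with restriction both follow in this
    way. *)
Lemma transitionE (h h' : smap U OX (Salg F)) phi : is_chart h -> is_chart h' ->
  strict_map phi ->
  (forall (V : opens X) (VU : V `<=` U) (a : rsec OX V),
     h' V VU a = phi V VU (h V VU a)) ->
  transition h h' = phi.
Proof.
move=> hU hU' phi_strict phiE; apply: (equivalence_unique hU).
  exact: transitionP.
exact: strict_equivalence.
Qed.

Lemma transition_strict (h h' : smap U OX (Salg F)) : is_chart h -> is_chart h' ->
  strict_map (transition h h').
Proof. by move=> hU hU'; apply: equivalence_strict; apply: transitionP. Qed.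

Lemma transition_apply (h h' : smap U OX (Salg F)) (V : opens X) (VU : V `<=` U) a :
  is_chart h -> is_chart h' -> transition h h' V VU (h V VU a) = h' V VU a.
Proof. by move=> hU hU'; case: (transitionP hU hU') => _ <-. Qed.

Lemma transition_id (h : smap U OX (Salg F)) : is_chart h ->
  transition h h = id_smap U (Salg F).
Proof. by move=> hU; apply: transitionE => //; apply: strict_id. Qed.

Lemma transition_comp (h h' h'' : smap U OX (Salg F)) :
  is_chart h -> is_chart h' -> is_chart h'' ->
  transition h h'' = scomp (transition h' h'') (transition h h').
Proof.
move=> hU hU' hU''; apply: transitionE => //.
  by apply: strict_comp; apply: transition_strict.
by move=> V VU a; rewrite /= !transition_apply.
Qed.

End Pair.

Lemma transition_res (U V : opens X) (VU : V `<=` U) (h h' : smap U OX (Salg F)) :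
  is_chart h -> is_chart h' ->
  transition (srestr VU h) (srestr VU h') = srestr VU (transition h h').
Proof.
move=> hU hU'; apply: transitionE; do ?exact: is_chart_restr.
  by apply: strict_restr; apply: transition_strict.
by move=> W WV a; rewrite /= transition_apply.
Qed.

Definition hasse_chart (U : opens X) : Type := {h : smap U OX (Salg F) | is_chart h}.

Lemma hasse_chartP U (h h' : hasse_chart U) : sval h = sval h' -> h = h'.
Proof.
case: h h' => [h hU] [h' hU'] /= e; case: _ / e hU' => hU'.
by congr exist; apply: Prop_irrelevance.
Qed.

Definition hasse_chres (U V : opens X) (VU : V `<=` U) (h : hasse_chart U) :
  hasse_chart V := exist _ (srestr VU (sval h)) (is_chart_restr VU (svalP h)).

Definition hasse_atlas : atlas X.
Proof.
apply: (@Atlas X hasse_chart hasse_chres) => [U UU h|U V W VU WV WU h|x].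
- by apply: hasse_chartP; apply: smapP => V VU s; apply: (sapp_irr (sval h)).
- by apply: hasse_chartP; apply: smapP => Z ZW s; apply: (sapp_irr (sval h)).
have [U [Ux DU]] := D_loc x; have [h hU] := integrable_chart DU.
by exists U; split=> //; exists (exist _ h (conj DU hU)).
Defined.

Definition jet_descent : descent hasse_atlas (Salg F).
Proof.
apply: (@Descent X OX hasse_atlas (Salg F)
  (fun U h h' => transition (sval h) (sval h'))) => [U h h'|U h V VU s|U h h' h'' V VU s|].
- by have [] := transition_strict (svalP h) (svalP h').
- by rewrite (transition_id (svalP h)).
- by rewrite (transition_comp (svalP h) (svalP h') (svalP h'')).
- move=> U V VU h h' W WV WU s /=; rewrite (transition_res VU (svalP h) (svalP h')).
  exact: (sapp_irr (transition (sval h) (sval h'))).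
Defined.

End Transition.

(** * Truncations of S(F) and the maps induced on them *)

Section Truncated.
Variables (X : topologicalType) (OB : QSheaf X) (OX : algSheaf OB) (F : modSheaf OX).

Lemma trunc_inj N (V : opens X) (s s' : Ssec F V) p :
  trunc N s = trunc N s' -> (p <= N)%N -> s p = s' p.
Proof.
move=> e pN; exact: (congr1 (fun t : Tsec F N V => t (Ordinal (pN : (p < N.+1)%N))) e).
Qed.

Lemma eq_trunc N (V : opens X) (s s' : Ssec F V) :
  (forall p, (p <= N)%N -> s p = s' p) -> trunc N s = trunc N s'.
Proof.
move=> e; apply: functional_extensionality_dep => p; apply: e.
by rewrite -ltnS.
Qed.

Lemma pad_trunc N (V : opens X) (s : Ssec F V) p : (p <= N)%N ->
  pad (trunc N s) p = s p.
Proof. by apply: trunc_inj; rewrite padK. Qed.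

Lemma pad_res N (V W : opens X) (WV : W `<=` V) (t : Tsec F N V) :
  pad (Tres WV t) = Sres WV (pad t).
Proof.
apply: functional_extensionality_dep => n; rewrite /pad /Sres.
by case: {-}_ / idP => // _; rewrite raddf0.
Qed.

Definition trunc_smap N : smap fullO (Salg F) (Talg F N).
Proof. by exists (fun V VU (s : Ssec F V) => trunc N s). Defined.

Lemma trunc_smap_alg N : alg_map (trunc_smap N).
Proof.
split=> // V VU; split=> [|s t|s t] /=; [exact: rmorph1|exact: rmorphD|exact: rmorphM].
Qed.

Definition trunc_trunc N : smap fullO (Talg F N.+1) (Talg F N).
Proof.
exists (fun V VU (t : Tsec F N.+1 V) => trunc N (pad t)).
by move=> V W VU WV WU t; rewrite [pres WV t]/(Tres WV t) pad_res.
Defined.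

Lemma trunc_truncE N (V : opens X) (VU : V `<=` fullO) (s : Ssec F V) :
  trunc_trunc N V VU (trunc N.+1 s) = trunc N s.
Proof. by apply: eq_trunc => p pN; apply: pad_trunc; apply: leqW. Qed.

Lemma trunc_trunc_alg N : alg_map (trunc_trunc N).
Proof.
split=> [V VU|V VU a]; last exact: trunc_truncE.
split=> [|s t|s t]; first exact: trunc_truncE.
  rewrite -(padK s) -(padK t) -[X in trunc_trunc N V VU X](rmorphD (trunc N.+1)).
  by rewrite !trunc_truncE [LHS](rmorphD (trunc N)).
rewrite -(padK s) -(padK t) -[X in trunc_trunc N V VU X](rmorphM (trunc N.+1)).
by rewrite !trunc_truncE [LHS](rmorphM (trunc N)).
Qed.

Section Transport.
Variables (N : nat) (U : opens X).

Definition trunc_map (phi : smap U (Salg F) (Salg F)) : smap U (Talg F N) (Talg F N).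
Proof.
exists (fun V VU (t : Tsec F N V) => trunc N (phi V VU (pad t) : Ssec F V)).
move=> V W VU WV WU t; rewrite [pres WV t]/(Tres WV t) pad_res.
by rewrite (sapp_res phi VU WV).
Defined.

(** The choice of zero padding does not matter: a strict map does not decrease degrees, so
    components above N have no effect up to N. The algebra properties of phi pass to the truncation
    through this identity. *)
Lemma trunc_mapE phi (V : opens X) (VU : V `<=` U) (s : Ssec F V) : strict_map phi ->
  trunc_map phi V VU (trunc N s) = trunc N (phi V VU s : Ssec F V).
Proof.
move=> phi_strict; apply: eq_trunc => p pN; apply: (strict_congr phi_strict) => k kp.
by apply: pad_trunc; apply: leq_trans pN.
Qed.

Lemma trunc_map_alg phi : strict_map phi -> alg_map (trunc_map phi).
Proof.
move=> phi_strict; have [phi_alg _ _] := phi_strict.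
split=> [V VU|V VU a]; last first.
  by rewrite [LHS]trunc_mapE // -[Sconst F a]/(astr (Salg F) V a) (alg_mapC phi_alg).
split=> [|s t|s t].
- by rewrite [LHS](trunc_mapE _ 1) // (alg_map1 phi_alg).
- rewrite -(padK s) -(padK t) -[X in trunc_map phi V VU X](rmorphD (trunc N)).
  by rewrite !trunc_mapE // (alg_mapD phi_alg) [LHS](rmorphD (trunc N)).
- rewrite -(padK s) -(padK t) -[X in trunc_map phi V VU X](rmorphM (trunc N)).
  by rewrite !trunc_mapE // (alg_mapM phi_alg) [LHS](rmorphM (trunc N)).
Qed.

End Transport.

Lemma Ttop_trunc n (V : opens X) (m : msec (Ssh F n) V) : Ttop m = trunc n (Sinj m).
Proof. by []. Qed.

(** A strict map is the identity on the associated graded algebra. This is why the kernels glue to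
    S^n(F) itself and not to a twisted form of it. *)
Lemma trunc_map_top n (U : opens X) phi (V : opens X) (VU : V `<=` U)
    (m : msec (Ssh F n) V) :
  strict_map phi -> trunc_map n phi V VU (Ttop m) = Ttop m.
Proof.
move=> phi_strict; rewrite !Ttop_trunc trunc_mapE //; apply: eq_trunc => p.
rewrite leq_eqVlt => /orP[/eqP->|pn].
  by rewrite (strict_homogeneous phi_strict) Sinj_same.
rewrite (strict_low phi_strict) ?Sinj_other ?ltn_eqF // => k kp.
by rewrite Sinj_other // ltn_eqF //; apply: leq_ltn_trans pn.
Qed.

Lemma TtopD n (V : opens X) : {morph @Ttop X OX F n V : s t / s + t}.
Proof. by move=> s t; rewrite !Ttop_trunc SinjD; apply: rmorphD. Qed.

Lemma TtopZ n (V : opens X) (a : rsec OX V) (s : msec (Ssh F n) V) :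
  Ttop (a *: s) = @Tconst X OX F n V a * Ttop s.
Proof. by rewrite !Ttop_trunc SinjZ; apply: rmorphM. Qed.

Lemma Ttop_inj n (V : opens X) : injective (@Ttop X OX F n V).
Proof.
move=> s t; rewrite !Ttop_trunc => e.
by have := trunc_inj e (leqnn n); rewrite !Sinj_same.
Qed.

Lemma Ttop_res n (V W : opens X) (WV : W `<=` V) (m : msec (Ssh F n) V) :
  Tres WV (Ttop m) = Ttop (mres (Ssh F n) WV m).
Proof. by rewrite !Ttop_trunc Tres_trunc Sinj_res. Qed.

Lemma trunc_trunc_eq0 n (V : opens X) (VU : V `<=` fullO) (t : Tsec F n.+1 V) :
  trunc_trunc n V VU t = (0 : Tsec F n V) <-> exists m, t = Ttop m.
Proof.
split=> [t0|[m ->]]; last first.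
  rewrite Ttop_trunc trunc_truncE; apply: functional_extensionality_dep => p.
  by rewrite /trunc Sinj_other // ltn_eqF.
exists (pad t n.+1); rewrite Ttop_trunc -{1}(padK t); apply: eq_trunc => p.
rewrite leq_eqVlt => /orP[/eqP->|pn]; first by rewrite Sinj_same.
have := congr1 (fun u : Tsec F n V => u (Ordinal pn)) t0; rewrite /= /trunc /= => ->.
by rewrite Sinj_other // ltn_eqF.
Qed.

Lemma symC_inj x : injective (@symC (rstalk OX x) (mstalk F x)).
Proof.
pose r := symlift (M := mstalk F x) (idfun : {rmorphism rstalk OX x -> rstalk OX x})
  (fun _ => 0).
have rK a : r (symC _ a) = a.
  by apply: symliftC => [m n|b m]; rewrite ?addr0 ?mulr0.
exact: can_inj rK.
Qed.

Lemma rgerm_inj (V : opens X) (a b : rsec OX V) :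
  (forall x (Vx : V x), rgerm Vx a = rgerm Vx b) -> a = b.
Proof.
move=> ab.
have ex (i : {x | V x}) : exists W : opens X, exists WV : W `<=` V,
    W (sval i) /\ rres OX WV a = rres OX WV b.
  have /clsP [W /= [W1 [W2 [Wx e]]]] := ab _ (svalP i).
  by exists W, W1; split=> //; rewrite (Prop_irrelevance W2 W1) in e.
pose W i := projT1 (cid (ex i)); pose WV i := projT1 (cid (projT2 (cid (ex i)))).
have WP i : W i (sval i) /\ rres OX (WV i) a = rres OX (WV i) b.
  exact: projT2 (cid (projT2 (cid (ex i)))).
apply: (sheaf_ext (VU := WV)) => [x Vx|i]; last exact: (WP i).2.
by exists (exist _ x Vx); apply: (WP (exist _ x Vx)).1.
Qed.

Lemma Tconst0_inj (V : opens X) : injective (@Tconst X OX F 0 V).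
Proof.
move=> a b ab; have e := @trunc_inj 0 V (Sconst F a) (Sconst F b) 0 ab (leqnn 0).
apply: rgerm_inj => x Vx; apply: symC_inj.
have := congr1 (fun s => symval s Vx) e.
by rewrite /symval /= /Spure !big_nil !mulr1.
Qed.

Lemma Tconst0_locally_surj (V : opens X) (t : Tsec F 0 V) x : V x ->
  exists (W : opens X) (WV : W `<=` V) (a : rsec OX W),
    W x /\ Tres WV t = @Tconst X OX F 0 W a.
Proof.
move=> Vx; have [W [WV [l [Wx tl]]]] := fvalP (t ord0) Vx.
exists W, WV, (\sum_(g <- l) g.1); split=> //.
rewrite -(padK t) Tres_trunc; apply: eq_trunc => p; rewrite leqn0 => /eqP->.
have pt0 : pad t 0%N = t ord0 := congr1 (fun u : Tsec F 0 V => u ord0) (padK t).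
apply: famP => y Wy; rewrite [LHS]/= /Sv pt0 (tl y Wy).
rewrite /= /Spure big_nil mulr1 (raddf_sum (rgerm Wy)) (raddf_sum (@symC _ _)).
by apply: eq_bigr => -[a s] _ /=; rewrite (tuple0 s) big_nil mulr1.
Qed.

End Truncated.

Section LocalBijection.
Variables (X : topologicalType) (U : opens X) (R S : ringSheaf X) (f : smap U R S).

(** Injectivity makes local preimages agree on overlaps, so they glue. *)
Lemma inj_locally_surj_bij : Defs.inj_map f -> locally_surj f -> bij_map f.
Proof.
move=> f_inj f_surj V VU; apply: inj_surj_bijective => [|t]; first exact: f_inj.
have ex (i : {x | V x}) : exists (W : opens X) (WV : W `<=` V) (s : rsec R W),
    W (sval i) /\ f W (subset_trans WV VU) s = rres S WV t.
  exact: f_surj (svalP i).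
pose W i := projT1 (cid (ex i)); pose WV i := projT1 (cid (projT2 (cid (ex i)))).
pose s i := projT1 (cid (projT2 (cid (projT2 (cid (ex i)))))).
have sP i : W i (sval i) /\ f (W i) (subset_trans (@WV i) VU) (s i) = rres S (@WV i) t.
  exact: projT2 (cid (projT2 (cid (projT2 (cid (ex i)))))).
have cov x : V x -> exists i, W i x.
  by move=> Vx; exists (exist _ x Vx); apply: (sP (exist _ x Vx)).1.
have [i j|u [uE _]] := @rsheaf _ R V _ W WV cov s.
  have IV : interO (W i) (W j) `<=` V by move=> x [/(@WV i)].
  have IU := subset_trans IV VU; apply: (f_inj _ IU).
  rewrite (sapp_res f (subset_trans (@WV i) VU)) (sapp_res f (subset_trans (@WV j) VU)).
  rewrite (sP i).2 (sP j).2.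
  exact: etrans (rres_comp _ _ IV t) (esym (rres_comp _ _ IV t)).
exists u; apply: (sheaf_ext (VU := WV) cov) => i.
rewrite -(sP i).2 -uE; exact: esym (sapp_res f VU (@WV i) _ u).
Qed.

End LocalBijection.

(** * The sheaf of jets and its truncations *)

Section Jets.
Variables (X : topologicalType) (OB : QSheaf X) (OX : algSheaf OB) (F : modSheaf OX).
Variable D : smap fullO OX F.
Hypothesis D_der : is_derivation D.
Hypothesis D_loc : locally_integrable D.
Hypothesis D_rigid : forall (U : opens X) (f : smap U F (amod (Salg F))),
  linear_map f ->
  (forall (V : opens X) (VU : V `<=` U) (a : rsec OX V),
     f V VU (on_open D U V VU a) = (0 : msec (amod (Salg F)) V)) ->
  forall (V : opens X) (VU : V `<=` U) (m : msec F V),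
    f V VU m = (0 : msec (amod (Salg F)) V).

Let T := hasse_atlas D_der D_loc.
Let GS : descent T (Salg F) := jet_descent D_der D_loc D_rigid.

Let ch_strict U (h h' : chart T U) : strict_map (transition (sval h) (sval h')).
Proof. exact: (transition_strict D_der (svalP h) (svalP h')). Qed.

Definition trunc_descent n : descent T (Talg F n).
Proof.
apply: (@Descent X OX T (Talg F n) (fun U (h h' : chart T U) =>
  trunc_map n (transition (sval h) (sval h')))).
- by move=> U h h'; apply: trunc_map_alg; apply: ch_strict.
- move=> U h V VU s; rewrite -{1}(padK s) trunc_mapE; last exact: ch_strict.
  by rewrite [X in trunc n X](trans_id GS h VU) padK.
- move=> U h h' h'' V VU s; rewrite -(padK s) !trunc_mapE; try exact: ch_strict.
  by congr trunc; apply: (trans_comp GS).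
- move=> U V VU h h' W WV WU s; rewrite -(padK s) !trunc_mapE; try exact: ch_strict.
  by congr trunc; apply: (trans_res GS).
Defined.

Definition jets : algSheaf OX := glue GS.
Definition njets n : algSheaf OX := glue (trunc_descent n).

Lemma trunc_smap_trans n U (h h' : chart T U) (V : opens X) (VU : V `<=` U) s :
  trunc_smap F n V (@fullO_sub _ V) (trans GS h h' V VU s) =
  trans (trunc_descent n) h h' V VU (trunc_smap F n V (@fullO_sub _ V) s).
Proof. by apply: esym; apply: trunc_mapE; apply: ch_strict. Qed.

Lemma trunc_trunc_trans n U (h h' : chart T U) (V : opens X) (VU : V `<=` U) s :
  trunc_trunc F n V (@fullO_sub _ V) (trans (trunc_descent n.+1) h h' V VU s) =
  trans (trunc_descent n) h h' V VU (trunc_trunc F n V (@fullO_sub _ V) s).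
Proof.
rewrite -(padK s) [X in trunc_trunc _ _ _ _ X]trunc_mapE; last exact: ch_strict.
by rewrite !trunc_truncE [RHS]trunc_mapE //; apply: ch_strict.
Qed.

Definition jet_quot n : smap fullO jets (njets n) :=
  glue_map (@trunc_smap_trans n).
Definition njet_quot n : smap fullO (njets n.+1) (njets n) :=
  glue_map (@trunc_trunc_trans n).

(** In the chart h the section tau(a) is h(a) itself; compatibility is the property h' = phi h of
    the transition phi from h to h'. *)
Lemma jet_tauP (V : opens X) (a : rsec OX V) :
  compatible GS (fun c : local_chart T V =>
    sval (cind c) (cdom c) (@subset_refl _ _) (rres OX (csub c) a)).
Proof.
move=> c c' cc; pose h := chres cc (cind c).
have e : rres (Salg F) cc (sval (cind c) _ (@subset_refl _ _) (rres OX (csub c) a)) =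
    sval (cind c) _ cc (rres OX (subset_trans cc (csub c)) a).
  apply: etrans (esym (sapp_res (sval (cind c)) (@subset_refl _ _) cc cc _)) _.
  by congr (sval (cind c) _ _ _); apply: rres_comp.
rewrite [X in tr _ _ _ X]e.
rewrite -[RHS]/(transition (sval h) (sval (cind c')) _ (@subset_refl _ _) _).
have := transition_apply D_der (@subset_refl _ (cdom c'))
  (rres OX (subset_trans cc (csub c)) a) (svalP h) (svalP (cind c')).
rewrite (Prop_irrelevance (csub c') (subset_trans cc (csub c))) => <-.
by congr (transition _ _ _ _ _); apply: (sapp_irr (sval (cind c))).
Qed.

Definition jet_tau : smap fullO OX jets.
Proof.
exists (fun V VT a => Gsec (jet_tauP a) : gsec GS V) => V W VU WV WU a.
apply: gsecP => c /=.
apply: (congr1 (fun b => sval (cind c) (cdom c) (@subset_refl _ _) b)).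
exact: rres_comp.
Defined.

Lemma jet_tau_alg : base_alg_map jet_tau.
Proof.
have hc (V : opens X) (c : local_chart T V) : base_alg_map (sval (cind c)).
  by case: (svalP (cind c)) => _ [[]].
split=> [V VT|V VT b].
  split=> [|a b|a b]; apply: gsecP => c /=;
    have [h1 hD hM] := (hc V c).1 _ (@subset_refl _ (cdom c)).
  - by rewrite rmorph1 h1.
  - by rewrite rmorphD hD.
  - by rewrite rmorphM hM.
apply: gsecP => c /=; rewrite -astr_res (hc V c).2.
by [].
Qed.

Definition zero_smap (U : opens X) (R S : ringSheaf X) : smap U R S :=
  @Smap X U R S (fun V _ _ => (0 : rsec S V))
    (fun V W VU WV WU s => esym (rmorph0 (rres S WV))).

(** The zero map is a default where h is not a chart, since the isomorphisms are indexed by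
    arbitrary maps h. *)
Definition jet_chart (B : algSheaf OX) (G : descent T B) (U : opens X)
    (h : smap U OX (Salg F)) : smap U (glue G) B :=
  if pselect (is_chart D h) is left hU
  then glue_chart G (exist _ h hU : chart T U) else zero_smap U _ _.

Lemma jet_chartE (B : algSheaf OX) (G : descent T B) (U : opens X)
    (h : smap U OX (Salg F)) (hU : is_chart D h) :
  jet_chart G h = glue_chart G (exist _ h hU : chart T U).
Proof.
rewrite /jet_chart; case: pselect => [hU'|//].
by rewrite (Prop_irrelevance hU' hU).
Qed.

Definition jet_const : smap fullO (self_alg OX) (njets 0) :=
  @Smap X fullO (self_alg OX) (njets 0) (fun V VT a => gstr (trunc_descent 0) a)
    (fun V W VU WV WU a => gstr_res (trunc_descent 0) WV a).

(** In a chart, a section of S^0(F) is a family of germs that comes from O_X only locally, so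
    surjectivity is obtained locally and globalized by [inj_locally_surj_bij]. *)
Lemma jet_const_iso : alg_iso jet_const.
Proof.
split; first split=> // V VT.
  split=> [|a b|a b]; [exact: rmorph1|exact: rmorphD|exact: rmorphM].
apply: inj_locally_surj_bij => [V VT a b ab|V VT s x Vx].
  apply: rgerm_inj => x Vx; have [c cx] := local_chart_cover T Vx.
  have := congr1 (fun u : gsec (trunc_descent 0) V => u c) ab.
  move=> /Tconst0_inj /(congr1 (rgerm cx)).
  by rewrite !(rgerm_res (csub c) cx Vx).
have [c cx] := local_chart_cover T Vx.
have [W [Wc [a [Wx sa]]]] := Tconst0_locally_surj (gv s c : Tsec F 0 (cdom c)) cx.
have WV := subset_trans Wc (csub c).
exists W, WV, a; split=> //.
(* The element a of O_X exists only over W, so the two sections are compared in the chart c cut down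
   to W, where [glue_chart] is injective. *)
pose cW : local_chart T V := LocalChart WV (chres Wc (cind c)).
apply: (bij_inj ((glue_chart_iso (trunc_descent 0) (cind cW)).2 _ (@subset_refl _ _))).
rewrite [RHS](@glue_chart_gres _ _ _ _ _ _ cW (s : gsec _ V)) /=.
rewrite -(gv_res (s : gsec _ V) Wc WV) rres_id.
by rewrite -[LHS]/(Tconst F a) -sa.
Qed.

Lemma jet_topP n (V : opens X) (m : msec (Ssh F n) V) :
  compatible (trunc_descent n) (fun c : local_chart T V =>
    (Ttop (mres (Ssh F n) (csub c) m) : Tsec F n (cdom c))).
Proof.
move=> c c' cc; rewrite [rres _ _ _]Ttop_res (mres_comp _ cc (subset_trans cc (csub c))).
rewrite [RHS](trunc_map_top _ _ (ch_strict _ _)).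
by congr (Ttop (mres _ _ _)); apply: Prop_irrelevance.
Qed.

Definition jet_top n : smap fullO (Ssh F n) (amod (njets n)).
Proof.
exists (fun V VT m => Gsec (jet_topP m) : gsec (trunc_descent n) V) => V W VU WV WU m.
apply: gsecP => c /=; congr Ttop.
exact: (mres_comp WV (csub c) (subset_trans (csub c) WV) m).
Defined.

(** Exactness is checked chart by chart, where the kernel is given by [trunc_trunc_eq0]; local
    surjectivity lifts by zero padding. *)
Lemma jet_top_exact n :
  short_exact (G := amod (njets n.+1)) (H := amod (njets n)) (jet_top n.+1) (njet_quot n).
Proof.
have q_alg := glue_map_alg (trunc_trunc_alg F n) (@trunc_trunc_trans n).
split.
- split=> [V VT s t|V VT a s]; apply: gsecP => c.
    rewrite -[LHS]/(Ttop (mres (Ssh F n.+1) (csub c) (s + t))) raddfD.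
    exact: TtopD.
  rewrite -[LHS]/(Ttop (mres (Ssh F n.+1) (csub c) (a *: s))) mresZ.
  exact: TtopZ.
- split=> [V VT s t|V VT a s]; first exact: (alg_mapD q_alg).
  rewrite -[LHS]/(njet_quot n V VT (astr (njets n.+1) V a * (s : rsec (njets n.+1) V))).
  by rewrite (alg_mapM q_alg) (alg_mapC q_alg).
- move=> V VT s t st; apply: famP => x Vx; have [c cx] := local_chart_cover T Vx.
  have := congr1 (fun u : gsec (trunc_descent n.+1) V => u c) st.
  move=> /Ttop_inj /(congr1 (fun u => fval u cx)).
  rewrite -[LHS]/(fval s (csub c x cx)) -[RHS]/(fval t (csub c x cx)).
  by rewrite !(fval_irr _ (csub c x cx) Vx).
- apply: (glue_map_quotient (trunc_trunc_alg F n) (@trunc_trunc_trans n) _).2.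
  by move=> V t; exists (trunc n.+1 (pad t)); rewrite trunc_truncE padK.
move=> V VT s; split=> [s0 x Vx|loc].
  have [c cx] := local_chart_cover T Vx.
  have [+ _] := trunc_trunc_eq0 (@fullO_sub _ _) (gv s c : Tsec F n.+1 (cdom c)).
  case=> [|m sm].
    exact: (congr1 (fun u : gsec (trunc_descent n) V => u c) s0).
  exists (cdom c), (csub c), m; split=> //.
  apply: (bij_inj ((glue_chart_iso (trunc_descent n.+1) (cind c)).2 _ (@subset_refl _ _))).
  rewrite [RHS](@glue_chart_gres _ _ _ _ _ _ c (s : gsec _ V)) sm.
  rewrite -[LHS]/(Ttop (mres (Ssh F n.+1) (@subset_refl _ _) m)).
  by rewrite mres_id.
apply: gsecP => c; apply: functional_extensionality_dep => p; apply: famP => x cx.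
have [W [WV [m [Wx Wm]]]] := loc x (csub c x cx).
(* The chart c and the neighbourhood W on which s comes from S^{n+1}(F) are unrelated; vanishing at
   x is tested in c restricted to their intersection. *)
pose Z := interO (cdom c) W.
have Zc : Z `<=` cdom c := @interOl _ _ _.
have ZW : Z `<=` W := @interOr _ _ _.
have Zx : Z x by [].
have /(congr1 (fun u : gsec (trunc_descent n.+1) W =>
  u (LocalChart ZW (chres Zc (cind c))))) /= := Wm.
have ZV := subset_trans ZW WV.
rewrite (gv_irr (s : gsec _ V) _ ZV) -(gv_res (s : gsec _ V) Zc ZV) => sZ.
have := (trunc_trunc_eq0 (@fullO_sub _ Z) (rres (Talg F n.+1) Zc (gv s c))).2
  (ex_intro _ (mres (Ssh F n.+1) ZW m) (esym sZ)).
rewrite (sapp_res (trunc_trunc F n) (@fullO_sub _ (cdom c)) Zc).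
move=> /(congr1 (fun u : Tsec F n Z => fval (u p) Zx)).
move=> e; apply: etrans e.
exact: (@fval_irr _ _ _ _ (trunc_trunc F n (cdom c) (@fullO_sub _ _) (gv s c) p)
  x cx (Zc x Zx)).
Qed.

End Jets.

Theorem mainTheorem4 (X : topologicalType) (OB : QSheaf X) (OX : algSheaf OB)
    (F : modSheaf OX) (D : smap fullO OX F)
    (D_derivation : is_derivation D)
    (D_locally_integrable : locally_integrable D)
    (D_rigid : forall (U : opens X) (f : smap U F (amod (Salg F))),
       linear_map f ->
       (forall (V : opens X) (VU : V `<=` U) (a : rsec OX V),
          f V VU (on_open D U V VU a) = (0 : msec (amod (Salg F)) V)) ->
       forall (V : opens X) (VU : V `<=` U) (m : msec F V),
         f V VU m = (0 : msec (amod (Salg F)) V)) :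
  let UU := fun U : opens X => integrable (on_open D U) in
  let C := fun U : opens X => iterated_hasse (on_open D U) in
  (forall U, UU U -> exists h, C U h) /\
  exists phi : forall U : opens X, smap U OX (Salg F) -> smap U OX (Salg F) ->
      smap U (Salg F) (Salg F),
    (forall U h h', UU U -> C U h -> C U h' ->
       unique (is_equivalence h h') (phi U h h')) /\
  exists (J : algSheaf OX) (tau : smap fullO OX J)
      (psi : forall U : opens X, smap U OX (Salg F) -> smap U J (Salg F)),
    [/\ base_alg_map tau,
        forall U h, UU U -> C U h -> alg_iso (psi U h),
        forall (U V : opens X) (VU : V `<=` U) h, UU U -> C U h ->
          psi V (srestr VU h) = srestr VU (psi U h),
        forall U h, UU U -> C U h ->
          scomp (psi U h) (on_open tau U) = h
      & forall U h h', UU U -> C U h -> C U h' ->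
          psi U h' = scomp (phi U h h') (psi U h)] /\
  exists (Jn : nat -> algSheaf OX) (q : forall n, smap fullO J (Jn n))
      (psin : forall n (U : opens X), smap U OX (Salg F) ->
         smap U (Jn n) (Talg F n)),
    [/\ forall n, alg_quotient (q n),
        forall n U h, UU U -> C U h ->
          alg_iso (psin n U h) /\
          forall (V : opens X) (VU : V `<=` U) (s : rsec J V),
            psin n U h V VU (on_open (q n) U V VU s) =
            trunc n (psi U h V VU s),
        exists e : smap fullO (self_alg OX) (Jn 0%N), alg_iso e
      & forall n, exists (p : smap fullO (Jn n.+1) (Jn n))
            (iota : smap fullO (Ssh F n.+1) (amod (Jn n.+1))),
          [/\ alg_quotient p,
              forall (V : opens X) (VT : V `<=` fullO) (s : rsec J V),
                p V VT (q n.+1 V VT s) = q n V VT s,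
              short_exact (G := amod (Jn n.+1)) (H := amod (Jn n)) iota p
            & forall U h, UU U -> C U h ->
              forall (V : opens X) (VU : V `<=` U) (m : msec (Ssh F n.+1) V),
                psin n.+1 U h V VU (on_open iota U V VU m) = Ttop m]].
Proof.
move=> UU C; split; first by move=> U; apply: integrable_chart.
have chartP U h : UU U -> C U h -> is_chart D h by move=> DU hU; split.
exists (fun U h h' => transition h h'); split=> [U h h' DU hU hU'|].
  have tP := transitionP D_derivation (chartP _ _ DU hU) (chartP _ _ DU hU').
  split=> // psi psiP.
  exact: (equivalence_unique D_rigid (chartP _ _ DU hU) tP psiP).
pose G := jet_descent D_derivation D_locally_integrable D_rigid.
pose Gn n := trunc_descent D_derivation D_locally_integrable D_rigid n.
exists (jets D_derivation D_locally_integrable D_rigid).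
exists (jet_tau D_derivation D_locally_integrable D_rigid).
exists (fun U h => jet_chart G h); split.
  split=> [|U h DU hU|U V VU h DU hU|U h DU hU|U h h' DU hU hU'].
  - exact: jet_tau_alg.
  - by rewrite (jet_chartE G (chartP _ _ DU hU)); apply: glue_chart_iso.
  - have hc := chartP _ _ DU hU.
    rewrite (jet_chartE G hc) (jet_chartE G (is_chart_restr VU hc)).
    rewrite -glue_chart_res; congr glue_chart; exact: hasse_chartP.
  - rewrite (jet_chartE G (chartP _ _ DU hU)); apply: smapP => V VU a.
    by rewrite /= (@rres_id _ OX); apply: (sapp_irr h).
  - rewrite (jet_chartE G (chartP _ _ DU hU)) (jet_chartE G (chartP _ _ DU hU')).
    exact: (glue_chart_trans G (exist _ h (chartP _ _ DU hU) : chart (hasse_atlas _ _) U)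
      (exist _ h' (chartP _ _ DU hU'))).
exists (njets D_derivation D_locally_integrable D_rigid).
exists (jet_quot D_derivation D_locally_integrable D_rigid).
exists (fun n U h => jet_chart (Gn n) h); split.
- move=> n; apply: glue_map_quotient; first exact: trunc_smap_alg.
  by move=> V t; exists (pad t); apply: padK.
- move=> n U h DU hU; rewrite (jet_chartE (Gn n) (chartP _ _ DU hU)).
  rewrite (jet_chartE G (chartP _ _ DU hU)); split; first exact: glue_chart_iso.
  by [].
- by exists (jet_const D_derivation D_locally_integrable D_rigid); apply: jet_const_iso.
move=> n; exists (njet_quot D_derivation D_locally_integrable D_rigid n).
exists (jet_top D_derivation D_locally_integrable D_rigid n.+1); split.
- apply: glue_map_quotient; first exact: trunc_trunc_alg.
  by move=> V t; exists (trunc n.+1 (pad t)); rewrite trunc_truncE padK.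
- by move=> V VT s; apply: gsecP => c; apply: trunc_truncE.
- exact: jet_top_exact.
- move=> U h DU hU V VU m; rewrite (jet_chartE (Gn n.+1) (chartP _ _ DU hU)).
  rewrite -[LHS]/(Ttop (mres (Ssh F n.+1) (@subset_refl _ V) m)).
  by rewrite mres_id.
Qed.
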